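(* Let $k=\mathbb{F}_q$ with $q=2^n$. Let $(E_1,E_2,E_3)$ be a triple of ordinary elliptic curves over $k$ with $j$-invariants $j_1,j_2,j_3$. Then $(E_1,E_2,E_3)$ admits an Artin-Schreier cover by a hyperelliptic genus $3$ curve if and only if $$\frac{1}{j_1}+\frac{1}{j_2}+\frac{1}{j_3}=0.$$
   Context: A curve means a smooth, projective, absolutely irreducible curve. An Artin-Schreier cover of a triple $(E_1,E_2,E_3)$ of elliptic curves over $k$ is a commutative diagram consisting of a genus $3$ curve $C$ over $k$, maps $C\to E_i$ and $E_i\to\mathbb{P}^1$ ($i=1,2,3$) with all composites $C\to E_i\to\mathbb{P}^1$ equal, where all maps are separable degree two morphisms defined over $k$; ''by a hyperelliptic genus 3 curve'' means $C$ is hyperelliptic.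
   Formalization: An Artin-Schreier cover is also required to have E_1, E_2, E_3 pairwise distinct as intermediate covers of C → P^1; otherwise one map C → E → P^1 used three times would cover (E,E,E), although 3/j(E) = 1/j(E) ≠ 0. *)

(* Defs.v *)
From HB Require Import structures.
From mathcomp Require Import all_boot all_order all_algebra all_field.
From mathcomp Require Import zify ring.

Set Implicit Arguments.
Unset Strict Implicit.
Unset Printing Implicit Defensive.

Import GRing.Theory.
Local Open Scope ring_scope.
Local Open Scope quotient_scope.

(** A smooth projective curve X over k is given by its function field k(X),
    seen as an extension of k; a nonconstant k-morphism X -> Y is given by its
    pullback, a k-embedding k(Y) -> k(X).  The closed points of X are recovered
    as the valuation rings of k(X) over k, which are the local rings of X. *)

Record curve_data (k : fieldType) := CurveData {
  funfield :> fieldType;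
  cst : {rmorphism k -> funfield}
}.

Record curve_map (k : fieldType) (X Y : curve_data k) := CurveMap {
  pullback : {rmorphism Y -> X};
  pullback_cst : forall a : k, pullback (cst Y a) = cst X a
}.

Definition has_degree (K L : fieldType) (phi : {rmorphism K -> L}) (d : nat) :=
  exists b : 'I_d -> L,
    forall z : L, exists! c : 'rV[K]_d, z = \sum_(i < d) phi (c 0 i) * b i.

Definition separable_extension (K L : fieldType) (phi : {rmorphism K -> L}) :=
  forall z : L, exists2 p : {poly K}, separable_poly p & root (map_poly phi p) z.

Definition separable_degree2 (k : fieldType) (X Y : curve_data k)
    (f : curve_map X Y) :=
  has_degree (pullback f) 2 /\ separable_extension (pullback f).

Definition proj_line (k : fieldType) : curve_data k :=
  CurveData (@FracField.tofrac {poly k} \o polyC).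

(* k(X) is a finite extension of a rational function field k(t), in which k is
   algebraically closed.  For k perfect, in particular for k finite, the latter
   means that X is absolutely irreducible. *)
Definition is_curve (k : fieldType) (X : curve_data k) :=
  (exists (d : nat) (f : curve_map X (proj_line k)), has_degree (pullback f) d)
  /\ (forall z : X, algebraicOver (cst X) z -> exists a : k, z = cst X a).

Record derivation (k : fieldType) (X : curve_data k) := Derivation {
  der :> X -> X;
  derD : forall u v, der (u + v) = der u + der v;
  derM : forall u v, der (u * v) = der u * v + u * der v;
  der_cst : forall a : k, der (cst X a) = 0
}.

Record is_valuation_ring (k : fieldType) (X : curve_data k) (O : X -> Prop) :
    Prop := IsValuationRing {
  vring_cst : forall a : k, O (cst X a);
  vring_add : forall u v, O u -> O v -> O (u + v);
  vring_mul : forall u v, O u -> O v -> O (u * v);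
  vring_inv : forall u, O u \/ O u^-1;
  vring_proper : exists u, ~ O u
}.

(* A rational differential w of X is seen as the function D |-> <w, D> on
   Der_k(k(X)), so that (f dt)(D) = f * D t.  Since Der_k(k(X)) is the
   k(X)-linear dual of the module of Kaehler differentials of k(X)/k, this
   identifies that module with a submodule of functions. *)
Definition differential (k : fieldType) (X : curve_data k) := derivation X -> X.

(* w lies in the image of the Kaehler differentials of O/k. *)
Definition regular_at (k : fieldType) (X : curve_data k) (O : X -> Prop)
    (w : differential X) :=
  exists (n : nat) (f t : 'I_n -> X),
    [/\ forall i, O (f i), forall i, O (t i)
      & forall D : derivation X, w D = \sum_(i < n) f i * D (t i)].

Definition regular (k : fieldType) (X : curve_data k) (w : differential X) :=
  forall O : X -> Prop, is_valuation_ring O -> regular_at O w.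

(* dim_k H^0(X, Omega) = g *)
Definition has_genus (k : fieldType) (X : curve_data k) (g : nat) :=
  exists w : 'I_g -> differential X,
    (forall i, regular (w i))
    /\ (forall v : differential X, regular v ->
          exists! c : 'rV[k]_g,
            forall D, v D = \sum_(i < g) cst X (c 0 i) * w i D).

Definition hyperelliptic (k : fieldType) (X : curve_data k) :=
  (exists2 g : nat, (2 <= g)%N & has_genus X g)
  /\ (exists f : curve_map X (proj_line k), separable_degree2 f).

(* The equation y^2 + a1 x y + a3 y = x^3 + a2 x^2 + a4 x + a6 *)

Record weierstrass (R : Type) := Weierstrass { a1 : R; a2 : R; a3 : R; a4 : R; a6 : R }.

Definition map_weierstrass (R S : Type) (f : R -> S) (W : weierstrass R) :=
  Weierstrass (f (a1 W)) (f (a2 W)) (f (a3 W)) (f (a4 W)) (f (a6 W)).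

Section Invariants.

Variables (R : comNzRingType) (W : weierstrass R).

Definition b2 := a1 W ^+ 2 + 4 * a2 W.
Definition b4 := 2 * a4 W + a1 W * a3 W.
Definition b6 := a3 W ^+ 2 + 4 * a6 W.
Definition b8 := a1 W ^+ 2 * a6 W + 4 * a2 W * a6 W - a1 W * a3 W * a4 W
                 + a2 W * a3 W ^+ 2 - a4 W ^+ 2.
Definition c4 := b2 ^+ 2 - 24 * b4.
Definition disc := - b2 ^+ 2 * b8 - 8 * b4 ^+ 3 - 27 * b6 ^+ 2 + 9 * b2 * b4 * b6.

End Invariants.

Section Points.

Variables (K : fieldType) (W : weierstrass K).

(* None is the point at infinity *)
Definition on_curve (P : option (K * K)) : bool :=
  if P is Some (x, y) then
    y ^+ 2 + a1 W * x * y + a3 W * y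
      == x ^+ 3 + a2 W * x ^+ 2 + a4 W * x + a6 W
  else true.

Definition line_slope (x1 y1 x2 y2 : K) : K :=
  if x1 == x2 then
    (3 * x1 ^+ 2 + 2 * a2 W * x1 + a4 W - a1 W * y1)
      / (2 * y1 + a1 W * x1 + a3 W)
  else (y2 - y1) / (x2 - x1).

Definition add_point (P Q : option (K * K)) : option (K * K) :=
  match P, Q with
  | None, _ => Q
  | _, None => P
  | Some (x1, y1), Some (x2, y2) =>
      if (x1 == x2) && (y1 + y2 + a1 W * x2 + a3 W == 0) then None
      else
        let l := line_slope x1 y1 x2 y2 in
        let x3 := l ^+ 2 + a1 W * l - a2 W - x1 - x2 in
        Some (x3, - (l + a1 W) * x3 - (y1 - l * x1) - a3 W)
  end.

Definition mul_point (n : nat) (P : option (K * K)) := iter n (add_point P) None.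

End Points.

Record elliptic_curve (k : fieldType) := EllipticCurve {
  equation :> weierstrass k;
  disc_neq0 : disc equation != 0
}.

Definition j_invariant (k : fieldType) (E : elliptic_curve k) : k :=
  c4 E ^+ 3 / disc E.

(* In characteristic p > 0, E is ordinary when E[p] is nontrivial over an
   algebraic closure K of k. *)
Definition ordinary (k : fieldType) (E : elliptic_curve k) :=
  exists2 p : nat, p \in [pchar k] &
  exists (K : closedFieldType) (f : {rmorphism k -> K}),
    integralRange f /\
    let EK := map_weierstrass f E in
    exists P : option (K * K),
      [/\ on_curve EK P, P <> None & mul_point EK p P = None].

(* The equation of E as a polynomial in y over k(x) *)
Definition weierstrass_poly (k : fieldType) (W : weierstrass k) :
    {poly {fraction {poly k}}} :=
  let A : {poly k} := (a1 W)%:P * 'X + (a3 W)%:P in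
  let B : {poly k} :=
    'X^3 + (a2 W)%:P * 'X^2 + (a4 W)%:P * 'X + (a6 W)%:P in
  'X^2 + (FracField.tofrac A)%:P * 'X - (FracField.tofrac B)%:P.


Lemma fracE (R : idomainType) (z : {fraction R}) :
  exists n d : R, d != 0 /\ z = FracField.tofrac n / FracField.tofrac d.
Proof.
elim/quotW: z => r; exists (frac r).1, (frac r).2.
have nz := denom_ratioP r; split=> //.
have nzF : FracField.tofrac (frac r).2 != 0 by rewrite tofrac_eq0.
apply: (mulIf nzF); rewrite divfK //.
rewrite !piE; apply/eqmodP; rewrite /= FracField.equivfE /FracField.mulf.
by rewrite !numden_Ratio ?mulr1 ?oner_neq0 // mulrC.
Qed.

Lemma clear_denom (K : fieldType) (n d A B : K) :
  d != 0 -> (n / d) ^+ 2 + A * n / d = B -> n * n + A * n * d = B * (d * d).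
Proof. by move=> nzd <-; field. Qed.

Section WeierstrassPoly.

Variables (k : fieldType) (W : weierstrass k).

Lemma size_weierstrass_poly : size (weierstrass_poly W) = 3%N.
Proof.
rewrite /weierstrass_poly -addrA size_polyDl ?size_polyXn //.
rewrite (leq_ltn_trans (size_polyD _ _)) // gtn_max size_polyN.
rewrite (leq_ltn_trans (size_polyC_leq1 _)) // andbT mul_polyC.
by rewrite (leq_ltn_trans (size_scale_leq _ _)) // size_polyX.
Qed.

Lemma weierstrass_poly_monic : weierstrass_poly W \is monic.
Proof.
rewrite monicE /lead_coef size_weierstrass_poly /= /weierstrass_poly.
by rewrite coefB coefD coefXn coefCM coefX coefC mulr0 subr0 addr0.
Qed.

Lemma weierstrass_poly_noroot z : ~~ root (weierstrass_poly W) z.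
Proof.
apply/negP; have [n [d [nzd ->]]] := fracE z.
rewrite rootE /weierstrass_poly.
set A := (_ * 'X + _); set B := 'X^3 + _ + _ + _.
have sA : (size A <= 2)%N.
  rewrite (leq_trans (size_polyD _ _)) // geq_max.
  rewrite (leq_trans (size_polyC_leq1 _)) // andbT mul_polyC.
  by rewrite (leq_trans (size_scale_leq _ _)) // size_polyX.
have sB : size B = 4%N.
  rewrite /B -!addrA size_polyDl ?size_polyXn //.
  rewrite (leq_ltn_trans (size_polyD _ _)) // gtn_max !mul_polyC.
  rewrite (leq_ltn_trans (size_scale_leq _ _)) ?size_polyXn //=.
  rewrite (leq_ltn_trans (size_polyD _ _)) // gtn_max.
  rewrite (leq_ltn_trans (size_scale_leq _ _)) ?size_polyX //=.
  by rewrite (leq_ltn_trans (size_polyC_leq1 _)).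
have nzdF : FracField.tofrac d != 0 by rewrite tofrac_eq0.
rewrite !hornerE subr_eq0 => /eqP E.
have {E}: n ^+ 2 + A * n * d = B * d ^+ 2.
  apply/eqP; rewrite -tofrac_eq !expr2 tofracD !tofracM; apply/eqP.
  exact: (clear_denom nzdF E).
have nzB : B != 0 by rewrite -size_poly_gt0 sB.
have sd : (0 < size d)%N by rewrite size_poly_gt0.
have sR : size (B * d ^+ 2) = ((size d).*2 + 2)%N.
  rewrite size_mul ?expf_neq0 // sB expr2 size_mul //; lia.
have [->|nzn] := eqVneq n 0.
  by rewrite expr0n mulr0 mul0r addr0 => /eqP; rewrite eq_sym mulf_eq0 (negPf nzB) expf_eq0 (negPf nzd).
have sn : (0 < size n)%N by rewrite size_poly_gt0.
have sN : size (n ^+ 2) = ((size n).*2 - 1)%N.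
  rewrite expr2 size_mul //; lia.
have sM : (size (A * n * d)%R <= size n + size d)%N.
  rewrite (leq_trans (size_polyMleq _ _)) // -subn1 leq_subLR addnA.
  rewrite leq_add2r (leq_trans (size_polyMleq _ _)) // -subn1 leq_subLR addnA.
  by rewrite leq_add2r.
move=> /(congr1 (fun p : {poly k} => size p)); rewrite sR.
have := size_polyD (n ^+ 2) (A * n * d).
have := @size_polyDl _ (n ^+ 2) (A * n * d).
rewrite sN; move: sM sn sd.
move: (size (n ^+ 2 + A * n * d)) (size (A * n * d)) (size n) (size d).
move=> s4 s1 s2 s3.
by case: (ltnP s1 (s2.*2 - 1)) => [lt _ _ _ /(_ isT) -> _|le le' _ _ _]; lia.
Qed.

Lemma weierstrass_poly_irreducible : monic_irreducible_poly (weierstrass_poly W).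
Proof.
split; last exact: weierstrass_poly_monic.
apply: cubic_irreducible; first by rewrite size_weierstrass_poly.
exact: weierstrass_poly_noroot.
Qed.

End WeierstrassPoly.

Definition ell_curve (k : fieldType) (E : elliptic_curve k) : curve_data k :=
  @CurveData k {poly %/ weierstrass_poly E with weierstrass_poly_irreducible E}
    (qpolyC (weierstrass_poly E) \o cst (proj_line k)).

Record artin_schreier_cover (k : fieldType) (E : 'I_3 -> elliptic_curve k)
    (C : curve_data k) := ArtinSchreierCover {
  cover_map : forall i, curve_map C (ell_curve (E i));
  base_map : forall i, curve_map (ell_curve (E i)) (proj_line k);
  cover_map_deg2 : forall i, separable_degree2 (cover_map i);
  base_map_deg2 : forall i, separable_degree2 (base_map i);
  cover_comm : forall i j,
    pullback (cover_map i) \o pullback (base_map i)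
      =1 pullback (cover_map j) \o pullback (base_map j);
  (* The three E i are distinct as intermediate covers of C -> P^1, that is, the
     k(E i) have distinct images in k(C); the diagram cannot repeat a vertex. *)
  cover_distinct : forall i j, i != j ->
    ~ (forall u : ell_curve (E i), exists v : ell_curve (E j),
         pullback (cover_map i) u = pullback (cover_map j) v)
}.

(* Main.v *)
(** Everything takes place inside the function field of C.  Let x be the common
    coordinate on the line.  An ordinary elliptic curve over k is, as a double cover
    of the x-line, w^2 + w = S^2/A + e with A = a x^2 + x + d, S linear, and the
    fourth power of the resultant of S and A is 1/j.

    If C covers the triple, its three functions w_i add up to a constant, and the
    differentials dx/A_i and w_i dx/A_j are regular.  The trace to the line of a
    regular differential vanishes, so quotients of regular differentials lie in the
    rational subfield k(s) of the hyperelliptic map.  If two A_i were different, this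
    would put x, hence some k(E_i), in k(s), against Lueroth (proved by a
    Fermat-type descent on the equation of E_i).  So the A_i agree, the S_i are
    dependent, and the resultants, which are then additive, sum to zero.

    Conversely choose g_i with g_i^8 = 1/j_i, so that g_0 + g_1 + g_2 = 0.  After a
    change of coordinate E_i is w^2 + w = g_i^2/(t^2 + t + eps) + e_i with
    e_0 + e_1 + e_2 = 0 and a common eps; that both can be arranged over k uses that
    the values of z^2 + z have index two in the finite field k.  Then
    s = g_1 w_0 + g_0 w_1 satisfies w_i = (g_i/delta) (s^2 + g_i s + kappa), and
    1/(t^2 + t + eps) is a separable quartic U in s: the compositum C of the E_i is
    t^2 + t = 1/U(s) + eps, hyperelliptic of genus 3. *)

From HB Require Import structures.
Require Import Defs.
From Stdlib Require Import ZArith Ring_polynom Field_theory.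
From mathcomp Require Import all_boot all_order all_algebra all_field.
From mathcomp Require Import ssrZ zify ring common boolp classical_sets.

Set Implicit Arguments.
Unset Strict Implicit.
Unset Printing Implicit Defensive.

Import GRing.Theory.
Local Open Scope ring_scope.

(** * Ring and field tactics in characteristic two *)

Import mathcomp.algebra_tactics.ring.Internals.

(** Regularity of a differential is given one valuation ring at a time, while the vanishing of its
    trace is a global statement. The bridge is the integral closure of [k[s]], taken as an
    intersection of valuation rings: Chevalley's theorem yields enough rings to spread regularity
    over a whole chart, and [s], [s^-1] give the two charts. Quotients of regular differentials lie
    in [k(s)] for the same reason that the canonical map of a hyperelliptic curve factors through
    the line. The resultant is the right invariant because coordinate changes on the line preserve
    it, once [A] is rescaled to middle coefficient [1] and [S] by a matching square root. For a
    fixed [A] it is a quadratic form in [S] whose polar form is the determinant of two linear forms,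
    so it is additive on [S_0 + S_1] exactly when [S_0] and [S_1] are proportional. The eighth roots
    come from the resultant of a constant [g] with [t^2 + t + eps], which is [g^2]. *)

(* Comparing the integer coefficients of normal forms modulo two makes [ring] and [field]
   decide identities that hold in characteristic two, whenever [2 = 0] is an assumption. *)
Definition eqb_mod2 (a b : Z) := Z.even (a - b).

Lemma intr_eqb_mod2 (R : pzRingType) : 2 = 0 :> R ->
  forall a b, eqb_mod2 a b -> (int_of_Z a)%:~R = (int_of_Z b)%:~R :> R.
Proof.
move=> two0 a b /Z.even_spec [c hc]; apply/eqP; rewrite -subr_eq0 -rmorphB /=.
have -> : int_of_Z a - int_of_Z b = 2 * int_of_Z c by lia.
by rewrite rmorphM /= [2%:~R](_ : _ = 2) // two0 mul0r.
Qed.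

Lemma ring_morph_mod2 (R : pzRingType) : 2 = 0 :> R ->
  @ring_morph R 0 1 +%R *%R (fun x y => x - y) -%R eq
    Z Z0 (Zpos xH) Z.add Z.mul Z.sub Z.opp eqb_mod2 (fun n => (int_of_Z n)%:~R).
Proof.
move=> two0; have RZ := RZ R; split; [exact: (morph0 RZ)|exact: (morph1 RZ)|
  exact: (morph_add RZ)|exact: (morph_sub RZ)|exact: (morph_mul RZ)|
  exact: (morph_opp RZ)|exact: intr_eqb_mod2].
Qed.

Lemma ring_correct_char2 (R : comPzRingType) (n : nat) (l : seq R)
    (lpe : seq (RExpr R * RExpr R * PExpr Z * PExpr Z))
    (re1 re2 : RExpr R) (pe1 pe2 : PExpr Z) :
  2 = 0 :> R ->
  Reval_eqs lpe ->
  (forall R_of_Z zero opp add sub one mul exp,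
      Ring.Rnorm R_of_Z zero add opp sub one mul exp id re1 ::
      Ring.Rnorm R_of_Z zero add opp sub one mul exp id re2 ::
      Rnorm_list R_of_Z zero add opp sub one mul exp lpe =
      PEeval zero one add mul sub opp R_of_Z id exp l pe1 ::
      PEeval zero one add mul sub opp R_of_Z id exp l pe2 ::
      PEeval_list R_of_Z zero opp add sub one mul exp l lpe) ->
  (let div := triv_div Z0 (Zpos xH) eqb_mod2 in
   let norm := norm_subst Z0 (Zpos xH) Z.add Z.mul Z.sub Z.opp eqb_mod2 div n
     (mk_monpol_list Z0 (Zpos xH) Z.add Z.mul Z.sub Z.opp eqb_mod2 div
        (map (fun '(_, _, lhs, rhs) => (lhs, rhs)) lpe)) in
   Ring_polynom.Peq eqb_mod2 (norm pe1) (norm pe2)) ->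
  Reval re1 = Reval re2.
Proof.
move=> two0 Hlpe' /(_ (fun n => (int_of_Z n)%:~R) 0 -%R +%R (fun x y => x - y)).
move=> /(_ 1 *%R (fun x n => x ^+ nat_of_N n)) /=.
rewrite -!Ring.Rnorm_correct => -[-> -> Hlpe].
have RE := Eq_ext +%R *%R (@GRing.opp R).
have RA := Rth_ARth (Eqsth R) RE (RR R).
have RM := ring_morph_mod2 two0.
apply: (Ring_polynom.ring_correct (Eqsth R) RE RA RM (PN R)
          (triv_div_th (Eqsth R) RE RA RM)).
elim: lpe Hlpe Hlpe' => [|[[[r1 r2] p1] p2] lpe IH] //=.
rewrite -!Ring.Rnorm_correct => -[-> ->] Hlpe [Hpe /(IH Hlpe)] {IH Hlpe} /=.
by case: lpe.
Qed.

Lemma field_correct_char2 (F : fieldType) (n : nat) (l : seq F)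
    (lpe : seq (RExpr F * RExpr F * PExpr Z * PExpr Z))
    (re1 re2 : RExpr F) (fe1 fe2 : FExpr Z) :
  2 = 0 :> F ->
  Reval_eqs lpe ->
  (forall R_of_Z zero opp add sub one mul exp div inv,
      Field.Rnorm R_of_Z zero add opp sub one mul exp inv id re1 ::
      Field.Rnorm R_of_Z zero add opp sub one mul exp inv id re2 ::
      Rnorm_list R_of_Z zero add opp sub one mul exp lpe =
      FEeval zero one add mul sub opp div inv R_of_Z id exp l fe1 ::
      FEeval zero one add mul sub opp div inv R_of_Z id exp l fe2 ::
      PEeval_list R_of_Z zero opp add sub one mul exp l lpe) ->
  (forall is_true_ negb_ andb_ zero one add mul sub opp Feqb F_of_nat exp l',
      is_true_ = is_true -> negb_ = negb -> andb_ = andb ->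
      zero = 0 -> one = 1 -> add = +%R -> mul = *%R ->
      sub = (fun x y => x - y) -> opp = -%R -> Feqb = eq_op ->
      F_of_nat = GRing.natmul 1 -> exp = @GRing.exp F -> l' = l ->
      let F_of_pos p := if p is xH then one else F_of_nat (Pos.to_nat p) in
      let F_of_Z n :=
        match n with
          Z0 => zero | Zpos p => F_of_pos p | Zneg p => opp (F_of_pos p)
        end
      in
      let div := triv_div Z0 (Zpos xH) eqb_mod2 in
      let norm :=
        norm_subst Z0 (Zpos xH) Z.add Z.mul Z.sub Z.opp eqb_mod2 div n
          (mk_monpol_list Z0 (Zpos xH) Z.add Z.mul Z.sub Z.opp eqb_mod2 div
             (map (fun '(_, _, lhs, rhs) => (lhs, rhs)) lpe)) in
      let nf := Field_theory.Fnorm Z0 (Zpos xH) Z.add Z.mul Z.sub Z.opp eqb_mod2 in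
      Ring_polynom.Peq eqb_mod2 (norm (PEmul (num (nf fe1)) (denum (nf fe2))))
                   (norm (PEmul (num (nf fe2)) (denum (nf fe1)))) /\
      is_true_ (PCond' true negb_ andb_
                  zero one add mul sub opp Feqb F_of_Z nat_of_N exp l'
                  (Fapp (Fcons00 Z0 (Zpos xH) Z.add Z.mul Z.sub Z.opp eqb_mod2 div)
                     (condition (nf fe1) ++ condition (nf fe2)) [::]))) ->
  Reval re1 = Reval re2.
Proof.
move=> two0 Hlpe' /(_ (fun n => (int_of_Z n)%:~R) 0 -%R +%R (fun x y => x - y)).
move=> /(_ 1 *%R (fun x n => x ^+ nat_of_N n) (fun x y => x / y) GRing.inv).
rewrite -!Field.Rnorm_correct => -[-> -> Hlpe].
move=> /(_ _ _ _ _ _ _ _ _ _ _ _ _ _ erefl erefl erefl erefl erefl erefl erefl).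
move=> /(_ _ _ _ _ _ _ erefl erefl erefl erefl erefl erefl) [Heq Hcond].
have RE := Eq_ext +%R *%R (@GRing.opp F).
have AF := F2AF (Eqsth F) RE (RF F).
have RA := Rth_ARth (Eqsth F) RE (RR F).
have RM := ring_morph_mod2 two0.
have FC := Field_correct (Eqsth F) RE (congr1 GRing.inv) AF RM (PN F)
  (triv_div_th (Eqsth F) RE RA RM).
apply: (FC _ _ _ _ _ _ _ erefl _ erefl _ erefl Heq).
  elim: lpe Hlpe Hlpe' {Heq Hcond} => [|[[[r1 r2] p1] p2] lpe IH] //=.
  rewrite -!Ring.Rnorm_correct => -[-> ->] Hlpe [Hpe /(IH Hlpe)] {IH Hlpe} /=.
  by case: lpe.
apply: (Pcond_simpl_gen (Eqsth F) RE AF RM (PN F)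
          (triv_div_th (Eqsth F) RE RA RM)).
by move=> _ ->; exact/PCondP.
Qed.

(** Coefficients modulo two are tried as soon as the context has a fact [2 = 0], with the usual
    procedure as fallback. Hence the sections keep such a fact for each field in which they
    compute. *)
Ltac ring_reflection ::=
  fun Lem R VarMap Lpe RE1 RE2 PE1 PE2 LpeProofs =>
  first [
    match goal with
    | two0 : 2 = 0 |- _ =>
      exact (@ring_correct_char2 _ 100%N VarMap Lpe RE1 RE2 PE1 PE2 two0 LpeProofs
               ltac:(reflexivity) ltac:(vm_compute; reflexivity))
    end
  | ring_reflection_check Lem R VarMap Lpe RE1 RE2 PE1 PE2 LpeProofs ].

Ltac field_reflection ::=
  fun Lem F VarMap Lpe RE1 RE2 PE1 PE2 LpeProofs =>
  first [
    match goal with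
    | two0 : 2 = 0 |- _ =>
      refine (@field_correct_char2 F 100%N VarMap Lpe RE1 RE2 PE1 PE2 two0 LpeProofs
                ltac:(reflexivity) ltac:(field_normalization))
    end
  | field_reflection_check Lem F VarMap Lpe RE1 RE2 PE1 PE2 LpeProofs ].

(** * Artin-Schreier extensions of degree two *)

Section CharTwo.
Variable (R : pzRingType).
Hypothesis two0 : 2 = 0 :> R.

Lemma oppr2 (x : R) : - x = x.
Proof.
apply/eqP; rewrite -subr_eq0 -opprD oppr_eq0.
by rewrite -mulr2n -mulr_natl two0 mul0r.
Qed.

Lemma addrr2 (x : R) : x + x = 0.
Proof. by rewrite -mulr2n -mulr_natl two0 mul0r. Qed.

Lemma addr2_eq0 (x y : R) : x + y = 0 -> x = y.
Proof. by move=> e; apply/eqP; rewrite -subr_eq0 oppr2 e. Qed.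
End CharTwo.

Lemma rmorph_two0 (R S : pzRingType) (f : {rmorphism R -> S}) :
  2 = 0 :> R -> 2 = 0 :> S.
Proof. by move=> h; rewrite -(rmorph_nat f) h rmorph0. Qed.

Lemma sqr2_inj (R : idomainType) : 2 = 0 :> R -> injective (fun x : R => x ^+ 2).
Proof.
move=> two0 x y /= e; apply: (addr2_eq0 two0); apply/eqP.
by rewrite -sqrf_eq0; apply/eqP; transitivity (x^+2 + y^+2); [ring|rewrite e addrr2].
Qed.

Section Subfields.
Variable K : fieldType.

(** Subfields are predicates on one ambient field, because many intermediate fields of a single
    function field have to be compared. *)
Record subfield (P : K -> Prop) : Prop := Subfield {
  sf1 : P 1;
  sfB : forall u v, P u -> P v -> P (u - v);
  sfdiv : forall u v, P u -> P v -> P (u / v)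
}.

Variables (P : K -> Prop) (sP : subfield P).

Lemma sf0 : P 0. Proof. by rewrite -(subrr 1); apply: sfB sP _ _ (sf1 sP) (sf1 sP). Qed.
Lemma sfN u : P u -> P (- u).
Proof. by move=> h; rewrite -sub0r; apply: sfB sP _ _ sf0 h. Qed.
Lemma sfD u v : P u -> P v -> P (u + v).
Proof. by move=> hu hv; rewrite -[v]opprK; apply: sfB sP _ _ hu (sfN hv). Qed.
Lemma sfV u : P u -> P u^-1.
Proof. by move=> h; rewrite -div1r; apply: sfdiv sP _ _ (sf1 sP) h. Qed.
Lemma sfM u v : P u -> P v -> P (u * v).
Proof. by move=> hu hv; rewrite -[v]invrK; apply: sfdiv sP _ _ hu (sfV hv). Qed.
Lemma sfX u n : P u -> P (u ^+ n).
Proof. by move=> h; elim: n => [|n IH]; rewrite ?expr0 ?exprS; [exact: sf1|exact: sfM]. Qed.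
Lemma sf_nat n : P n%:R.
Proof. by elim: n => [|n IH]; [exact: sf0|rewrite -natr1; apply: sfD IH (sf1 sP)]. Qed.

End Subfields.

Lemma subfield_image (K L : fieldType) (f : {rmorphism K -> L}) :
  subfield (fun z => exists u, z = f u).
Proof.
split; first by exists 1; rewrite rmorph1.
  by move=> _ _ [u ->] [v ->]; exists (u - v); rewrite rmorphB.
by move=> _ _ [u ->] [v ->]; exists (u / v); rewrite fmorph_div.
Qed.

Ltac sf_tac sP :=
  repeat first [ assumption | exact: (sf0 sP) | exact: (sf1 sP) | exact: (sf_nat sP)
    | apply: (sfD sP) | apply: (sfM sP) | apply: (sfN sP) | apply: (sfV sP) | apply: (sfX sP) ].

Section ArtinSchreier.
Variables (K : fieldType) (P : K -> Prop) (sP : subfield P).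
Hypothesis two0 : 2 = 0 :> K.

Definition AS_gen (y : K) :=
  [/\ P (y ^+ 2 + y), ~ P y & forall z, exists a b, [/\ P a, P b & z = a + b * y]].

Lemma AS_uniq y a b a' b' : ~ P y -> P a -> P b -> P a' -> P b' ->
  a + b * y = a' + b' * y -> a = a' /\ b = b'.
Proof.
move=> ny Pa Pb Pa' Pb' e.
have e1 : (b - b') * y = a' - a by rewrite mulrBl -(addKr a (b * y)) e; ring.
have [eb|nb] := eqVneq (b - b') 0.
  move/eqP: eb e1; rewrite subr_eq0 => /eqP ->; rewrite subrr mul0r => /esym/eqP.
  by rewrite subr_eq0 => /eqP ->.
case: ny; rewrite -[y](mulKf nb) e1; sf_tac sP.
Qed.

(** The coefficient of [y] in [w ^ 2 + w] is [b ^ 2 + b]. So, up to the base field, a quadratic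
    extension has only one Artin-Schreier generator. *)
Lemma AS_linear y a b : P (y ^+ 2 + y) -> ~ P y -> P a -> P b ->
  P ((a + b * y) ^+ 2 + (a + b * y)) -> b = 0 \/ b = 1.
Proof.
move=> Pf ny Pa Pb Pw.
have e : (a + b * y) ^+ 2 + (a + b * y)
  = (a ^+ 2 + a + b ^+ 2 * (y ^+ 2 + y)) + (b ^+ 2 + b) * y by ring.
have [] := @AS_uniq y ((a + b * y) ^+ 2 + (a + b * y)) 0
   (a ^+ 2 + a + b ^+ 2 * (y ^+ 2 + y)) (b ^+ 2 + b) ny.
- by [].
- by sf_tac sP.
- by sf_tac sP.
- by sf_tac sP.
- by rewrite mul0r addr0.
move=> _ /esym/eqP; rewrite expr2 -[X in _ + X]mulr1 -mulrDr mulf_eq0 => /orP[/eqP|/eqP e2].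
  by left.
by right; apply: (addr2_eq0 two0).
Qed.

Lemma AS_shift y w : AS_gen y -> P (w ^+ 2 + w) -> P w \/ P (w + y).
Proof.
move=> [Pf ny span] Pw; have [a [b [Pa Pb ew]]] := span w.
rewrite ew in Pw *; case: (AS_linear Pf ny Pa Pb Pw) => ->.
  by left; rewrite mul0r addr0.
by right; rewrite mul1r -addrA addrr2 // addr0.
Qed.

(** The coefficient of [y] in [(a + b y) ^ 2] is [b ^ 2]: a separable quadratic extension acquires
    no new square roots. *)
Lemma AS_sqr y z : AS_gen y -> P (z ^+ 2) -> P z.
Proof.
move=> [Pf ny span] Pw; have [a [b [Pa Pb ew]]] := span z; subst z.
have [] := @AS_uniq y ((a + b * y) ^+ 2) 0
   (a ^+ 2 + b ^+ 2 * (y ^+ 2 + y)) (b ^+ 2) ny.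
- by [].
- by sf_tac sP.
- by sf_tac sP.
- by sf_tac sP.
- by ring.
by move=> _ /esym/eqP; rewrite sqrf_eq0 => /eqP ->; rewrite mul0r addr0.
Qed.

Definition span2 (y z : K) := exists a b, [/\ P a, P b & z = a + b * y].

Lemma span2_base y z : P z -> span2 y z.
Proof. by move=> h; exists z, 0; split; sf_tac sP; rewrite mul0r addr0. Qed.
Lemma span2_gen y : span2 y y.
Proof. by exists 0, 1; split; sf_tac sP; rewrite mul1r add0r. Qed.

Lemma span2_subfield y : P (y ^+ 2 + y) -> ~ P y -> subfield (span2 y).
Proof.
move=> Pf ny.
have M u v : span2 y u -> span2 y v -> span2 y (u * v).
  move=> [a [b [Pa Pb ->]]] [a' [b' [Pa' Pb' ->]]].
  exists (a * a' + b * b' * (y ^+ 2 + y)), (a * b' + b * a' + b * b').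
  by split; sf_tac sP; ring.
split; first by apply: span2_base; apply: sf1.
  move=> _ _ [a [b [Pa Pb ->]]] [a' [b' [Pa' Pb' ->]]].
  by exists (a - a'), (b - b'); split; [exact: sfB sP _ _ _ _|exact: sfB sP _ _ _ _|ring].
move=> u v Mu [a [b [Pa Pb ev]]]; apply: M => //; subst v.
(* [N] is the norm of [a + b y], whose conjugate under [y |-> y + 1] is [a + b + b y]. *)
pose N := a ^+ 2 + a * b + b ^+ 2 * (y ^+ 2 + y).
have PN : P N by rewrite /N; sf_tac sP.
have eN : (a + b * y) * (a + b + b * y) = N by rewrite /N; ring.
have [z|nz] := eqVneq (a + b * y) 0.
  by rewrite z invr0; apply: span2_base; apply: sf0.
have nN : N != 0.
  rewrite -eN mulf_neq0 //; apply: contraNneq nz => z.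
  have [] := @AS_uniq y (a + b) b 0 0 ny; try by sf_tac sP.
    by rewrite z mul0r addr0.
  move=> + b0; rewrite b0 addr0 => ->; by rewrite mul0r addr0.
exists ((a + b) / N), (b / N); split; sf_tac sP.
apply: (mulfI nz); rewrite mulfV //.
transitivity ((a + b * y) * (a + b + b * y) / N); first by rewrite eN divff.
by ring.
Qed.

End ArtinSchreier.

Definition evp (k K : fieldType) (c : {rmorphism k -> K}) (x : K) : {poly k} -> K :=
  horner_eval x \o map_poly c.
HB.instance Definition _ (k K : fieldType) (c : {rmorphism k -> K}) (x : K) :=
  GRing.RMorphism.copy (evp c x) (horner_eval x \o map_poly c).

Lemma irreducible_divisor (k : fieldType) (p : {poly k}) : (1 < size p)%N ->
  exists2 q, irreducible_poly q & q %| p.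
Proof.
move: {2}(size p) (leqnn (size p)) => n; elim: n p => [|n IH] p; first by lia.
move=> sn s1; have [h|h] := pselect (irreducible_poly p); first by exists p.
have [q [q1 qp sq]] : exists q : {poly k}, [/\ (1 < size q)%N, q %| p & (size q < size p)%N].
  apply: contrapT => hn; apply: h; split=> // q q1 qp; apply: contrapT => nq.
  have p0 : p != 0 by rewrite -size_poly_gt0; lia.
  apply: hn; exists q; split=> //.
    rewrite ltn_neqAle eq_sym q1 size_poly_gt0.
    by apply: contraTneq qp => ->; rewrite dvd0p.
  have := dvdp_leq p0 qp; rewrite leq_eqVlt => /orP[|//].
  by rewrite (dvdp_size_eqp qp) => /nq.
have [|r ir rq] := IH q _ q1; first by lia.
by exists r => //; apply: dvdp_trans qp.
Qed.

Lemma irredp_dvdM (k : fieldType) (p a b : {poly k}) : irreducible_poly p ->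
  (p %| a * b) = (p %| a) || (p %| b).
Proof.
move=> ip; have [pa|npa] := boolP (p %| a); first by rewrite dvdp_mulr.
by rewrite mulrC Gauss_dvdpl // irreducible_poly_coprime.
Qed.

(** * Squares, derivatives and a Fermat descent in [k[X]], for [k] perfect of characteristic two *)

Section Polynomials.
Variables (k : fieldType) (two0 : 2 = 0 :> k).
Hypothesis sqrtk : forall a : k, exists b, b ^+ 2 = a.
Implicit Types p q : {poly k}.

Lemma poly2_0 : 2 = 0 :> {poly k}.
Proof. exact: (rmorph_two0 (@polyC k) two0). Qed.

(** As [k] is perfect, the even part of [p] is a square and the odd part is ['X] times a square. The
    derivative of [p] is then [b ^ 2]. *)
Lemma poly_square_decomp p : exists a b, p = a ^+ 2 + b ^+ 2 * 'X.
Proof.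
have two := poly2_0.
elim/poly_ind: p => [|p a [u [v ->]]]; first by exists 0, 0; ring.
have [r <-] := sqrtk a; exists (v * 'X + r%:P), u.
by rewrite rmorphXn /=; ring.
Qed.

Lemma deriv_square p : (p ^+ 2)^`() = 0.
Proof. by rewrite expr2 derivM mulrC addrr2 // poly2_0. Qed.

Lemma deriv_eq0_square p : p^`() = 0 -> exists q, p = q ^+ 2.
Proof.
have [a [b ->]] := poly_square_decomp p.
rewrite derivD derivM !deriv_square derivX mul0r !add0r mulr1 => /eqP.
by rewrite sqrf_eq0 => /eqP ->; exists a; rewrite expr0n mul0r addr0.
Qed.

Lemma dvd_deriv_eq0 p : p %| p^`() -> p^`() = 0.
Proof.
have [->|p0] := eqVneq p 0; first by rewrite linear0.
move=> h; apply/eqP; apply: contraLR h => n0; apply/negP => /(dvdp_leq n0).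
by rewrite leqNgt lt_size_deriv.
Qed.

(* Descent: [u], [v] turn out to be squares, and their square roots give a solution
   of half the degree. *)
Lemma descent_poly (u v n d : {poly k}) (a b : k) :
  coprimep u v -> u != 0 -> v != 0 -> d != 0 -> b != 0 ->
  (n ^+ 2 + n * d) * (u * v) = d ^+ 2 * (u ^+ 2 + a *: (u * v) + b *: v ^+ 2) ->
  exists r : k, u = r *: v.
Proof.
move: {2}(size u + size v)%N (leqnn (size u + size v)) => m.
elim: m u v n d b => [|m IH] u v n d b sm cuv u0 v0 d0 b0.
  by have := size_poly_gt0 u; rewrite u0; lia.
have two := poly2_0.
wlog cnd : n d d0 / coprimep n d => [hw|].
  have g0 : gcdp n d != 0 by rewrite gcdp_eq0 negb_and d0 orbT.
  have [n' [d' [en ed cn]]] : exists n' d',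
      [/\ n = n' * gcdp n d, d = d' * gcdp n d & coprimep n' d'].
    exists (n %/ gcdp n d), (d %/ gcdp n d).
    by rewrite !divpK ?dvdp_gcdl ?dvdp_gcdr // coprimep_div_gcd ?d0 ?orbT.
  move: (gcdp n d) g0 en ed => g g0 en ed.
  have d'0 : d' != 0 by apply: contraNneq d0 => z; rewrite ed z mul0r.
  move=> e; apply: (hw n' d') => //.
  apply: (mulIf (expf_neq0 2 g0)); move: e; rewrite en ed -!mul_polyC => e.
  transitivity (((n' * g) ^+ 2 + n' * g * (d' * g)) * (u * v)); first by ring.
  by rewrite e; ring.
move=> e.
have uv0 : u * v != 0 by rewrite mulf_neq0.
have dq : d ^+ 2 %| u * v.
  rewrite -(@Gauss_dvdpr _ _ (n ^+ 2 + n * d)).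
    by rewrite e dvdp_mulr.
  apply: coprimep_expl; have -> : n ^+ 2 + n * d = n * (1 * d + n) by ring.
  by rewrite coprimepMr coprimep_addl_mul coprimep_sym cnd.
have [q eq] := dvdpP _ _ dq.
have q0 : q != 0 by apply: contraNneq uv0 => z; rewrite eq z mul0r.
have e2 : (n ^+ 2 + n * d) * q = u ^+ 2 + a *: (u * v) + b *: v ^+ 2.
  apply: (mulIf (expf_neq0 2 d0)); rewrite -mulrA -eq e; ring.
have cq : coprimep q (u ^+ 2 + a *: (u * v) + b *: v ^+ 2).
  have quv : q %| u * v by rewrite eq dvdp_mulr.
  apply: coprimep_dvdr quv _; rewrite coprimepMl; apply/andP; split.
  - rewrite -addrA addrC.
    have -> : a *: (u * v) + b *: v ^+ 2 + u ^+ 2 = (a *: v + u) * u + b *: v ^+ 2.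
      by rewrite -!mul_polyC; ring.
    by rewrite coprimep_addl_mul coprimepZr // coprimep_expr.
  - have -> : u ^+ 2 + a *: (u * v) + b *: v ^+ 2 = (a *: u + b *: v) * v + u ^+ 2.
      by rewrite -!mul_polyC; ring.
    by rewrite coprimep_addl_mul coprimep_expr // coprimep_sym.
(* By [e2] the factor [q] divides the form on the right, to which it is prime because it divides
   [u v]. *)
have sq1 : size q = 1%N.
  apply/eqP; rewrite size_poly_eq1; move/coprimepP: cq; apply=> //.
  by rewrite -e2 dvdp_mulIr.
have [l l0 el] : exists2 l, l != 0 & q = l%:P by move/eqP: sq1 => /size_poly1P.
(* [u v] is a constant times [d ^ 2], so its derivative vanishes; coprimality then makes [u] divide
   its own derivative, which must be zero. *)
have duv : u^`() * v = u * v^`().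
  apply: (addr2_eq0 two); rewrite -derivM eq el mul_polyC derivZ.
  by rewrite deriv_square scaler0.
have u'0 : u^`() = 0.
  apply: dvd_deriv_eq0; rewrite -(Gauss_dvdpl _ cuv).
  by rewrite duv dvdp_mulIl.
have v'0 : v^`() = 0.
  by move/eqP: duv; rewrite u'0 mul0r eq_sym mulf_eq0 (negPf u0) => /eqP.
have [u1 eu] := deriv_eq0_square u'0; have [v1 ev] := deriv_eq0_square v'0.
have u10 : u1 != 0 by apply: contraNneq u0 => z; rewrite eu z expr0n.
have v10 : v1 != 0 by apply: contraNneq v0 => z; rewrite ev z expr0n.
have c1 : coprimep u1 v1.
  by move: cuv; rewrite eu ev coprimep_pexpl // coprimep_pexpr.
have [s2 el2] := sqrtk l; have [b1 eb] := sqrtk b.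
have s20 : s2 != 0 by apply: contraNneq l0 => z; rewrite -el2 z expr0n.
have ed : s2 *: d = u1 * v1.
  apply: (sqr2_inj two) => /=; rewrite exprZn el2 -mul_polyC -el -eq eu ev; ring.
have [su su1] : size u = ((size u1).*2.-1)%N /\ (0 < size u1)%N.
  by rewrite size_poly_gt0 u10 eu expr2 size_mul // addnn.
have [sv sv1] : size v = ((size v1).*2.-1)%N /\ (0 < size v1)%N.
  by rewrite size_poly_gt0 v10 ev expr2 size_mul // addnn.
have [small|big] := leqP (size u + size v) 2.
  have /eqP/size_poly1P[ru ru0 ->] : size u = 1%N by move: su sv su1 sv1 small; clear; lia.
  have /eqP/size_poly1P[rv rv0 ->] : size v = 1%N by move: su sv su1 sv1 small; clear; lia.
  by exists (ru / rv); rewrite -mul_polyC -polyCM divfK.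
(* Adding [u1 ^ 2 + b1 v1 ^ 2] to [s2 n] cancels the fourth powers of [e3]. What remains is the same
   equation with denominator [u1 v1] and with [b] replaced by its square root [b1]. *)
have [] := IH u1 v1 (s2 *: n + u1 ^+ 2 + b1 *: v1 ^+ 2) (u1 * v1) b1 _ c1 u10 v10 _ _ _.
- by move: su sv su1 sv1 big sm; clear; lia.
- by rewrite mulf_neq0.
- by apply: contraNneq b0 => z; rewrite -eb z expr0n.
- move: e; rewrite eu ev -ed -eb -!mul_polyC rmorphXn /= => e.
  have D0 : s2 *: d != 0 by rewrite scaler_eq0 negb_or s20.
  move: D0 ed e; rewrite -!mul_polyC => D0 ed e.
  have e3 : s2%:P ^+ 2 * (n ^+ 2 + n * d)
    = u1 ^+ 4 + a%:P * (s2%:P * d) ^+ 2 + b1%:P ^+ 2 * v1 ^+ 4.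
    apply: (mulIf (expf_neq0 2 D0)); rewrite {1 3}ed.
    transitivity (s2%:P ^+ 2 * ((n ^+ 2 + n * d) * (u1 ^+ 2 * v1 ^+ 2))); first by ring.
    by rewrite e; ring: ed.
  transitivity ((s2%:P ^+ 2 * (n ^+ 2 + n * d) + (u1 ^+ 2 + b1%:P * v1 ^+ 2) ^+ 2
     + (u1 ^+ 2 + b1%:P * v1 ^+ 2) * (s2%:P * d)) * (s2%:P * d)); first by ring.
  by rewrite e3 ed; ring.
by move=> r er; exists (r ^+ 2); rewrite eu ev er exprZn.
Qed.
End Polynomials.

(** * Rational functions *)

Section RationalFunctions.
Variables (k K : fieldType) (c : {rmorphism k -> K}).
Local Notation ev := (evp c).

Lemma evpX x : ev x 'X = x.
Proof. by rewrite /evp /= map_polyX /horner_eval hornerX. Qed.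
Lemma evpC x a : ev x a%:P = c a.
Proof. by rewrite /evp /= map_polyC /horner_eval hornerC. Qed.
Lemma evpZ x a p : ev x (a *: p) = c a * ev x p.
Proof. by rewrite -mul_polyC rmorphM /= evpC. Qed.

Definition transc x := forall p, ev x p = 0 -> p = 0.
Definition ratl x z := exists p q, ev x q != 0 /\ z = ev x p / ev x q.

Lemma transc_inj x : transc x -> injective (ev x).
Proof.
move=> tx p q e; apply/eqP; rewrite -subr_eq0; apply/eqP/tx.
by rewrite rmorphB /= e subrr.
Qed.

Lemma transc_neq0 x p : transc x -> p != 0 -> ev x p != 0.
Proof. by move=> tx p0; apply: contraNneq p0 => /tx ->. Qed.

Lemma ratl_evp x p : ratl x (ev x p).
Proof. by exists p, 1; rewrite !rmorph1 oner_neq0 divr1. Qed.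
Lemma ratl_gen x : ratl x x.
Proof. by rewrite -[x in ratl _ x](evpX x); apply: ratl_evp. Qed.
Lemma ratl_cst x a : ratl x (c a).
Proof. by rewrite -(evpC x); apply: ratl_evp. Qed.

Lemma ratl_subfield x : subfield (ratl x).
Proof.
split; first by rewrite -(rmorph1 c); apply: ratl_cst.
  move=> _ _ [p [q [q0 ->]]] [p' [q' [q'0 ->]]].
  exists (p * q' - p' * q), (q * q'); rewrite rmorphB !rmorphM /= mulf_neq0 //.
  by split=> //; field; rewrite q0 q'0.
move=> _ _ [p [q [q0 ->]]] [p' [q' [q'0 ->]]].
have [z|nz] := eqVneq (ev x p') 0.
  by exists 0, 1; rewrite z mul0r invr0 mulr0 rmorph1 rmorph0 oner_neq0 mul0r.
exists (p * q'), (q * p'); rewrite !rmorphM /= mulf_neq0 //; split=> //.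
by rewrite invf_div mulf_div.
Qed.

Lemma ratl_min x (P : K -> Prop) : subfield P -> (forall a, P (c a)) -> P x ->
  forall z, ratl x z -> P z.
Proof.
move=> sP Pc Px z [p [q [_ ->]]].
have Pp r : P (ev x r).
  elim/poly_ind: r => [|r a IH]; first by rewrite rmorph0; apply: sf0.
  by rewrite rmorphD rmorphM /= evpX evpC; apply: (sfD sP) => //; apply: (sfM sP).
by apply: sfdiv sP _ _ _ _.
Qed.

Lemma ratl_coprime x z : transc x -> ratl x z ->
  exists p q, [/\ coprimep p q, q != 0 & z = ev x p / ev x q].
Proof.
move=> tx [p [q [q0 ->]]].
have nq : q != 0 by apply: contraNneq q0 => ->; rewrite rmorph0.
have g0 : gcdp p q != 0 by rewrite gcdp_eq0 negb_and nq orbT.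
have [p' [q' [ep eq cpq]]] : exists p' q',
    [/\ p = p' * gcdp p q, q = q' * gcdp p q & coprimep p' q'].
  exists (p %/ gcdp p q), (q %/ gcdp p q).
  by rewrite !divpK ?dvdp_gcdl ?dvdp_gcdr // coprimep_div_gcd ?nq ?orbT.
move: (gcdp p q) g0 ep eq => g g0 ep eq.
have q'0 : q' != 0 by apply: contraNneq nq => e0; rewrite eq e0 mul0r.
exists p', q'; split=> //; rewrite ep eq !rmorphM /=.
by field; rewrite !transc_neq0.
Qed.

Lemma transc_ncst x a : transc x -> x <> c a.
Proof.
move=> tx e; have : ev x ('X - a%:P) = 0 by rewrite rmorphB /= evpX evpC e subrr.
by move=> /tx/eqP; rewrite polyXsubC_eq0.
Qed.

Section CharTwo.
Hypothesis two0 : 2 = 0 :> k.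
Hypothesis sqrtk : forall a : k, exists b, b ^+ 2 = a.

Let twoK : 2 = 0 :> K. Proof. exact: rmorph_two0 c two0. Qed.

Variable x : K.
Hypothesis tx : transc x.

(** At most a simple pole at the finite place [p] of the [x]-line: [f] is [N / (p B)] with [p] prime
    to [B]. *)
Definition simple_pole (p : {poly k}) (f : K) :=
  exists N B, ~~ (p %| B) /\ f * ev x (p * B) = ev x N.

Lemma simple_poleD p f g : irreducible_poly p ->
  simple_pole p f -> simple_pole p g -> simple_pole p (f + g).
Proof.
move=> ip [N [B [pB e]]] [N' [B' [pB' e']]].
exists (N * B' + N' * B), (B * B'); split.
  by rewrite irredp_dvdM // negb_or pB.
rewrite rmorphD !rmorphM /= -e -e' !rmorphM /=; ring.
Qed.

Lemma simple_pole_sep p f N A : irreducible_poly p -> coprimep A A^`() ->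
  f * ev x A = ev x N -> simple_pole p f.
Proof.
move=> ip cA e; have [/dvdpP[B eA]|pA] := boolP (p %| A); last first.
  by exists (p * N), A; rewrite !rmorphM /= -e; split=> //; ring.
exists N, B; split; last by rewrite [p * B]mulrC -eA.
apply/negP => /dvdpP[B' eB]; have := ip.1; rewrite ltnNge => /negP; apply.
have /coprimepP/(_ p) : coprimep A A^`() by [].
rewrite -size_poly_eq1 => /(_ _ _)/eqP -> //; rewrite eA eB.
  by rewrite dvdp_mulIr.
by rewrite -mulrA -expr2 derivM deriv_square // mulr0 addr0 expr2 mulrA dvdp_mulIr.
Qed.

(* At a pole of [alpha], [alpha ^ 2 + alpha] has a pole of even order. *)
Lemma AS_no_pole alpha : ratl x alpha ->
  (forall p, irreducible_poly p -> simple_pole p (alpha ^+ 2 + alpha)) ->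
  (exists N B : {poly k}, [/\ B != 0, (size N <= (size B).+1)%N
     & (alpha ^+ 2 + alpha) * ev x B = ev x N]) ->
  exists a, alpha = c a.
Proof.
move=> /(ratl_coprime tx)[n [d [cnd d0 ea]]] sp [N [B [B0 sN eN]]].
have two := poly2_0 two0.
have nd0 := transc_neq0 tx d0.
have ef : (alpha ^+ 2 + alpha) * ev x (d ^+ 2) = ev x (n ^+ 2 + n * d).
  by rewrite ea rmorphD !rmorphXn rmorphM /=; field.
have sd : size d = 1%N.
  apply/eqP; rewrite eqn_leq size_poly_gt0 d0 andbT leqNgt; apply/negP.
  move=> /irreducible_divisor[p ip pd].
  have [M [C [pC e]]] := sp p ip.
  have e1 : (n ^+ 2 + n * d) * (p * C) = d ^+ 2 * M.
    apply: (transc_inj tx); rewrite rmorphM [RHS]rmorphM /= -ef -e; ring.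
  have [d1 ed] := dvdpP _ _ pd.
  have p0 := irredp_neq0 ip.
  have : p %| (n ^+ 2 + n * d) * C.
    rewrite (_ : _ * C = d1 ^+ 2 * M * p) ?dvdp_mulIr //.
    by apply: (mulIf p0); rewrite mulrAC -mulrA e1 ed; ring.
  rewrite irredp_dvdM // (negPf pC) orbF (dvdp_addl _ (dvdp_mull n pd)) expr2 irredp_dvdM //.
  rewrite orbb => pn; move/coprimepP: cnd => /(_ _ pn pd).
  by rewrite -size_poly_eq1; have := ip.1; case: size => [|[]].
have /size_poly1P[r r0 er] : size d == 1%N by rewrite sd.
pose m : {poly k} := r^-1 *: n.
have eal : alpha = ev x m.
  by rewrite ea er evpC evpZ fmorphV mulrC.
have e2 : (m ^+ 2 + m) * B = N.
  by apply: (transc_inj tx); rewrite rmorphM rmorphD rmorphXn /= -eal.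
(* If [m] were not constant, [m ^ 2 + m] would have a pole of even order at infinity, where the
   bound on [size N] allows at most a simple one. *)
have [sm|bg] := leqP (size m) 1.
  by move/size1_polyC: sm eal => ->; rewrite evpC => ->; eexists.
have m0 : m != 0 by rewrite -size_poly_gt0; apply: leq_trans bg.
have s2 : size (m ^+ 2 + m) = ((size m).*2.-1)%N.
  have sm2 : size (m ^+ 2) = ((size m).*2.-1)%N by rewrite expr2 size_mul // addnn.
  by rewrite size_polyDl sm2 //; move: bg; clear; lia.
exfalso; have := sN; rewrite -e2 size_mul //; last first.
  by rewrite -size_poly_gt0 s2; move: bg; clear; lia.
rewrite s2; have : (0 < size B)%N by rewrite size_poly_gt0.
move: bg; move: (size m) (size B) => i j; clear; lia.
Qed.
End CharTwo.

(** Modulo [p] only the term [cf 0 * q ^ (n - 1)] survives and [q] is invertible, so [p] divides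
    [cf 0], whose degree is too small. Dividing by [p] continues the induction. *)
Lemma coprime_comb_eq0 (p q : {poly k}) n (cf : nat -> {poly k}) : p != 0 ->
  coprimep p q -> (2 < size p)%N -> (forall i, (size (cf i) <= 2)%N) ->
  \sum_(i < n) cf i * p ^+ i * q ^+ (n.-1 - i) = 0 ->
  forall i, (i < n)%N -> cf i = 0.
Proof.
move=> p0 cpq sp; elim: n cf => [//|n IH] cf sc.
rewrite big_ord_recl /= expr0 mulr1 subn0 => e.
have c0 : cf 0%N = 0.
  apply/eqP; apply: contraT => nz.
  have ps : p %| \sum_(i < n) cf (bump 0 i) * p ^+ bump 0 i * q ^+ (n - bump 0 i).
    apply: (big_ind (fun r => p %| r)) => [|u v|i _]; [exact: dvdp0|exact: dvdp_add|].
    by rewrite /bump leq0n exprS -!mulrA dvdp_mull // dvdp_mulr.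
  have : p %| cf 0%N * q ^+ n by rewrite -(dvdp_addl _ ps) e dvdp0.
  rewrite Gauss_dvdpl ?coprimep_expr // => /(dvdp_leq nz).
  by rewrite leqNgt (leq_ltn_trans (sc 0%N)).
move=> [//|i]; rewrite ltnS => lti.
apply: (IH (fun i => cf i.+1)) => //.
apply: (mulIf p0); rewrite mul0r -[RHS]e c0 mul0r add0r mulr_suml.
apply: eq_bigr => j _; rewrite /bump leq0n add1n exprS.
have -> : (n - j.+1 = n.-1 - j)%N by case: (n) j => [[]|].
by ring.
Qed.

(** Clearing denominators in [x = P(xi) / Q(xi)] with [xi = p / q] gives a homogeneous relation in
    [p], [q] whose coefficients [Q_i 'X - P_i] have degree at most one and do not all vanish. This
    excludes degree two or more for [p] and for [q]. *)
Lemma moebius x xi : transc x -> ratl x xi -> ratl xi x ->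
  exists p q, [/\ coprimep p q, q != 0, (size p <= 2)%N, (size q <= 2)%N
    & xi = ev x p / ev x q].
Proof.
move=> tx /(ratl_coprime tx)[p [q [cpq q0 exi]]] [P [Q [nQ ex]]].
have nq := transc_neq0 tx q0.
pose n := (maxn (size P) (size Q)).+1.
pose cf i : {poly k} := Q`_i *: 'X - (P`_i)%:P.
have scf i : (size (cf i) <= 2)%N.
  rewrite (leq_trans (size_polyD _ _)) // geq_max size_polyN.
  rewrite (leq_trans (size_scale_leq _ _)) ?size_polyX //=.
  by rewrite (leq_trans (size_polyC_leq1 _)).
have evs (R : {poly k}) : (size R <= n)%N ->
    \sum_(i < n) c R`_i * ev x p ^+ i * ev x q ^+ (n.-1 - i) = ev xi R * ev x q ^+ n.-1.
  move=> sR; have sR' : (size (map_poly c R) <= n)%N by rewrite size_map_poly.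
  rewrite [ev xi R]/evp /= /horner_eval (horner_coef_wide _ sR').
  rewrite mulr_suml; apply: eq_bigr => i _; rewrite coef_map /= exi expr_div_n.
  have -> : ev x q ^+ n.-1 = ev x q ^+ i * ev x q ^+ (n.-1 - i).
    by rewrite -exprD subnKC // -ltnS.
  by field; rewrite expf_neq0.
have sum0 : \sum_(i < n) cf i * p ^+ i * q ^+ (n.-1 - i) = 0.
  apply: (transc_inj tx); rewrite rmorph0 rmorph_sum /=.
  transitivity (x * (ev xi Q * ev x q ^+ n.-1) - ev xi P * ev x q ^+ n.-1).
    rewrite -!evs ?/n ?leqW ?leq_maxl ?leq_maxr // mulr_sumr -sumrB.
    apply: eq_bigr => i _; rewrite !rmorphM rmorphB !rmorphXn /= evpZ evpX evpC.
    ring.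
  by rewrite ex mulrA divfK // subrr.
have [i [ltin ni]] : exists i, (i < n)%N /\ cf i != 0.
  exists (size Q).-1; split; first by rewrite /n; lia.
  have Q0 : Q != 0 by apply: contraNneq nQ => ->; rewrite rmorph0.
  apply: contraNneq Q0 => /(congr1 (fun r : {poly k} => r`_1)).
  by rewrite coefB coefZ coefX coefC coef0 /= mulr1 subr0 -[_`_ _]/(lead_coef Q) => /eqP; rewrite lead_coef_eq0.
exists p, q; split=> //; rewrite leqNgt; apply/negP => big.
- have p0 : p != 0 by rewrite -size_poly_gt0; apply: leq_trans big.
  by move/eqP: ni; apply; apply: (coprime_comb_eq0 p0 cpq big scf sum0).
move/eqP: ni; apply.
have lei : (i <= n.-1)%N by rewrite -ltnS.
rewrite -(subKn lei).
(* Reversing the order of summation exchanges [p] and [q]. *)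
apply: (@coprime_comb_eq0 q p n (fun j => cf (n.-1 - j)%N) q0 _ big) => //.
- by rewrite coprimep_sym.
- rewrite -[RHS]sum0 (reindex_inj rev_ord_inj) /=; apply: eq_bigr => j _.
  have lj : (j <= n.-1)%N by rewrite -ltnS.
  by rewrite (_ : n - j.+1 = n.-1 - j)%N ?subKn // mulrAC.
by rewrite ltnS leq_subr.
Qed.

End RationalFunctions.

(** * Existence of valuation rings *)

Section ValuationRings.
Variables (k : fieldType) (X : curve_data k).
Implicit Types (A I R J O : X -> Prop).

Record subalg A : Prop := Subalg {
  sa_cst : forall a, A (cst X a);
  sa_add : forall u v, A u -> A v -> A (u + v);
  sa_mul : forall u v, A u -> A v -> A (u * v)
}.

Lemma sa0 A : subalg A -> A 0.
Proof. by move=> h; rewrite -(rmorph0 (cst X)); apply: sa_cst. Qed.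
Lemma sa1 A : subalg A -> A 1.
Proof. by move=> h; rewrite -(rmorph1 (cst X)); apply: sa_cst. Qed.
Lemma saN A u : subalg A -> A u -> A (- u).
Proof.
by move=> h Au; rewrite -mulN1r -(rmorph1 (cst X)) -rmorphN; apply: (sa_mul h (sa_cst h _) Au).
Qed.
Lemma saX A u n : subalg A -> A u -> A (u ^+ n).
Proof. by move=> h Au; elim: n => [|n IH]; rewrite ?expr0 ?exprS; [exact: sa1|exact: sa_mul]. Qed.

Record ideal_of A I : Prop := IdealOf {
  id_sub : forall u, I u -> A u;
  id_add : forall u v, I u -> I v -> I (u + v);
  id_mul : forall a u, A a -> I u -> I (a * u);
  id_neq1 : ~ I 1
}.

(** For a valuation ring [O] this is its maximal ideal; [0] is listed apart because [0^-1 = 0]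
    belongs to [O]. *)
Definition nonunit O (u : X) := u = 0 \/ ~ O u^-1.

Section Existence.
Variables (R J : X -> Prop).
Hypotheses (sR : subalg R) (iJ : ideal_of R J).

Record dominates (AI : (X -> Prop) * (X -> Prop)) : Prop := Dominates {
  dom_alg : subalg AI.1;
  dom_ideal : ideal_of AI.1 AI.2;
  dom_R : forall u, R u -> AI.1 u;
  dom_J : forall u, J u -> AI.2 u
}.

Let T := {AI | dominates AI}.
Let le (s t : T) : bool :=
  `[< (forall u, (sval s).1 u -> (sval t).1 u) /\ (forall u, (sval s).2 u -> (sval t).2 u) >].

Lemma maximal_dominating : exists AI, dominates AI /\
  forall BI, dominates BI -> (forall u, AI.1 u -> BI.1 u) -> (forall u, AI.2 u -> BI.2 u) ->
    (forall u, BI.1 u -> AI.1 u) /\ (forall u, BI.2 u -> AI.2 u).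
Proof.
have t0 : T by exists (R, J); split.
have [] := @ZL_preorder T t0 le.
- by move=> t; apply/asboolP.
- move=> r s t /asboolP[h1 h2] /asboolP[h3 h4]; apply/asboolP.
  by split=> u; [move=> /h1/h3|move=> /h2/h4].
- move=> Ch tot; have [[s0 Cs0]|ne] := pselect (exists s, Ch s); last first.
    by exists t0 => s Cs; case: ne; exists s.
  pose UA u := exists s, Ch s /\ (sval s).1 u.
  pose UI u := exists s, Ch s /\ (sval s).2 u.
  have common s t : Ch s -> Ch t -> exists r, [/\ Ch r, le s r & le t r].
    move=> Cs Ct; have [h|h] := tot s t Cs Ct.
      by exists t; split=> //; apply/asboolP.
    by exists s; split=> //; apply/asboolP.
  suff d : dominates (UA, UI).
    exists (exist _ _ d) => s Cs; apply/asboolP => /=.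
    by split=> u h; exists s.
  split=> /=.
  + split.
    * by move=> a; exists s0; split=> //; apply: (sa_cst (dom_alg (svalP s0)) _).
    * move=> u v [s [Cs su]] [t [Ct tv]]; have [r [Cr /asboolP[sr _] /asboolP[tr _]]] := common s t Cs Ct.
      by exists r; split=> //; apply: (sa_add (dom_alg (svalP r)) _ _); auto.
    * move=> u v [s [Cs su]] [t [Ct tv]]; have [r [Cr /asboolP[sr _] /asboolP[tr _]]] := common s t Cs Ct.
      by exists r; split=> //; apply: (sa_mul (dom_alg (svalP r)) _ _); auto.
  + split.
    * by move=> u [s [Cs su]]; exists s; split=> //; apply: (id_sub (dom_ideal (svalP s)) su).
    * move=> u v [s [Cs su]] [t [Ct tv]]; have [r [Cr /asboolP[_ sr] /asboolP[_ tr]]] := common s t Cs Ct.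
      by exists r; split=> //; apply: (id_add (dom_ideal (svalP r)) _ _); auto.
    * move=> u v [s [Cs su]] [t [Ct tv]]; have [r [Cr /asboolP[sr _] /asboolP[_ tr]]] := common s t Cs Ct.
      by exists r; split=> //; apply: (id_mul (dom_ideal (svalP r)) _ _); auto.
    * by move=> [s [_ s1]]; apply: (id_neq1 (dom_ideal (svalP s)) s1).
  + by move=> u Ru; exists s0; split=> //; apply: (dom_R (svalP s0) Ru).
  + by move=> u Ru; exists s0; split=> //; apply: (dom_J (svalP s0) Ru).
move=> [AI dA] mx; exists AI; split=> // BI dB h1 h2.
by have /asboolP := mx (exist _ _ dB) ltac:(by apply/asboolP).
Qed.

(* Chevalley's theorem: a maximal pair [(A, I)] is a valuation ring and its ideal. *)
Lemma valuation_dominating r0 : J r0 -> r0 != 0 ->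
  exists O, [/\ is_valuation_ring O, forall u, R u -> O u & forall u, J u -> nonunit O u].
Proof.
move=> Jr0 nr0; have [[A I] [dA mx]] := maximal_dominating.
have sA := dom_alg dA; have iI := dom_ideal dA; rewrite /= in sA iI mx.
have I0 : I 0.
  by rewrite -(mul0r r0); apply: (id_mul iI (sa0 sA) (dom_J dA Jr0)).
have A0 := sa0 sA; have A1 := sa1 sA.
have Isum (n : nat) (F : nat -> X) : (forall i, (i < n)%N -> I (F i)) -> I (\sum_(i < n) F i).
  move=> h; apply: (big_ind I) => [//|u v|i _]; first apply: (id_add iI).
  by apply: h.
have Asum (n : nat) (F : nat -> X) : (forall i, A (F i)) -> A (\sum_(i < n) F i).
  move=> h; apply: (big_ind A) => [//|u v|i _]; first apply: (sa_add sA).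
  by apply: h.
have IN u : I u -> I (- u).
  by move=> Iu; rewrite -mulN1r; apply: (id_mul iI (saN sA A1) Iu).
have inv1 i : I i -> A (1 - i)^-1.
  move=> Ii; set d := 1 - i.
  have Ad : A d by apply: (sa_add sA A1 (saN sA (id_sub iI Ii))).
  have d0 : d != 0.
    by apply/eqP => /subr0_eq e; apply: (id_neq1 iI); rewrite e.
  have pow n : exists2 j, I j & d ^+ n = 1 - j.
    elim: n => [|n [j Ij e]]; first by exists 0; rewrite ?subr0.
    exists (i + d * j); last by rewrite exprS e /d; ring.
    by apply: (id_add iI Ii _); apply: (id_mul iI Ad Ij).
  (* Localizing at the powers of [d = 1 - i] keeps the ideal proper, since these powers are [1]
     minus elements of [I]. By maximality nothing new is obtained, so [d^-1] is in [A]. *)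
  pose loc (P : X -> Prop) u := exists n, P (u * d ^+ n).
  have [] := mx (loc A, loc I).
  - split=> /=.
    + split; first by move=> a; exists 0%N; rewrite mulr1; apply: (sa_cst sA _).
        move=> u v [n hn] [m hm]; exists (n + m)%N.
        have -> : (u + v) * d ^+ (n + m) = u * d ^+ n * d ^+ m + v * d ^+ m * d ^+ n.
          by rewrite exprD; ring.
        by apply: (sa_add sA _ _); apply: (sa_mul sA _ _) => //; apply: saX.
      move=> u v [n hn] [m hm]; exists (n + m)%N.
      have -> : (u * v) * d ^+ (n + m) = u * d ^+ n * (v * d ^+ m).
        by rewrite exprD; ring.
      exact: (sa_mul sA _ _).
    + split.
      * by move=> u [n hn]; exists n; apply: (id_sub iI hn).
      * move=> u v [n hn] [m hm]; exists (n + m)%N.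
        have -> : (u + v) * d ^+ (n + m) = d ^+ m * (u * d ^+ n) + d ^+ n * (v * d ^+ m).
          by rewrite exprD; ring.
        by apply: (id_add iI _ _); apply: (id_mul iI _ _) => //; apply: saX.
      * move=> u v [n hn] [m hm]; exists (n + m)%N.
        have -> : (u * v) * d ^+ (n + m) = u * d ^+ n * (v * d ^+ m).
          by rewrite exprD; ring.
        exact: (id_mul iI _ _).
      * move=> [n]; rewrite mul1r; have [j Ij ->] := pow n => h; apply: (id_neq1 iI).
        by rewrite -(subrK j 1); apply: (id_add iI h Ij).
    + by move=> u Ru; exists 0%N; rewrite mulr1; apply: (dom_R dA Ru).
    + by move=> u Ru; exists 0%N; rewrite mulr1; apply: (dom_J dA Ru).
  - by move=> u h; exists 0%N; rewrite mulr1.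
  - by move=> u h; exists 0%N; rewrite mulr1.
  by move=> /= h _; apply: h; exists 1%N; rewrite mulVf.
have reach x : ~ A x -> exists n (a : nat -> X),
    (forall i, I (a i)) /\ \sum_(i < n) a i * x ^+ i = 1.
  move=> nAx; apply: contrapT => no.
  (* [A[x]] is larger than [A], so by maximality [I A[x]] cannot be a proper ideal; an expression of
     [1] in it is the relation sought. *)
  pose ext (P : X -> Prop) u := exists2 q : {poly X}, (forall i, P q`_i) & u = q.[x].
  have P1 (P : X -> Prop) : P 0 -> forall u, P u -> ext P u.
    move=> P0 u Pu; exists u%:P; last by rewrite hornerC.
    by move=> i; rewrite coefC; case: ifP.
  have [] := mx (ext A, ext I).
  - split=> /=.
    + split; first by move=> a; apply: P1 => //; apply: (sa_cst sA _).
        move=> _ _ [p hp ->] [q hq ->]; exists (p + q); last by rewrite hornerD.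
        by move=> i; rewrite coefD; apply: (sa_add sA _ _).
      move=> _ _ [p hp ->] [q hq ->]; exists (p * q); last by rewrite hornerM.
      move=> i; rewrite coefM; apply: (Asum _ (fun j => p`_j * q`_(i - j))) => j.
      exact: (sa_mul sA _ _).
    + split.
      * by move=> _ [p hp ->]; exists p => // i; apply: (id_sub iI _).
      * move=> _ _ [p hp ->] [q hq ->]; exists (p + q); last by rewrite hornerD.
        by move=> i; rewrite coefD; apply: (id_add iI _ _).
      * move=> _ _ [p hp ->] [q hq ->]; exists (p * q); last by rewrite hornerM.
        move=> i; rewrite coefM; apply: (Isum _ (fun j => p`_j * q`_(i - j))) => j _.
        exact: (id_mul iI _ _).
      * move=> [p hp e]; apply: no; exists (size p), (fun i => p`_i); split=> //.
        by rewrite e horner_coef.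
    + by move=> u Ru; apply: P1 => //; apply: (dom_R dA Ru).
    + by move=> u Ru; apply: P1 => //; apply: (dom_J dA Ru).
  - by move=> u h; apply: P1.
  - by move=> u h; apply: P1.
  move=> /= h _; apply: nAx; apply: h; exists 'X; last by rewrite hornerX.
  by move=> i; rewrite coefX; case: eqP.
have reduce x n m (a b : nat -> X) : x != 0 -> (m <= n)%N -> (forall i, I (a i)) -> (forall i, I (b i)) ->
    \sum_(i < n) a i * x ^+ i = 1 -> \sum_(i < m) b i * x ^- i = 1 ->
    exists2 a' : nat -> X, (forall i, I (a' i)) & \sum_(i < n.-1) a' i * x ^+ i = 1.
  case: n => [|n] x0; first by rewrite big_ord0 => _ _ _ /eqP; rewrite eq_sym oner_eq0.
  case: m => [|m] lemn Ia Ib ea; first by rewrite big_ord0 => /eqP; rewrite eq_sym oner_eq0.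
  rewrite big_ord_recl /= expr0 invr1 mulr1 => eb.
  have e1 : \sum_(i < m) b i.+1 * x ^- i.+1 = 1 - b 0%N.
    by rewrite -eb addrC addKr; apply: eq_bigr => i _; rewrite /bump leq0n add1n.
  have d0 : 1 - b 0%N != 0.
    by apply/eqP => /subr0_eq e; apply: (id_neq1 iI); rewrite e.
  (* The relation in [x^-1], multiplied by [x ^ n], is solved for [x ^ n]; this is possible because
     [1 - b 0] is invertible in [A]. Substitution removes the top term of the relation in [x]. *)
  pose b' i := if (i < n - m)%N then 0 else b (n - i)%N / (1 - b 0%N).
  have Ib' i : I (b' i).
    by rewrite /b'; case: ifP => // _; rewrite mulrC; apply: (id_mul iI (inv1 _ (Ib _)) (Ib _)).
  have exn : \sum_(i < n) b' i * x ^+ i = x ^+ n.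
    apply: (mulfI d0); rewrite -{2}e1 mulr_suml mulr_sumr.
    transitivity (\sum_(i < n | (n - m <= i)%N) b (n - i)%N * x ^+ i).
      rewrite [RHS]big_mkcond /=; apply: eq_bigr => i _; rewrite /b' ltnNge.
      by case: leqP => _ /=; rewrite ?mul0r ?mulr0 // mulrA mulrCA mulfV // mulr1.
    rewrite (reindex_inj rev_ord_inj) /=.
    rewrite (big_ord_widen_cond n (fun=> true) (fun i => b i.+1 * x ^- i.+1 * x ^+ n)) //=.
    apply: eq_big => i /=; first by have := ltn_ord i; move: (i : nat) lemn => j; lia.
    move=> _; have li := ltn_ord i; rewrite subKn // -mulrA; congr (_ * _).
    apply: (mulfI (expf_neq0 i.+1 x0)); rewrite mulrA mulfV ?expf_neq0 // mul1r -exprD.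
    by rewrite subnKC.
  exists (fun i => a i + a n * b' i) => [i|].
    by apply: (id_add iI (Ia i) _); apply: (id_mul iI (id_sub iI (Ia n)) (Ib' i)).
  rewrite /= -[RHS]ea big_ord_recr /= -exn mulr_sumr -big_split /=.
  by apply: eq_bigr => i _; rewrite mulrDl mulrA.
have val x : A x \/ A x^-1.
  apply: contrapT => /not_orP[nA nV].
  have x0 : x != 0 by apply: contra_notN nA => /eqP ->.
  have [n [a [Ia ea]]] := reach _ nA; have [m [b [Ib eb]]] := reach _ nV.
  (* The shorter relation shortens the longer one, again and again, until one of them is empty and
     reads [0 = 1]. *)
  move: {2}(n + m)%N (leqnn (n + m)) => N.
  have [V Vx0] : exists V, V = x^-1 by eexists.
  elim: N n m a b Ia ea Ib eb => [|N IH] n m a b Ia ea Ib eb leN.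
    have n0 : n = 0%N by lia.
    by move: ea; rewrite n0 big_ord0 => /eqP; rewrite eq_sym oner_eq0.
  have n0 : (0 < n)%N.
    by case: n ea {leN} => //; rewrite big_ord0 => /eqP; rewrite eq_sym oner_eq0.
  have m0 : (0 < m)%N.
    by case: m eb {leN} => //; rewrite big_ord0 => /eqP; rewrite eq_sym oner_eq0.
  have [lemn|ltnm] := leqP m n.
    have [|a' Ia' ea'] := reduce x n m a b x0 lemn Ia Ib ea.
      by rewrite -[RHS]eb; apply: eq_bigr => i _; rewrite exprVn.
    by apply: (IH n.-1 m a' b) => //; lia.
  have [||b' Ib' eb'] := reduce x^-1 m n b a _ (ltnW ltnm) Ib Ia eb.
    by rewrite invr_eq0.
    by rewrite -[RHS]ea; apply: eq_bigr => i _; rewrite exprVn invrK.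
  by apply: (IH n m.-1 a b') => //; lia.
have nJ u : J u -> nonunit A u.
  move=> Ju; have [->|u0] := eqVneq u 0; [by left|right=> Av].
  by apply: (id_neq1 iI); rewrite -(mulVf u0); apply: (id_mul iI Av (dom_J dA Ju)).
exists A; split=> //; last by move=> u; apply: (dom_R dA).
split=> //; [exact: sa_cst|exact: sa_add|exact: sa_mul|].
by exists r0^-1; case: (nJ _ Jr0) => // e; rewrite e eqxx in nr0.
Qed.

End Existence.
End ValuationRings.

(** * Regular differentials on a double cover of the line *)

Section ValuationFacts.
Variables (k : fieldType) (X : curve_data k) (O : X -> Prop).
Hypothesis vO : is_valuation_ring O.

Lemma vring_subalg : subalg O.
Proof. by split; [exact: vring_cst vO|exact: vring_add vO|exact: vring_mul vO]. Qed.

Lemma nonunit_sub u : nonunit O u -> O u.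
Proof. by case=> [->|nV]; [exact: sa0 vring_subalg|case: (vring_inv vO u)]. Qed.

Lemma nonunit_mul u v : O u -> nonunit O v -> nonunit O (u * v).
Proof.
move=> Ou [->|nV]; first by left; rewrite mulr0.
have [->|u0] := eqVneq u 0; first by left; rewrite mul0r.
right=> h; apply: nV; have -> : v^-1 = u * (u * v)^-1 by rewrite invfM mulrA mulfV // mul1r.
exact: vring_mul vO _ _ _ _.
Qed.

Lemma nonunit1 : ~ nonunit O 1.
Proof.
case=> [/eqP|]; first by rewrite oner_eq0.
by rewrite invr1; apply; apply: sa1 vring_subalg.
Qed.

Lemma nonunit_inv u : O u -> ~ nonunit O u -> O u^-1.
Proof. by move=> _ h; apply: contrapT => n; apply: h; right. Qed.

Lemma unit_neq0 u : ~ nonunit O u -> u != 0.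
Proof. by move=> h; apply: contra_notN h => /eqP ->; left. Qed.

Lemma unit_mul u v : O u -> O v -> ~ nonunit O u -> ~ nonunit O v -> ~ nonunit O (u * v).
Proof.
move=> Ou Ov nu nv h; apply: nonunit1.
have -> : 1 = u^-1 * v^-1 * (u * v).
  by rewrite mulrACA !mulVf ?mul1r // unit_neq0.
by apply: nonunit_mul => //; apply: (vring_mul vO); apply: nonunit_inv.
Qed.

Lemma nonunit_add u v : nonunit O u -> nonunit O v -> nonunit O (u + v).
Proof.
move=> mu mv; have [->|u0] := eqVneq u 0; first by rewrite add0r.
have [->|v0] := eqVneq v 0; first by rewrite addr0.
have O1 := sa1 vring_subalg.
have [h|h] := vring_inv vO (u / v).
  have -> : u + v = (u / v + 1) * v by rewrite mulrDl divfK // mul1r.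
  by apply: nonunit_mul => //; apply: (vring_add vO).
have -> : u + v = (1 + (u / v)^-1) * u by rewrite invf_div mulrDl divfK // mul1r.
by apply: nonunit_mul => //; apply: (vring_add vO).
Qed.

Lemma vring_integral2 u a b : O a -> O b -> u ^+ 2 + a * u + b = 0 -> O u.
Proof.
move=> Oa Ob e; have [//|Ov] := vring_inv vO u.
have [->|u0] := eqVneq u 0; first exact: sa0 vring_subalg.
have -> : u = - (a + b * u^-1).
  apply: (mulfI u0); apply/eqP; rewrite -subr_eq0; apply/eqP; rewrite -[RHS]e; field.
  exact: u0.
apply: (saN vring_subalg); apply: (vring_add vO) => //; exact: vring_mul vO _ _ _ _.
Qed.

Lemma vring_nonunitV u : ~ O u -> nonunit O u^-1.
Proof. by move=> h; right; rewrite invrK. Qed.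
End ValuationFacts.

Section Derivations.
Variables (k : fieldType) (X : curve_data k) (D : derivation X).

Lemma der0 : D 0 = 0.
Proof. by have := der_cst D 0; rewrite rmorph0. Qed.
Lemma der1 : D 1 = 0.
Proof. by have := der_cst D 1; rewrite rmorph1. Qed.
Lemma derV u : u != 0 -> D u^-1 = - D u / u ^+ 2.
Proof.
move=> u0; have := derM D u u^-1; rewrite mulfV // der1 => e.
apply: (mulfI u0); apply/eqP; rewrite -subr_eq0; apply/eqP; rewrite [RHS]e; field.
exact: u0.
Qed.
Lemma der_evp x p : D (evp (cst X) x p) = evp (cst X) x p^`() * D x.
Proof.
elim/poly_ind: p => [|p a IH]; first by rewrite linear0 !rmorph0 der0 mul0r.
rewrite rmorphD rmorphM /= evpX evpC derD derM IH der_cst.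
rewrite derivD derivM derivX derivC !mulr1 !addr0 rmorphD rmorphM /= evpX; ring.
Qed.

Hypothesis two0 : 2 = 0 :> X.
Lemma der_sqr u : D (u ^+ 2) = 0.
Proof. by rewrite expr2 derM; ring. Qed.

Lemma der_ratl x z : ratl (cst X) x z -> D x = 0 -> D z = 0.
Proof.
move=> [p [q [q0 ->]]] x0; rewrite derM derV // !der_evp x0; ring.
Qed.
End Derivations.

(** Controls poles at infinity: [r] is [q] reversed, so that multiplication by [s ^ n] moves the
    comparison into [k[s]]. *)
Lemma evp_inv_size (k K : fieldType) (c : {rmorphism k -> K}) s m p q :
  transc c s -> s != 0 -> evp c s p = s ^+ m * evp c s^-1 q -> (size p <= m.+1)%N.
Proof.
move=> ts s0 e; pose n := size q.
pose r : {poly k} := \sum_(i < n) q`_i *: 'X^(n - i).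
have er : evp c s r = s ^+ n * evp c s^-1 q.
  rewrite rmorph_sum /= [evp c s^-1 q]/evp /= /horner_eval horner_coef size_map_poly mulr_sumr.
  apply: eq_bigr => i _; rewrite evpZ coef_map rmorphXn /= evpX exprVn mulrCA; congr (_ * _).
  by rewrite -[in RHS](subnK (ltnW (ltn_ord i))) exprD mulfK // expf_neq0.
have : 'X^n * p = 'X^m * r.
  by apply: (transc_inj ts); rewrite !rmorphM !rmorphXn /= evpX e er mulrCA.
have sr : (size r <= n.+1)%N.
  apply: (leq_trans (size_sum _ _ _)); apply/bigmax_leqP => i _.
  rewrite (leq_trans (size_scale_leq _ _)) // size_polyXn ltnS leq_subr //.
have [->|p0] := eqVneq p 0; first by rewrite size_poly0.
have [->|r0] := eqVneq r 0.
  by rewrite mulr0 => /eqP; rewrite mulf_eq0 (negPf p0) orbF expf_eq0 polyX_eq0 andbF.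
move=> /(congr1 (fun u : {poly k} => size u)).
rewrite !size_mul ?expf_neq0 ?polyX_eq0 // !size_polyXn /= => es.
by move: sr es; move: (size r) (size p) => a b; lia.
Qed.

(** * Differentials over the integral closure of [k[s]] in a quadratic extension *)

Section LocalKey.
Variables (k : fieldType) (two0 : 2 = 0 :> k) (X : curve_data k) (s y : X).
Local Notation ev := (evp (cst X)).
Local Notation P := (ratl (cst X) s).
Hypotheses (ts : transc (cst X) s) (gy : AS_gen P y).

Let sP := ratl_subfield (cst X) s.
Let twoX : 2 = 0 :> X. Proof. exact: rmorph_two0 (cst X) two0. Qed.
Let two := poly2_0 two0.

Definition kpoly (u : X) := exists p, u = ev s p.
(* the integral closure of [k[s]] in [k(X)], as an intersection of valuation rings *)
Definition int_closure (u : X) := forall O, is_valuation_ring O -> O s -> O u.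
Local Notation R := int_closure.

Lemma kpoly_subalg : subalg kpoly.
Proof.
split; first by move=> a; exists a%:P; rewrite evpC.
  by move=> _ _ [p ->] [q ->]; exists (p + q); rewrite rmorphD.
by move=> _ _ [p ->] [q ->]; exists (p * q); rewrite rmorphM.
Qed.

Lemma int_subalg : subalg R.
Proof.
split.
- by move=> a O vO _; apply: vring_cst vO _.
- by move=> u v hu hv O vO Os; apply: (vring_add vO); [apply: hu|apply: hv].
- by move=> u v hu hv O vO Os; apply: (vring_mul vO); [apply: hu|apply: hv].
Qed.

Lemma kpoly_int u : kpoly u -> R u.
Proof.
move=> [p ->] O vO Os; elim/poly_ind: p => [|p a IH].
  by rewrite rmorph0; apply: sa0 (vring_subalg vO).
rewrite rmorphD rmorphM /= evpX evpC; apply: (vring_add vO); last exact: vring_cst vO _.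
exact: vring_mul vO _ _ _ _.
Qed.

(** If the reduced denominator [q] were not constant, some valuation ring containing [k[s]] would
    have [q] in its maximal ideal. But a Bezout relation writes [1 / q] as [a u + b], which is in
    that ring. *)
Lemma int_ratl u : P u -> R u -> kpoly u.
Proof.
move=> /(ratl_coprime ts)[p [q [cpq q0 eu]]] Ru.
have nq := transc_neq0 ts q0.
have [/eqP/size_poly1P[r r0 er]|s1] := eqVneq (size q) 1%N.
  by exists (r^-1 *: p); rewrite eu er evpC evpZ fmorphV mulrC.
pose J u := exists p, u = ev s (p * q).
have iJ : ideal_of kpoly J.
  split.
  - by move=> _ [r ->]; exists (r * q).
  - by move=> _ _ [r ->] [r' ->]; exists (r + r'); rewrite mulrDl rmorphD.
  - by move=> _ _ [r ->] [r' ->]; exists (r * r'); rewrite -mulrA [RHS]rmorphM.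
  - move=> [r]; rewrite -(rmorph1 (ev s)) => /(transc_inj ts) e.
    by move: s1; rewrite -dvdp1 e dvdp_mulIr.
have Jq : J (ev s q) by exists 1; rewrite mul1r.
have [O [vO RO JO]] := valuation_dominating kpoly_subalg iJ Jq nq.
have Os : O s by apply: RO; exists 'X; rewrite evpX.
have /Bezout_eq1_coprimepP[[a b] /= e] := cpq.
case: (JO _ Jq) => [z|]; first by rewrite z eqxx in nq.
case; have -> : (ev s q)^-1 = ev s a * u + ev s b.
  apply: (mulIf nq); rewrite mulVf // eu mulrDl mulrA divfK //.
  by rewrite -!rmorphM -rmorphD e rmorph1.
by apply: (vring_add vO); [apply: (vring_mul vO)|]; [apply: RO; eexists|apply: Ru|apply: RO; eexists].
Qed.

Lemma int_integral2 u a b : R a -> R b -> u ^+ 2 + a * u + b = 0 -> R u.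
Proof.
by move=> Ra Rb e O vO Os; apply: (vring_integral2 vO) e; [apply: Ra|apply: Rb].
Qed.

Lemma span_uniq a b a' b' : P a -> P b -> P a' -> P b' ->
  a + b * y = a' + b' * y -> a = a' /\ b = b'.
Proof. by case: gy => _ ny _; apply: AS_uniq. Qed.

(** The elements whose conjugate under [y |-> y + 1] lies in [O] form a valuation ring [O'] that
    still contains [s], to which the hypothesis applies. *)
Lemma int_conj a b : P a -> P b -> R (a + b * y) -> R (a + b + b * y).
Proof.
move=> Pa Pb Rz O vO Os; have [PF ny span] := gy.
pose O' u := exists a b, [/\ P a, P b, u = a + b * y & O (a + b + b * y)].
have O'P u : P u -> O u -> O' u.
  by move=> Pu Ou; exists u, 0; split=> //; rewrite ?mul0r ?addr0 //; apply: sf0.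
have vO' : is_valuation_ring O'.
  have O'M u v : O' u -> O' v -> O' (u * v).
    move=> [a1 [b1 [Pa1 Pb1 -> h1]]] [a2 [b2 [Pa2 Pb2 -> h2]]].
    exists (a1 * a2 + b1 * b2 * (y ^+ 2 + y)), (a1 * b2 + b1 * a2 + b1 * b2).
    split; sf_tac sP; first by ring.
    have := vring_mul vO h1 h2; congr (O _); ring.
  split=> //.
  - by move=> a0; apply: O'P; [exact: ratl_cst|exact: vring_cst vO _].
  - move=> u v [a1 [b1 [Pa1 Pb1 -> h1]]] [a2 [b2 [Pa2 Pb2 -> h2]]].
    exists (a1 + a2), (b1 + b2); split; sf_tac sP; first by ring.
    by have := vring_add vO h1 h2; congr (O _); ring.
  - move=> u; have [a1 [b1 [Pa1 Pb1 eu]]] := span u.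
    have [u0|u0] := eqVneq u 0.
      by left; rewrite u0; apply: O'P; [exact: sf0|exact: sa0 (vring_subalg vO)].
    have [a2 [b2 [Pa2 Pb2 ev]]] := span u^-1.
    have e12 : 1 + 0 * y = (a1 * a2 + b1 * b2 * (y ^+ 2 + y)) + (a1 * b2 + b1 * a2 + b1 * b2) * y.
      by rewrite mul0r addr0 -(mulfV u0) ev {1}eu; ring.
    have Pc : P (a1 * a2 + b1 * b2 * (y ^+ 2 + y)) by sf_tac sP.
    have Pd : P (a1 * b2 + b1 * a2 + b1 * b2) by sf_tac sP.
    have [e1 e2] := span_uniq (sf1 sP) (sf0 sP) Pc Pd e12.
    have ei : (a1 + b1 + b1 * y)^-1 = a2 + b2 + b2 * y.
      have e3 : (a1 + b1 + b1 * y) * (a2 + b2 + b2 * y) = 1.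
        transitivity ((a1 * a2 + b1 * b2 * (y ^+ 2 + y)) + (a1 * b2 + b1 * a2 + b1 * b2)
          + (a1 * b2 + b1 * a2 + b1 * b2) * y); first by ring.
        by rewrite -e1 -e2; ring.
      have n0 : a1 + b1 + b1 * y != 0.
        by apply: contra_eq_neq e3 => ->; rewrite mul0r eq_sym oner_eq0.
      by apply: (mulfI n0); rewrite mulfV // e3.
    have [h|h] := vring_inv vO (a1 + b1 + b1 * y); [left|right].
      by exists a1, b1; split.
    by exists a2, b2; split=> //; rewrite -ei.
  - have [u nu] := vring_proper vO; have [a1 [b1 [Pa1 Pb1 eu]]] := span u.
    exists (a1 + b1 + b1 * y) => -[a2 [b2 [Pa2 Pb2 e h]]].
    apply: nu; move: h.
    have [<- <-] := span_uniq (sfD sP Pa1 Pb1) Pb1 Pa2 Pb2 e.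
    by congr (O _); rewrite eu; ring.
have [|a' [b' [Pa' Pb' e h]]] := Rz O' vO'.
  by apply: O'P => //; apply: ratl_gen.
by have [-> ->] := span_uniq Pa Pb Pa' Pb' e.
Qed.

Lemma int_trace a b : P a -> P b -> R (a + b * y) -> kpoly b.
Proof.
move=> Pa Pb Rz; apply: int_ratl => //.
have -> : b = (a + b * y) + (a + b + b * y) by ring.
by apply: (sa_add int_subalg) => //; apply: int_conj.
Qed.

(** In characteristic two the coefficient of [y] is the trace, so it is polynomial for integral
    elements. Euclidean division by a trace [h] of least degree shows that all these traces are
    multiples of [h]. *)
Lemma int_basis : exists v h, [/\ P v, h != 0, R (v + ev s h * y)
  & forall z, R z -> exists p q, z = ev s p + ev s q * (v + ev s h * y)].
Proof.
have [PF ny span] := gy.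
pose Q n := exists (p : {poly k}) v, [/\ p != 0, size p = n, P v & R (v + ev s p * y)].
have exQ : exists n, `[< Q n >].
  have [p [q [q0 e]]] := PF.
  exists (size q); apply/asboolP; exists q, 0; split=> //; last 1 first.
  - apply: (@int_integral2 _ (ev s q) (ev s (q * p))); try by apply: kpoly_int; eexists.
    rewrite rmorphM /=.
    have -> : (0 + ev s q * y) ^+ 2 + ev s q * (0 + ev s q * y) + ev s q * ev s p
      = ev s q ^+ 2 * (y ^+ 2 + y) + ev s q * ev s p by ring.
    by rewrite e; field.
  - by apply: contraNneq q0 => ->; rewrite rmorph0.
  - exact: sf0.
have [n /asboolP[h [v [h0 sh Pv Rt]]] mn] := ex_minnP exQ.
exists v, h; split=> // z Rz.
have [a [b [Pa Pb ez]]] := span z; have [pb eb] : kpoly b.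
  by apply: (@int_trace a) => //; rewrite -ez.
pose q := pb %/ h; pose r := pb %% h.
have er : ev s pb = ev s q * ev s h + ev s r.
  by rewrite -rmorphM -rmorphD -divp_eq.
have ezq : z - ev s q * (v + ev s h * y) = (a - ev s q * v) + ev s r * y.
  by rewrite ez eb er; ring.
have Rzq : R (z - ev s q * (v + ev s h * y)).
  apply: (sa_add int_subalg) => //; apply: (saN int_subalg).
  by apply: (sa_mul int_subalg) => //; apply: kpoly_int; eexists.
have Paq : P (a - ev s q * v).
  by apply: (sfB sP) => //; apply: (sfM sP) => //; apply: ratl_evp.
have r0 : r = 0.
  apply/eqP; apply: contraT => nr; have := mn (size r).
  rewrite leqNgt -sh ltn_modp h0 /= => /implyP; rewrite implybF => /asboolP; case.
  by exists r, (a - ev s q * v); split=> //; rewrite -ezq.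
have [p ep] : kpoly (a - ev s q * v).
  by apply: int_ratl => //; move: Rzq; rewrite ezq r0 rmorph0 mul0r addr0.
exists p, q; rewrite -ep; move: ezq; rewrite r0 rmorph0 mul0r addr0 => <-.
by rewrite subrK.
Qed.

Variables (D : derivation X) (Ds0 : D s != 0).
(** Normalized to have value [1] at [s], so that it extends the formal derivative of [k[s]]. *)
Let d (u : X) := D u / D s.

Let dD u v : d (u + v) = d u + d v. Proof. by rewrite /d derD mulrDl. Qed.
Let dM u v : d (u * v) = d u * v + u * d v. Proof. by rewrite /d derM; ring. Qed.
Let d_ev p : d (ev s p) = ev s p^`(). Proof. by rewrite /d der_evp mulfK. Qed.

(* [f] is a root of [al f^2 + be f + ga] with unimodular coefficients in [k[s]], and
   [al f], [al f + be] are integral, so one of [al f / al], [ga / (al f + be)] will do. *)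
Lemma int_localize O f : is_valuation_ring O -> O s -> O f ->
  exists a b, [/\ R a, R b, ~ nonunit O b & f = a / b].
Proof.
move=> vO Os Of; have [PF ny span] := gy.
have RO u : R u -> O u by move=> h; apply: h.
have [a [b [Pa Pb ef]]] := span f.
pose N := a ^+ 2 + a * b + b ^+ 2 * (y ^+ 2 + y).
have PN : P N by rewrite /N; sf_tac sP.
have e2 : f ^+ 2 + b * f + N = 0 by rewrite /N ef; ring.
have [p1 [q1 [q10 eb]]] := Pb; have [p2 [q2 [q20 eN]]] := PN.
pose A := q1 * q2; pose B := p1 * q2; pose C := p2 * q1.
have e3 : ev s A * f ^+ 2 + ev s B * f + ev s C = 0.
  rewrite !rmorphM /=; transitivity (ev s q1 * ev s q2 * (f ^+ 2 + b * f + N)).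
    by rewrite eb eN; field; rewrite q10 q20.
  by rewrite e2 mulr0.
have A0 : A != 0.
  by rewrite /A mulf_neq0 //; [apply: contraNneq q10|apply: contraNneq q20] => ->; rewrite rmorph0.
pose g := gcdp (gcdp A B) C.
have g0 : g != 0 by rewrite !gcdp_eq0 !negb_and A0.
have gA : g %| A by rewrite (dvdp_trans (dvdp_gcdl _ _)) ?dvdp_gcdl.
have gB : g %| B by rewrite (dvdp_trans (dvdp_gcdl _ _)) ?dvdp_gcdr.
have gC : g %| C by rewrite dvdp_gcdr.
have [[u1 v1] /= z1] := Bezoutp A B.
have [[u2 v2] /= z2] := Bezoutp (gcdp A B) C.
have [w1 [w2 [w3 [r [r0 ew]]]]] : exists w1 w2 w3 r, r != 0 /\ w1 * A + w2 * B + w3 * C = r *: g.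
  have /eqpP[[r1 r1'] /= /andP[n1 n1'] h1] := z1.
  have /eqpP[[r2 r2'] /= /andP[n2 n2'] h2] := z2.
  exists (r2 *: (u2 * (r1 *: u1))), (r2 *: (u2 * (r1 *: v1))), (r2 *: (r1' *: v2)), (r1' * r2').
  split; first by rewrite mulf_neq0.
  rewrite -scalerA -h2 -!mul_polyC in h1 *.
  transitivity (r2%:P * u2 * (r1%:P * (u1 * A + v1 * B)) + r2%:P * r1'%:P * v2 * C); first by ring.
  by rewrite h1; ring.
pose al := A %/ g; pose be := B %/ g; pose ga := C %/ g.
have eal : A = al * g by rewrite divpK.
have ebe : B = be * g by rewrite divpK.
have ega : C = ga * g by rewrite divpK.
have comb : w1 * al + w2 * be + w3 * ga = r%:P.
  apply: (mulIf g0); rewrite mul_polyC -ew eal ebe ega; ring.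
have ng := transc_neq0 ts g0.
have e4 : ev s al * f ^+ 2 + ev s be * f + ev s ga = 0.
  apply: (mulIf ng); rewrite mul0r -[RHS]e3 eal ebe ega !rmorphM /=; ring.
have K p : R (ev s p) by apply: kpoly_int; exists p.
have Raf : R (ev s al * f).
  apply: (int_integral2 (K be) (K (al * ga))); rewrite rmorphM /=.
  transitivity (ev s al * (ev s al * f ^+ 2 + ev s be * f + ev s ga)); first by ring.
  by rewrite e4 mulr0.
have Rb : R (ev s al * f + ev s be) by apply: (sa_add int_subalg).
have [ma|na] := pselect (nonunit O (ev s al)); last first.
  by exists (ev s al * f), (ev s al); split=> //; rewrite mulrAC mulfV ?mul1r // (unit_neq0 na).
have eg : ev s ga = f * (ev s al * f + ev s be).
  by apply: (addr2_eq0 twoX); rewrite -[RHS]e4; ring.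
have [mb|nb] := pselect (nonunit O (ev s al * f + ev s be)); last first.
  by exists (ev s ga), (ev s al * f + ev s be); split=> //; rewrite eg mulfK // (unit_neq0 nb).
exfalso.
have maf : nonunit O (ev s al * f) by rewrite mulrC; apply: nonunit_mul.
have mbe : nonunit O (ev s be).
  have -> : ev s be = ev s al * f + ev s be + ev s al * f by ring.
  exact: nonunit_add.
have mga : nonunit O (ev s ga) by rewrite eg; apply: nonunit_mul.
have : nonunit O (cst X r).
  rewrite -(evpC _ s) -comb !rmorphD !rmorphM /=.
  have OK p : O (ev s p) by apply: RO.
  by apply: (nonunit_add vO); [apply: (nonunit_add vO)|]; apply: nonunit_mul.
case=> [/eqP|]; first by rewrite fmorph_eq0 (negPf r0).
by rewrite -fmorphV; apply; apply: vring_cst vO _.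
Qed.

(** Let [1, th] be the basis of [R] over [k[s]] and [c = w / ds]. Regularity at all valuation rings
    containing [s] puts [c] in [R + R * d th]. Differentiating [th ^ 2 + h th = g] gives
    [h * d th = h' th + g'], whence [h c] is integral and the coefficient of [y] in [c] is a
    polynomial. The second claim follows because every integral trace [b] is a multiple of [h]. *)
Lemma regular_trace w e0 e1 : regular w -> P e0 -> P e1 -> w D / D s = e0 + e1 * y ->
  kpoly e1 /\ (forall a b, P a -> P b -> R (a + b * y) -> e1 = 0 -> kpoly (e0 * b)).
Proof.
move=> rw Pe0 Pe1 ec; have [PF ny span] := gy.
have [v [h [Pv h0 Rt basis]]] := int_basis.
have [th eth] : exists th, th = v + ev s h * y by eexists.
rewrite -eth in Rt basis; pose c := w D / D s.
have K p : R (ev s p) by apply: kpoly_int; exists p.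
have [g eg] : kpoly (th ^+ 2 + ev s h * th).
  apply: int_ratl.
    have -> : th ^+ 2 + ev s h * th = v ^+ 2 + ev s h * v + ev s h ^+ 2 * (y ^+ 2 + y).
      by rewrite eth; ring.
    have Ph : P (ev s h) by apply: ratl_evp.
    by sf_tac sP.
  by apply: (sa_add int_subalg); rewrite ?expr2; apply: (sa_mul int_subalg).
have hdt : ev s h * d th = ev s h^`() * th + ev s g^`().
  rewrite -!d_ev -eg dD expr2 !dM. ring.
(* [M = R + R * d th] is the module of differentials of [R], divided by [D s]. *)
pose M u := exists f f2, [/\ R f, R f2 & u = f * d th + f2].
have MD u u' : M u -> M u' -> M (u + u').
  move=> [f [f2 [Rf Rf2 ->]]] [f' [f2' [Rf' Rf2' ->]]].
  by exists (f + f'), (f2 + f2'); split; [by apply: (sa_add int_subalg)|by apply: (sa_add int_subalg)|ring].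
have MM r u : R r -> M u -> M (r * u).
  move=> Rr [f [f2 [Rf Rf2 ->]]]; exists (r * f), (r * f2).
  by split; [by apply: (sa_mul int_subalg)|by apply: (sa_mul int_subalg)|ring].
have MR u : R u -> M u.
  by move=> Ru; exists 0, u; split=> //; [by apply: (sa0 int_subalg)|rewrite mul0r add0r].
have Md u : R u -> M (d u).
  move=> /basis[p [q ->]]; rewrite dD dM !d_ev.
  exists (ev s q), (ev s p^`() + ev s q^`() * th); split=> //; last by ring.
  by apply: (sa_add int_subalg) => //; apply: (sa_mul int_subalg).
(* The ideal of denominators of [c]. If it were proper, it would lie in the maximal ideal of a
   valuation ring [O] containing [R], yet regularity at [O] produces a denominator outside that
   maximal ideal. *)
pose J r := R r /\ M (r * c).
have Mc : M c.
  apply: contrapT => nM.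
  have iJ : ideal_of R J.
    split.
    - by move=> u [].
    - move=> u u' [Ru Mu] [Ru' Mu']; split; first by apply: (sa_add int_subalg).
      by rewrite mulrDl; apply: MD.
    - move=> r u Rr [Ru Mu]; split; first by apply: (sa_mul int_subalg).
      by rewrite -mulrA; apply: MM.
    - by move=> [_]; rewrite mul1r.
  have [r0 [Jr0 nr0]] : exists r0, J r0 /\ r0 != 0.
    have [p0 [q0 [nq0 ee0]]] := Pe0; have [p1 [q1 [nq1 ee1]]] := Pe1.
    have [pv [qv [nqv ev']]] := Pv.
    exists (ev s (q0 * q1 * qv * h)).
    split; last by rewrite !rmorphM /= !mulf_neq0 // transc_neq0.
    split=> //; apply: MR.
    have -> : ev s (q0 * q1 * qv * h) * c = ev s (p0 * q1 * qv * h)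
        + ev s (p1 * q0) * (ev s qv * th - ev s pv).
      by rewrite /c ec ee0 ee1 eth ev' !rmorphM /=; field; rewrite nq0 nq1 nqv.
    apply: (sa_add int_subalg) => //; apply: (sa_mul int_subalg) => //.
    apply: (sa_add int_subalg); last by apply: (saN int_subalg).
    by apply: (sa_mul int_subalg).
  have [O [vO RO JO]] := valuation_dominating int_subalg iJ Jr0 nr0.
  have Os : O s by apply: RO; rewrite -(evpX (cst X) s).
  have [n [f [t [Of Ot ew]]]] := rw O vO.
  pose L u := exists b, [/\ R b, ~ nonunit O b & M (b * u)].
  have LD u u' : L u -> L u' -> L (u + u').
    move=> [b [Rb nb Mb]] [b' [Rb' nb' Mb']]; exists (b * b'); split.
    - by apply: (sa_mul int_subalg).
    - by apply: unit_mul => //; apply: RO.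
    - have -> : b * b' * (u + u') = b' * (b * u) + b * (b' * u') by ring.
      by apply: MD; apply: MM.
  have : L c.
    rewrite /c ew mulr_suml; apply: (big_ind L) => [||i _] //.
      exists 1; split; [by apply: (sa1 int_subalg)|exact: nonunit1|rewrite mulr0].
      by apply: MR; apply: sa0 int_subalg.
    rewrite -mulrA -/(d (t i)).
    have [a [b [Ra Rb nb ->]]] := int_localize vO Os (Of i).
    have [p [q [Rp Rq nq et]]] := int_localize vO Os (Ot i).
    have b0 := unit_neq0 nb; have q0 := unit_neq0 nq.
    exists (b * (q * q)); split.
    - by do 2!apply: (sa_mul int_subalg) => //.
    - have Oq := RO _ Rq; apply: (unit_mul vO) (unit_mul vO Oq Oq nq nq) => //.
        exact: RO.
      exact: (vring_mul vO Oq Oq).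
    - have -> : b * (q * q) * (a / b * d (t i)) = a * (q * d p + p * d q).
        have ep : p = t i * q by rewrite et divfK.
        have -> : d p = d (t i) * q + t i * d q by rewrite {1}ep dM.
        by rewrite ep; field.
      by apply: (MM) => //; apply: (MD); apply: (MM) => //; apply: (Md).
  move=> [b [Rb nb Mb]]; apply: nb; apply: JO; split=> //.
have [f [f2 [Rf Rf2 eM]]] := Mc.
have [f0 [f1 ef]] := basis _ Rf; have [p0 [p1 ef2]] := basis _ Rf2.
pose T := f0 * h^`() + f1 * g^`() + f1 * h^`() * h + h * p1.
have nh := transc_neq0 ts h0.
have ehc : ev s h * c = (ev s f0 * ev s g^`() + ev s f1 * ev s h^`() * ev s g + ev s h * ev s p0)
     + ev s T * th.
  rewrite eM mulrDr mulrCA hdt -eg ef ef2 /T !rmorphD !rmorphM /=; ring.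
have kc : R (ev s h * c).
  rewrite ehc; apply: (sa_add int_subalg); last by apply: (sa_mul int_subalg).
  by rewrite -!rmorphM -!rmorphD; apply: K.
have PE p : P (ev s p) by apply: ratl_evp.
have [q eq] : kpoly e1.
  exists T; have [] := @span_uniq (ev s h * e0) (ev s h * e1)
     ((ev s f0 * ev s g^`() + ev s f1 * ev s h^`() * ev s g + ev s h * ev s p0) + ev s T * v)
     (ev s T * ev s h).
  - by apply: (sfM sP).
  - by apply: (sfM sP).
  - by have := PE f0; have := PE f1; have := PE g; have := PE h; have := PE p0; have := PE T;
      have := PE g^`(); have := PE h^`() => *; sf_tac sP.
  - by apply: (sfM sP).
  - rewrite -mulrA -mulrDr -ec -/c ehc eth; ring.
  by move=> _ e; apply: (mulfI nh); rewrite e mulrC.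
split; first by exists q.
move=> a b Pa Pb Rz e10.
have [p' [q' ez]] := basis _ Rz.
have [_ eb] : a = ev s p' + ev s q' * v /\ b = ev s q' * ev s h.
  apply: span_uniq => //; try by have := PE p'; have := PE q'; have := PE h => *; sf_tac sP.
  by rewrite ez eth; ring.
rewrite eb; apply: int_ratl.
  by have := PE p'; have := PE q'; have := PE h => *; sf_tac sP.
have -> : e0 * (ev s q' * ev s h) = ev s q' * (ev s h * c).
  by rewrite /c ec e10; ring.
by apply: (sa_mul int_subalg).
Qed.

End LocalKey.

(** * Gluing the charts [s] and [s^-1] *)

Section Key.
Variables (k : fieldType) (two0 : 2 = 0 :> k) (X : curve_data k) (s y : X).
Local Notation ev := (evp (cst X)).
Local Notation P := (ratl (cst X)).
Hypotheses (ts : transc (cst X) s) (gy : AS_gen (P s) y).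

Let sP := ratl_subfield (cst X) s.
Let twoX : 2 = 0 :> X. Proof. exact: rmorph_two0 (cst X) two0. Qed.

Lemma transc_gen_neq0 : s != 0.
Proof. by apply/eqP; rewrite -(rmorph0 (cst X)); apply: transc_ncst. Qed.
Let s0 := transc_gen_neq0.

Lemma ratlV : P s^-1 = P s.
Proof.
apply/funext => z; apply/propext; split.
  apply: ratl_min sP _ _ _; first exact: ratl_cst.
  by apply: (sfV sP); apply: ratl_gen.
apply: ratl_min (ratl_subfield _ _) _ _ _; first exact: ratl_cst.
by rewrite -[s in P _ s]invrK; apply: (sfV (ratl_subfield _ _)); apply: ratl_gen.
Qed.

Lemma transcV : transc (cst X) s^-1.
Proof.
move=> p e; pose r := \poly_(i < size p) p`_((size p).-1 - i).
apply/eqP; apply: contraT => p0; have sp : (0 < size p)%N by rewrite size_poly_gt0.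
have : ev s r = 0.
  transitivity (s ^+ (size p).-1 * ev s^-1 p); last by rewrite e mulr0.
  rewrite [r]poly_def rmorph_sum /= [ev s^-1 p]/evp /= /horner_eval horner_coef size_map_poly mulr_sumr.
  rewrite (reindex_inj rev_ord_inj) /=; apply: eq_bigr => i _.
  have li : (i <= (size p).-1)%N by rewrite -ltnS prednK.
  rewrite evpZ rmorphXn /= evpX coef_map exprVn /=.
  have -> : (size p - i.+1 = (size p).-1 - i)%N by rewrite -subn1 subnAC subn1 subnS.
  rewrite subKn // mulrCA; congr (_ * _).
  by rewrite -[in RHS](subnK li) exprD mulfK // expf_neq0.
move=> /ts r0; have := congr1 (fun q : {poly k} => q`_0) r0.
by rewrite coef0 coef_poly sp subn0 => /eqP; rewrite -/(lead_coef p) lead_coef_eq0 (negPf p0).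
Qed.

Variables (D : derivation X) (Ds0 : D s != 0) (w : differential X) (rw : regular w).

Let gyV : AS_gen (P s^-1) y. Proof. by rewrite ratlV. Qed.
Let DsV : D s^-1 = D s / s ^+ 2.
Proof. by rewrite derV // oppr2. Qed.
Let DsV0 : D s^-1 != 0.
Proof. by rewrite DsV mulf_neq0 // invr_eq0 expf_neq0. Qed.
Let eV : w D / D s^-1 = w D / D s * s ^+ 2.
Proof. by rewrite DsV; field; rewrite Ds0. Qed.
Let Ps : P s s. Proof. exact: ratl_gen. Qed.

(* A trace of a regular differential is a regular differential on the line, hence zero. *)
Lemma regular_ratl : P s (w D / D s).
Proof.
have [PF ny span] := gy.
have [e0 [e1 [Pe0 Pe1 ec]]] := span (w D / D s).
have [[p ep] _] := regular_trace two0 ts gy Ds0 rw Pe0 Pe1 ec.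
(* Since [ds = s ^ 2 d(s^-1)], the coefficients acquire a factor [s ^ 2] in the other chart; a
   nonzero polynomial trace cannot stay polynomial in [s^-1] after this. *)
have [] := @regular_trace k two0 X s^-1 y transcV gyV D DsV0 w (e0 * s ^+ 2) (e1 * s ^+ 2) rw.
- by rewrite ratlV; sf_tac sP.
- by rewrite ratlV; sf_tac sP.
- by rewrite eV ec; ring.
move=> [q eq] _.
have : (size (p * 'X^2)%R <= 1)%N.
  apply: (@evp_inv_size _ _ (cst X) s 0 _ q) => //.
  by rewrite rmorphM rmorphXn /= evpX -ep eq mul1r.
have [p0|p0] := eqVneq p 0.
  by rewrite ec ep p0 rmorph0 !mul0r addr0.
rewrite size_mul ?expf_neq0 ?polyX_eq0 // size_polyXn addn3 /= ltnS leqn0 => /eqP.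
by lia.
Qed.

(** The regular differentials have the shape [q ds / U] with [deg q <= m - 2]: integrality at
    infinity bounds the degree by [m], and the factor [s ^ 2] of [ds] takes two away. *)
Lemma regular_bound m a (U : {poly k}) : (2 <= m)%N ->
  P s a -> int_closure s (a + ev s U * y) ->
  int_closure s^-1 ((a + ev s U * y) / s ^+ m) ->
  exists2 q : {poly k}, (size q < m)%N & w D / D s * ev s U = ev s q.
Proof.
move=> m2 Pa R1 R2; have Pe := regular_ratl.
have PU : P s (ev s U) by apply: ratl_evp.
have P0 := sf0 sP.
have ee : w D / D s = w D / D s + 0 * y by rewrite mul0r addr0.
have [_ h1] := regular_trace two0 ts gy Ds0 rw Pe P0 ee.
have [q eq] := h1 _ _ Pa PU R1 erefl.
exists q => //.
have [] := @regular_trace k two0 X s^-1 y transcV gyV D DsV0 w (w D / D s * s ^+ 2) 0 rw.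
- by rewrite ratlV; sf_tac sP.
- by rewrite ratlV; sf_tac sP.
- by rewrite eV mul0r addr0.
move=> _ /(_ (a / s ^+ m) (ev s U / s ^+ m)) [].
- by rewrite ratlV; sf_tac sP.
- by rewrite ratlV; sf_tac sP.
- by have := R2; congr (int_closure _ _); ring.
- by [].
move=> r er; have : (size q <= (m - 2).+1)%N.
  apply: (@evp_inv_size _ _ (cst X) s (m - 2) q r ts s0); rewrite -eq -er.
  have -> : s ^+ m = s ^+ (m - 2) * s ^+ 2 by rewrite -exprD subnK.
  by field; rewrite !expf_neq0 ?s0 ?Ds0.
by lia.
Qed.
End Key.

(** * Double covers in normal form *)

Section NormalForm.
Variables (k K : fieldType) (c : {rmorphism k -> K}).

Definition quad (a d : k) (x : K) : K := c a * x ^+ 2 + x + c d.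
Definition lin (al ga : k) (x : K) : K := c al * x + c ga.
(* the resultant of al x + ga and a x^2 + x + d in characteristic 2 *)
Definition res (a d al ga : k) : k := al ^+ 2 * d + al * ga + ga ^+ 2 * a.

Definition normal_form a d al ga e x w : Prop :=
  w ^+ 2 + w = lin al ga x ^+ 2 / quad a d x + c e.

(** A Bezout identity: it puts the resultant in the ideal of the quadratic and the linear form,
    which therefore have no common zero when it is nonzero. *)
Lemma res_comb a d al ga x : 2 = 0 :> k ->
  c (res a d al ga) = c al ^+ 2 * quad a d x + c a * lin al ga x ^+ 2 + c al * lin al ga x.
Proof.
move=> /(rmorph_two0 c) two; rewrite /res /quad /lin; ring.
Qed.

Lemma resC a d al ga : res d a ga al = res a d al ga.
Proof. by rewrite /res; ring. Qed.

Lemma quadV a d x : x != 0 -> quad d a x^-1 = quad a d x / x ^+ 2.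
Proof. by move=> x0; rewrite /quad; field. Qed.

Lemma linV al ga x : x != 0 -> lin ga al x^-1 = lin al ga x / x.
Proof. by move=> x0; rewrite /lin; field. Qed.

(** In the chart [x^-1] both forms are replaced by their reversals, so that infinity is handled like
    any other point. *)
Lemma normal_formV a d al ga e x w : x != 0 -> normal_form a d al ga e x w ->
  normal_form d a ga al e x^-1 w.
Proof.
move=> x0; rewrite /normal_form => ->; rewrite quadV // linV // expr_div_n invf_div.
congr (_ + _); rewrite mulf_div; have [->|q0] := eqVneq (quad a d x) 0.
  by rewrite mulr0 !invr0 !mulr0.
by field; rewrite q0.
Qed.
End NormalForm.

(** * Local regularity of [dx / A] and [w dx / A] *)

Section Regularity.
Variables (k : fieldType) (two0 : 2 = 0 :> k) (X : curve_data k).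
Let twoX : 2 = 0 :> X. Proof. exact: rmorph_two0 (cst X) two0. Qed.
Local Notation c := (cst X).

Lemma regular_at1 (O : X -> Prop) (w : differential X) f t : O f -> O t ->
  (forall D : derivation X, w D = f * D t) -> regular_at O w.
Proof.
move=> Of Ot e; exists 1%N, (fun=> f), (fun=> t); split=> // D.
by rewrite big_ord1 e.
Qed.

Variables (a d : k) (x : X).
Local Notation A := (quad c a d x).

Lemma der_quad (D : derivation X) : D A = D x.
Proof. by rewrite /quad !derD derM !der_cst der_sqr //; ring. Qed.

Section AtO.
Variables (O : X -> Prop) (vO : is_valuation_ring O) (Ox : O x).
Let sO := vring_subalg vO.
Let Oc r : O (c r). Proof. exact: sa_cst sO _. Qed.

Lemma quad_in : O A.
Proof. by rewrite /quad expr2; do 2!apply: (sa_add sO) => //; do 2?apply: (sa_mul sO) => //. Qed.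
Lemma lin_in al ga : O (lin c al ga x).
Proof. by rewrite /lin; apply: (sa_add sO) => //; apply: (sa_mul sO). Qed.

Hypotheses (A0 : A != 0) (mA : nonunit O A).

Lemma lin_unit al ga : res a d al ga != 0 -> ~ nonunit O (lin c al ga x).
Proof.
move=> r0 mS; have : nonunit O (c (res a d al ga)).
  rewrite (res_comb c a d al ga x two0) [_ ^+ 2 in X in _ + X + _]expr2 [c a * _]mulrA.
  have OS := lin_in al ga.
  apply: (nonunit_add vO); [apply: (nonunit_add vO)|].
  - by apply: (nonunit_mul vO) => //; apply: (saX 2 sO).
  - by apply: (nonunit_mul vO) => //; apply: (sa_mul sO).
  - exact: (nonunit_mul vO).
case=> [/eqP|]; first by rewrite fmorph_eq0 (negPf r0).
by rewrite -fmorphV; apply; apply: Oc.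
Qed.

(** At a zero of [A] the numerator [S] is a unit, hence so is [A (w ^ 2 + w)]: the pole of [w] has
    half the order of the zero of [A]. *)
Lemma normal_form_at al ga e w : res a d al ga != 0 -> normal_form c a d al ga e x w ->
  [/\ ~ O w, nonunit O (A * w), O (A * w ^+ 2)
    & forall D : derivation X, D w = (lin c al ga x / A) ^+ 2 * D x].
Proof.
move=> r0 nf; set S := lin c al ga x.
have OA := quad_in; have OS : O S by apply: lin_in.
have uS : ~ nonunit O S by apply: lin_unit.
have e1 : A * (w ^+ 2 + w) = S ^+ 2 + c e * A by rewrite nf -/S; field.
have nw : ~ O w.
  move=> Ow; apply: (unit_mul vO OS OS uS uS).
  have -> : S * S = (w ^+ 2 + w - c e) * A.
    by transitivity (A * (w ^+ 2 + w) - c e * A); [rewrite e1|]; ring.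
  apply: (nonunit_mul vO) => //; apply: (sa_add sO); last exact: saN sO (Oc _).
  by apply: (sa_add sO) => //; apply: (saX 2 sO).
have Sq : O (S ^+ 2 + c e * A).
  by apply: (sa_add sO); [apply: (saX 2 sO)|apply: (sa_mul sO)].
have nw1 : ~ O (w + 1).
  by move=> h; apply: nw; rewrite -(addrK 1 w); apply: (sa_add sO) => //; apply: (saN sO); apply: (sa1 sO).
have w10 : w + 1 != 0 by apply: contra_notN nw1 => /eqP ->; apply: (sa0 sO).
have mAw : nonunit O (A * w).
  have -> : A * w = (S ^+ 2 + c e * A) * (w + 1)^-1.
    by rewrite -e1; field.
  by apply: (nonunit_mul vO) => //; apply: vring_nonunitV.
have OAw := nonunit_sub vO mAw.
split=> //.
  have -> : A * w ^+ 2 = S ^+ 2 + c e * A - A * w by rewrite -e1; ring.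
  by apply: (sa_add sO) => //; apply: (saN sO).
move=> D; have -> : D w = D (w ^+ 2 + w) by rewrite derD der_sqr // add0r.
by rewrite nf derD der_cst addr0 derM der_sqr // derV // der_quad -/S; field.
Qed.

End AtO.

(** At a zero of [A] the function [w^-1] is in [O], and from [d(w^-1) = S ^ 2 / (A w) ^ 2 dx] the
    form [dx / A] is [A w ^ 2 / S ^ 2] times [d(w^-1)]. *)
Lemma regular1_at (O : X -> Prop) al ga e w : is_valuation_ring O -> O x -> A != 0 ->
  res a d al ga != 0 -> normal_form c a d al ga e x w ->
  regular_at O (fun D : derivation X => D x / A).
Proof.
move=> vO Ox A0 r0 nf; have sO := vring_subalg vO.
have OA := quad_in vO Ox.
have [mA|uA] := pselect (nonunit O A); last first.
  by apply: (@regular_at1 O _ A^-1 x) => // [|D]; [exact: nonunit_inv|rewrite mulrC].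
have [nw _ OAw dw] := normal_form_at vO Ox A0 mA r0 nf.
have uS := lin_unit vO Ox mA r0; set S := lin c al ga x in uS dw.
have S0 := unit_neq0 uS.
have w0 : w != 0 by apply: contra_notN nw => /eqP ->; apply: (sa0 sO).
apply: (@regular_at1 O _ (A * w ^+ 2 * (S^-1 * S^-1)) w^-1).
- have OS : O S^-1 by apply: nonunit_inv uS; apply: lin_in.
  by apply: (sa_mul sO) => //; apply: (sa_mul sO).
- by have [] := vring_inv vO w.
- by move=> D; rewrite derV // dw; field; rewrite A0 S0 w0.
Qed.

(** Near a zero of [A] the poles of [w1] and [w2] have half its order, and in [z = S2 w1 + S1 w2]
    they cancel down to a quarter, because [z ^ 2] equals [S2 ^ 2 w1 + S1 ^ 2 w2] up to an element
    of [O]. A pole of [z] survives since [S1 S2 (S1 + S2)] is a unit; this is what the three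
    resultants ensure. *)
Lemma regular2_at (O : X -> Prop) al1 ga1 e1 w1 al2 ga2 e2 w2 :
  is_valuation_ring O -> O x -> A != 0 ->
  res a d al1 ga1 != 0 -> res a d al2 ga2 != 0 -> res a d (al1 + al2) (ga1 + ga2) != 0 ->
  normal_form c a d al1 ga1 e1 x w1 -> normal_form c a d al2 ga2 e2 x w2 ->
  regular_at O (fun D : derivation X => w1 * (D x / A)).
Proof.
move=> vO Ox A0 r1 r2 r3 nf1 nf2; have sO := vring_subalg vO.
have OA := quad_in vO Ox.
have OS1 := lin_in vO Ox al1 ga1; have OS2 := lin_in vO Ox al2 ga2.
have Oc r : O (c r) by apply: sa_cst sO _.
have [mA|uA] := pselect (nonunit O A); last first.
  have OV := nonunit_inv OA uA.
  apply: (@regular_at1 O _ (w1 * A^-1) x) => // [|D]; last by ring.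
  apply: (sa_mul sO) => //; apply: (@vring_integral2 _ _ _ vO w1 1 (- (w1 ^+ 2 + w1))).
  - exact: sa1 sO.
  - rewrite nf1; apply: (saN sO); apply: (sa_add sO) => //.
    by rewrite expr2; apply: (sa_mul sO) => //; apply: (sa_mul sO).
  - by ring.
have [nw1 mAw1 OAw1 dw1] := normal_form_at vO Ox A0 mA r1 nf1.
have [nw2 mAw2 OAw2 dw2] := normal_form_at vO Ox A0 mA r2 nf2.
have uS1 := lin_unit vO Ox mA r1; have uS2 := lin_unit vO Ox mA r2.
have uS3 := lin_unit vO Ox mA r3.
have e3 : lin c (al1 + al2) (ga1 + ga2) x = lin c al1 ga1 x + lin c al2 ga2 x.
  by rewrite /lin !rmorphD; ring.
move: nf1 nf2; rewrite /normal_form => nf1 nf2.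
have dS1 (D : derivation X) : D (lin c al1 ga1 x) = c al1 * D x.
  by rewrite /lin derD derM !der_cst; ring.
have dS2 (D : derivation X) : D (lin c al2 ga2 x) = c al2 * D x.
  by rewrite /lin derD derM !der_cst; ring.
rewrite e3 in uS3; move: (lin c al1 ga1 x) (lin c al2 ga2 x) => S1 S2 in OS1 OS2 uS1 uS2 uS3 dS1 dS2 dw1 dw2 nf1 nf2 *.
have w10 : w1 != 0 by apply: contra_notN nw1 => /eqP ->; apply: (sa0 sO).
have OX n v : O v -> O (v ^+ n) by apply: saX.
have OM := sa_mul sO; have OD := sa_add sO.
have NM := nonunit_mul vO; have ND := nonunit_add vO; have UM := unit_mul vO.
have OAw1' := nonunit_sub vO mAw1; have OAw2' := nonunit_sub vO mAw2.
have [q eq] : exists q, q = A by eexists.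
rewrite -{}eq in A0 mA OA mAw1 OAw1 mAw2 OAw2 OAw1' OAw2' dw1 dw2 nf1 nf2 *.
have OAww : O (q * w1 * w2).
  apply: (vring_integral2 vO (sa0 sO) (OM _ _ (saN sO OAw1) OAw2)).
  by ring.
(* [z] has a pole, and [dz] is a unit times [dx / A^2]: this makes [1 / z] do the job. *)
pose z := S2 * w1 + S1 * w2; pose u := S2 ^+ 2 * w1 + S1 ^+ 2 * w2.
pose kap := S2 ^+ 2 * c e1 + S1 ^+ 2 * c e2.
have Okap : O kap by apply: (OD); apply: (OM) => //; apply: saX.
have z2 : z ^+ 2 = u + kap.
  transitivity (u + S2 ^+ 2 * (w1 ^+ 2 + w1) + S1 ^+ 2 * (w2 ^+ 2 + w2)).
    by rewrite /z /u; ring.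
  by rewrite nf1 nf2 /kap; field.
pose S12 := S1 * S2 * (S1 + S2).
have OS3 := OD _ _ OS1 OS2; have OS12 := OM _ _ OS1 OS2.
have O12 : O S12 by apply: (OM).
have u12 : ~ nonunit O S12 by apply: (UM) => //; apply: (UM).
have Au2 : q * u ^+ 2 = S12 ^+ 2 + (S2 ^+ 4 * (q * w1) + S1 ^+ 4 * (q * w2)
    + (S2 ^+ 4 * c e1 + S1 ^+ 4 * c e2) * q).
  transitivity (S2 ^+ 4 * (q * (w1 ^+ 2 + w1)) + S1 ^+ 4 * (q * (w2 ^+ 2 + w2))
    + S2 ^+ 4 * (q * w1) + S1 ^+ 4 * (q * w2)); first by rewrite /u; ring.
  by rewrite nf1 nf2 /S12; field.
have mrest : nonunit O (S2 ^+ 4 * (q * w1) + S1 ^+ 4 * (q * w2)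
    + (S2 ^+ 4 * c e1 + S1 ^+ 4 * c e2) * q).
  have O4 v : O v -> O (v ^+ 4) by apply: saX.
  apply: (ND); first by apply: (ND); apply: (NM) => //; apply: (O4).
  by apply: (NM) => //; apply: (OD); apply: (OM) => //; apply: (O4).
have nu : ~ O u.
  move=> Ou; apply: (UM _ _ O12 O12 u12 u12).
  have -> : S12 * S12 = u ^+ 2 * q + (S2 ^+ 4 * (q * w1) + S1 ^+ 4 * (q * w2)
    + (S2 ^+ 4 * c e1 + S1 ^+ 4 * c e2) * q).
    by rewrite [u ^+ 2 * q]mulrC Au2; ring.
  by apply: (ND) => //; apply: (NM) => //; apply: (saX 2 sO).
have nz : ~ O z.
  move=> Oz; apply: nu; have -> : u = z ^+ 2 + kap by rewrite z2; ring.
  by apply: (OD) => //; apply: (saX 2 sO).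
have z0 : z != 0 by apply: contra_notN nz => /eqP ->; apply: (sa0 sO).
pose den := (c al2 * (q * w1) + c al1 * (q * w2)) * q + S12.
have Oden : O den by apply: (OD) => //; apply: (OM) => //; apply: (OD); apply: (OM).
have uden : ~ nonunit O den.
  move=> h; apply: u12; have -> : S12 = den + (c al2 * (q * w1) + c al1 * (q * w2)) * q.
    by rewrite /den; ring.
  by apply: (ND) => //; apply: (NM) => //; apply: (OD); apply: (OM).
have den0 := unit_neq0 uden.
pose num := S2 ^+ 2 * (q * w1 ^+ 2) + S1 ^+ 2 * (q * w1 * w2) + kap * (q * w1).
have Onum : O num.
  by apply: (OD); [apply: (OD)|]; apply: (OM) => //; apply: (saX 2 sO).
have enum : num = q * w1 * z ^+ 2 by rewrite z2 /num /u; ring.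
have dz (D : derivation X) : D z = den / q ^+ 2 * D x.
  rewrite /z derD !derM dw1 dw2 dS1 dS2 /den /S12; field.
  exact: A0.
apply: (@regular_at1 O _ (num * den^-1) z^-1).
- by apply: (OM) => //; apply: nonunit_inv.
- by have [] := vring_inv vO z.
- by move=> D; rewrite derV // dz enum; field; rewrite A0 z0 den0.
Qed.

End Regularity.

(** * Double covers by an elliptic curve *)

Section Forms.
Variables (k K : fieldType) (c : {rmorphism k -> K}).

Lemma quad_evp a d x : quad c a d x = evp c x (a *: 'X^2 + 'X + d%:P).
Proof. by rewrite /quad !rmorphD /= evpZ rmorphXn /= evpX evpC. Qed.
Lemma lin_evp al ga x : lin c al ga x = evp c x (al *: 'X + ga%:P).
Proof. by rewrite /lin !rmorphD /= evpZ evpX evpC. Qed.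

Lemma quad_poly_neq0 (a d : k) : a *: 'X^2 + 'X + d%:P != 0 :> {poly k}.
Proof.
apply/negP => /eqP/(congr1 (fun p : {poly k} => p`_1)).
by rewrite !coefD coefZ coefXn coefX coefC coef0 /= mulr0 add0r addr0 => /eqP; rewrite oner_eq0.
Qed.

Lemma quad_neq0 a d x : transc c x -> quad c a d x != 0.
Proof. by move=> tx; rewrite quad_evp transc_neq0 // quad_poly_neq0. Qed.

Lemma lin_neq0 al ga x : transc c x -> (al != 0) || (ga != 0) -> lin c al ga x != 0.
Proof.
move=> tx h; rewrite lin_evp transc_neq0 //.
apply: contraTneq h => e; rewrite negb_or !negbK; apply/andP; split.
  have := congr1 (fun p : {poly k} => p`_1) e.
  by rewrite coefD coefZ coefX coefC coef0 /= mulr1 addr0 => ->.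
have := congr1 (fun p : {poly k} => p`_0) e.
by rewrite coefD coefZ coefX coefC coef0 /= mulr0 add0r => ->.
Qed.

Lemma ratl_quad a d x : ratl c x (quad c a d x).
Proof. by rewrite quad_evp; apply: ratl_evp. Qed.
Lemma ratl_lin al ga x : ratl c x (lin c al ga x).
Proof. by rewrite lin_evp; apply: ratl_evp. Qed.
End Forms.

Section GlobalRegularity.
Variables (k : fieldType) (two0 : 2 = 0 :> k) (X : curve_data k) (x : X).
Hypothesis tx : transc (cst X) x.
Variables (a d : k).
Local Notation c := (cst X).

Let twoX : 2 = 0 :> X. Proof. exact: rmorph_two0 (cst X) two0. Qed.

Lemma regular1 al ga e w : res a d al ga != 0 -> normal_form c a d al ga e x w ->
  regular (fun D : derivation X => D x / quad c a d x).
Proof.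
move=> r0 nf O vO; have x0 := transc_gen_neq0 tx; have A0 := quad_neq0 a d tx.
have [Ox|Ox] := vring_inv vO x; first exact: (regular1_at two0 vO Ox A0 r0 nf).
have := @regular1_at k two0 X d a x^-1 O ga al e w vO Ox.
rewrite quadV // mulf_neq0 ?invr_eq0 ?expf_neq0 // resC => /(_ isT r0 (normal_formV x0 nf)).
move=> [n [f [t [Of Ot h]]]]; exists n, f, t; split=> // D; rewrite -h derV // oppr2 //.
by field; rewrite A0 x0.
Qed.

Lemma regular2 al1 ga1 e1 w1 al2 ga2 e2 w2 :
  res a d al1 ga1 != 0 -> res a d al2 ga2 != 0 -> res a d (al1 + al2) (ga1 + ga2) != 0 ->
  normal_form c a d al1 ga1 e1 x w1 -> normal_form c a d al2 ga2 e2 x w2 ->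
  regular (fun D : derivation X => w1 * (D x / quad c a d x)).
Proof.
move=> r1 r2 r3 nf1 nf2 O vO; have x0 := transc_gen_neq0 tx; have A0 := quad_neq0 a d tx.
have [Ox|Ox] := vring_inv vO x; first exact: (regular2_at two0 vO Ox A0 r1 r2 r3 nf1 nf2).
have := @regular2_at k two0 X d a x^-1 O ga1 al1 e1 w1 ga2 al2 e2 w2 vO Ox.
rewrite quadV // mulf_neq0 ?invr_eq0 ?expf_neq0 // (resC a d al1) (resC a d al2) (resC a d (al1 + al2)).
move=> /(_ isT r1 r2 r3 (normal_formV x0 nf1) (normal_formV x0 nf2)).
move=> [n [f [t [Of Ot h]]]]; exists n, f, t; split=> // D; rewrite -h derV // oppr2 //.
by field; rewrite A0 x0.
Qed.
End GlobalRegularity.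

(** * The equation [y^2 + x y = x^3 + a2 x^2 + a6]: constancy over [k(s)], explicit double covers *)

Section Elliptic.
Variables (k : fieldType) (two0 : 2 = 0 :> k).
Hypothesis sqrtk : forall a : k, exists b, b ^+ 2 = a.
Variables (K : fieldType) (c : {rmorphism k -> K}).
Let twoK : 2 = 0 :> K. Proof. exact: rmorph_two0 c two0. Qed.

Definition ell_eq (a2 a6 : k) (x y : K) : Prop :=
  y ^+ 2 + x * y = x ^+ 3 + c a2 * x ^+ 2 + c a6.

(** With [b ^ 2 = a6] and [z = (y + b) / x] the equation becomes [z ^ 2 + z = x + a2 + b / x]. The
    descent makes [x] constant; then [z ^ 2 + z] is constant and [z] has no pole. This replaces
    Lueroth's theorem. *)
Lemma ell_rational_const a2 a6 s x y : transc c s -> a6 != 0 ->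
  ratl c s x -> ratl c s y -> ell_eq a2 a6 x y ->
  exists x0 y0, [/\ x = c x0, y = c y0 & y0 ^+ 2 + x0 * y0 = x0 ^+ 3 + a2 * x0 ^+ 2 + a6].
Proof.
move=> ts a60 Px Py e; have sP := ratl_subfield c s.
have [b eb] := sqrtk a6.
have b0 : b != 0 by apply: contraNneq a60 => z; rewrite -eb z expr0n.
have fin x0 y0 : x = c x0 -> y = c y0 -> y0 ^+ 2 + x0 * y0 = x0 ^+ 3 + a2 * x0 ^+ 2 + a6.
  move=> ex ey; apply: (fmorph_inj c); move: e; rewrite /ell_eq ex ey => e.
  by transitivity (c y0 ^+ 2 + c x0 * c y0); [ring|rewrite e; ring].
have [z|x0] := eqVneq x 0.
  have ey : y = c b.
    apply: (sqr2_inj twoK) => /=; move: e; rewrite /ell_eq z -eb rmorphXn => e.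
    by transitivity (y ^+ 2 + 0 * y); [ring|rewrite e; ring].
  by exists 0, b; split; rewrite ?rmorph0 //; apply: fin; rewrite ?rmorph0.
have [u [v [cuv v0 ex]]] := ratl_coprime ts Px.
have Pw : ratl c s (y / x + c b / x).
  have Pb : ratl c s (c b) by apply: ratl_cst.
  by sf_tac sP.
have [n [d [_ d0 ew]]] := ratl_coprime ts Pw.
have nv := transc_neq0 ts v0; have nd := transc_neq0 ts d0.
have u0 : u != 0 by apply: contraNneq x0 => z; rewrite ex z rmorph0 mul0r.
have nu := transc_neq0 ts u0.
have ef : (y / x + c b / x) ^+ 2 + (y / x + c b / x) = x + c a2 + c b / x.
  transitivity ((y ^+ 2 + x * y) / x ^+ 2 + c b ^+ 2 / x ^+ 2 + c b / x); first by field.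
  by rewrite e -eb rmorphXn; field.
have [r er] : exists r, u = r *: v.
  apply: (descent_poly two0 sqrtk (n := n) (d := d) (a := a2) cuv u0 v0 d0 b0).
  apply: (transc_inj ts); rewrite -!mul_polyC !(rmorphD, rmorphXn, rmorphM) /= !evpC.
  move: ef; rewrite ew {1 2}ex => ef.
  transitivity (((evp c s n / evp c s d) ^+ 2 + evp c s n / evp c s d)
     * evp c s u * evp c s v * evp c s d ^+ 2); first by field.
  by rewrite ef; field; rewrite nv nu.
have ex0 : x = c r by rewrite ex er evpZ mulfK.
have [y0 ey0] : exists y0, y = c y0.
  have [p ip||a ea] := AS_no_pole two0 ts Pw.
  - rewrite ef ex0; exists ((r + a2 + b / r)%:P * p), 1; split.
      by rewrite dvdp1; have := ip.1; case: size => [|[]].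
    by rewrite mulr1 rmorphM /= evpC !rmorphD /= fmorph_div.
  - exists (r + a2 + b / r)%:P, 1; split; rewrite ?oner_neq0 //.
      by rewrite size_poly1 (leq_trans (size_polyC_leq1 _)).
    by rewrite ef ex0 rmorph1 mulr1 evpC !rmorphD /= fmorph_div.
  exists (a * r - b); rewrite rmorphB rmorphM /= -ea -ex0; field; exact: x0.
by exists r, y0; split=> //; apply: fin.
Qed.

Variables (a2 a6 : k) (x y : K).
Hypotheses (a60 : a6 != 0) (exy : ell_eq a2 a6 x y).

(* [a, d, al, ga, e] and [w] present the double cover [xi]. *)
Definition presents xi a d al ga e w :=
  [/\ normal_form c a d al ga e xi w, res a d al ga ^+ 4 = a6
    & forall P : K -> Prop, subfield P -> (forall r, P (c r)) -> P xi -> P w -> P x /\ P y].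

Lemma presents_x : x != 0 -> exists al ga w, presents x 0 0 al ga a2 w.
Proof.
move=> x0; have [b eb] := sqrtk a6; have [g eg] := sqrtk b.
(* For [w = (y + b) / x] one finds [w ^ 2 + w = x + a2 + b / x = (x + g) ^ 2 / x + a2], with
   [g ^ 4 = a6]. *)
exists 1, g, (y / x + c b / x); split.
- rewrite /normal_form /lin /quad !rmorph0 rmorph1 mul0r add0r addr0 mul1r.
  transitivity ((y ^+ 2 + x * y) / x ^+ 2 + c b ^+ 2 / x ^+ 2 + c b / x); first by field.
  by rewrite exy -eb -eg !rmorphXn; field.
- by rewrite /res -eb -eg; ring.
move=> P sP Pc Px Pw; split=> //.
have -> : y = (y / x + c b / x) * x - c b by field.
by have := Pc b => Pb; sf_tac sP.
Qed.

(* the line of slope [lam] through [(x0, y0)] meets the curve at [x] and [x + h] *)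
Lemma slope_trace x0 y0 : y0 ^+ 2 + x0 * y0 = x0 ^+ 3 + a2 * x0 ^+ 2 + a6 ->
  x != c x0 -> let lam := (y + c y0) / (x + c x0) in let h := quad c 1 (a2 + x0) lam in
  y = lam * (x + c x0) + c y0 /\ x ^+ 2 + h * x = c y0 + lam * c x0 + c x0 * h.
Proof.
move=> e0 nx lam h.
have x10 : x + c x0 != 0 by apply: contra nx => /eqP/(addr2_eq0 twoK) ->.
have ey : y = lam * (x + c x0) + c y0 by rewrite /lam; field.
split=> //; apply: (mulIf x10).
have -> : h = lam ^+ 2 + lam + c a2 + c x0 by rewrite /h /quad; ring.
have e1 : c y0 ^+ 2 + c x0 * c y0 = c x0 ^+ 3 + c a2 * c x0 ^+ 2 + c a6.
  by rewrite -!rmorphXn -!rmorphM -!rmorphD e0.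
have := exy; rewrite /ell_eq ey => e2.
apply/eqP; rewrite -subr_eq0; apply/eqP.
transitivity ((lam * (x + c x0) + c y0) ^+ 2 + x * (lam * (x + c x0) + c y0)
   + (x ^+ 3 + c a2 * x ^+ 2 + c a6) + (c y0 ^+ 2 + c x0 * c y0)
   + (c x0 ^+ 3 + c a2 * c x0 ^+ 2 + c a6)); first by ring.
by rewrite e2 e1; ring.
Qed.

(** By [slope_trace] the trace of [x] to [k(lam)] is [h] and its norm is [y0 + lam x0 + x0 h], which
    equals [(q lam + r) ^ 2]. So [w = (x + q lam + r) / h] satisfies [w ^ 2 + w = (q lam + r) / h],
    and [(al lam + ga) ^ 2 = q h + q lam + r] turns this into the normal form with constant [q]. *)
Lemma presents_slope x0 y0 : y0 ^+ 2 + x0 * y0 = x0 ^+ 3 + a2 * x0 ^+ 2 + a6 ->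
  x != c x0 -> let lam := (y + c y0) / (x + c x0) in
  quad c 1 (a2 + x0) lam != 0 ->
  exists q al ga w, [/\ q ^+ 2 = x0, al ^+ 2 = q & presents lam 1 (a2 + x0) al ga q w].
Proof.
move=> e0 nx lam h0.
have x10 : x + c x0 != 0 by apply: contra nx => /eqP/(addr2_eq0 twoK) ->.
have [q eq] := sqrtk x0; have [al eal] := sqrtk q.
pose kp := x0 * (a2 + x0) + y0; have [r er] := sqrtk kp.
have [ga ega] := sqrtk (q * (a2 + x0) + r).
pose h := quad c 1 (a2 + x0) lam.
pose w := (x + c q * lam + c r) / h.
have [ey ex] := slope_trace e0 nx; rewrite -/lam -/h in ey ex.
have eh : h = lam ^+ 2 + lam + c a2 + c x0 by rewrite /h /quad; ring.
exists q, al, ga, w; split=> //; split.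
- rewrite /normal_form -/h.
  transitivity ((x ^+ 2 + h * x + c q ^+ 2 * lam ^+ 2 + c r ^+ 2 + h * (c q * lam + c r)) / h ^+ 2).
    by rewrite /w; field.
  have -> : lin c al ga lam ^+ 2 = c q * lam ^+ 2 + (c q * (c a2 + c x0) + c r).
    by rewrite -!rmorphD -!rmorphM -!rmorphD -ega -eal /lin; ring.
  have -> : c r ^+ 2 = c q ^+ 2 * (c a2 + c x0) + c y0.
    by rewrite -!rmorphXn er /kp -eq; ring.
  have ex0 : c x0 = c q ^+ 2 by rewrite -eq rmorphXn.
  rewrite ex; apply: (mulIf (expf_neq0 2 h0)); rewrite -/h.
  transitivity (c y0 + lam * c x0 + c x0 * h + c q ^+ 2 * lam ^+ 2
    + (c q ^+ 2 * (c a2 + c x0) + c y0) + h * (c q * lam + c r)); first by field.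
  transitivity ((c q * lam ^+ 2 + (c q * (c a2 + c x0) + c r)) * h + c q * h ^+ 2); last by field.
  by rewrite eh ex0; ring.
- have e1 : res 1 (a2 + x0) al ga ^+ 2 = q * r + y0.
    transitivity ((al ^+ 2 * (a2 + x0)) ^+ 2 + al ^+ 2 * ga ^+ 2 + (ga ^+ 2) ^+ 2).
      by rewrite /res; ring.
    by rewrite eal ega; transitivity (x0 * (a2+x0) + q ^+ 2 * (a2+x0) + q * r + y0);
      [rewrite -eq; transitivity (q ^+ 2 * (a2 + q ^+ 2) + q * r + r ^+ 2);
        [ring|rewrite er /kp -eq; ring] | rewrite -eq; ring].
  rewrite (_ : 4 = 2 * 2)%N // exprM e1.
  transitivity (q ^+ 2 * r ^+ 2 + y0 ^+ 2); first by ring.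
  rewrite er eq /kp; apply: (addr2_eq0 two0).
  transitivity ((y0 ^+ 2 + x0 * y0) + (x0 ^+ 3 + a2 * x0 ^+ 2 + a6)); first by ring.
  by rewrite e0; ring.
move=> P sP Pc Pl Pw.
have Ph : P h by have P2 := Pc a2; have P0 := Pc x0; rewrite eh; sf_tac sP.
have Px : P x.
  have -> : x = w * h - c q * lam - c r by rewrite /w; field.
  by have Pq := Pc q; have Pr := Pc r; sf_tac sP.
by split=> //; rewrite ey; have P1 := Pc x0; have P2 := Pc y0; sf_tac sP.
Qed.
End Elliptic.

Section Algebraic.
Variables (k K : fieldType) (c : {rmorphism k -> K}).

Lemma algebraic_subfield : subfield (algebraicOver c).
Proof.
split; [exact: algebraic1|exact: algebraic_sub|exact: algebraic_div].
Qed.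

Lemma transcP x : transc c x <-> ~ algebraicOver c x.
Proof.
split=> [tx [p p0 /rootP e]|na p e].
  by move/eqP: p0; apply; apply: tx.
by apply: contrapT => /eqP p0; apply: na; exists p => //; apply/rootP.
Qed.

Lemma algebraic_AS w : algebraicOver c (w ^+ 2 + w) -> algebraicOver c w.
Proof.
set f := _ + _ => /integral_algebraic hf; apply/integral_algebraic.
have ep : Poly [:: - f; 1; 1] = [:: - f; 1; 1] :> seq K.
  by apply: (@PolyK _ 0); rewrite /= oner_neq0.
apply: (@integral_root_monic _ _ c w (Poly [:: - f; 1; 1])).
- by rewrite monicE /lead_coef ep.
- by rewrite rootE horner_Poly /= mul0r add0r mul1r /f; apply/eqP; ring.
move=> z; rewrite ep !inE => /or3P[] /eqP ->; [exact: integral_opp|exact: integral1|exact: integral1].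
Qed.
End Algebraic.

(** * Every double cover of the line by an elliptic curve has a normal form *)

Section Classification.
Variables (k : fieldType) (two0 : 2 = 0 :> k).
Hypothesis sqrtk : forall a : k, exists b, b ^+ 2 = a.
Variables (K : fieldType) (c : {rmorphism k -> K}).
Let twoK : 2 = 0 :> K. Proof. exact: rmorph_two0 c two0. Qed.
Local Notation P := (ratl c).

Lemma not_ratl_cst x r : transc c x -> ~ P (c r) x.
Proof.
move=> tx h; have [a ea] : exists a, x = c a.
  have := subfield_image c => sI.
  by apply: (ratl_min sI _ _ h); [move=> a; exists a|exists r].
exact: transc_ncst tx ea.
Qed.

(** Substitution multiplies the middle coefficient of the quadratic form by the determinant [det].
    Dividing by [det], and multiplying the linear form by a square root [l] of [det^-1], restores
    the shape and leaves the resultant unchanged. *)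
Lemma normal_form_moebius x xi a d al ga e w : transc c x -> P x xi -> P xi x ->
  normal_form c a d al ga e xi w ->
  exists a' d' al' ga', normal_form c a' d' al' ga' e x w /\ res a' d' al' ga' = res a d al ga.
Proof.
move=> tx Pxi Px nf.
have [p [q [cpq q0 sp sq exi]]] := moebius tx Pxi Px.
have nq := transc_neq0 tx q0.
have ncst r : xi <> c r by move=> h; apply: (not_ratl_cst (r := r) tx); rewrite -h.
have deg1 (r : {poly k}) : (size r <= 2)%N -> evp c x r = c r`_1 * x + c r`_0.
  move=> sr; have -> : r = r`_1 *: 'X + (r`_0)%:P.
    apply/polyP => i; rewrite coefD coefZ coefX coefC.
    case: i => [|[|i]]; rewrite /= ?mulr0 ?mulr1 ?add0r ?addr0 //.
    by rewrite nth_default // (leq_trans sr).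
  by rewrite !coefD !coefZ !coefX !coefC /= mulr0 mulr1 add0r addr0 rmorphD /= evpZ evpX evpC.
move: (deg1 p sp) (deg1 q sq) exi nq.
move: p`_1 p`_0 q`_1 q`_0 (evp c x p) (evp c x q) => p1 p0 q1 q0' u v eu ev exi nv.
pose det := p1 * q0' + p0 * q1.
have det0 : det != 0.
  apply/eqP => dz; have dzK : c p1 * c q0' = c p0 * c q1.
    by rewrite -!rmorphM; congr (c _); apply: (addr2_eq0 two0).
  have [q1z|q1n] := eqVneq q1 0.
    have q0n : q0' != 0.
      by apply: contraNneq nv => z; rewrite ev q1z z !rmorph0 mul0r addr0.
    apply: (ncst (p0 / q0')); rewrite exi fmorph_div.
    have cq0 : c q0' != 0 by rewrite fmorph_eq0.
    apply: (mulIf nv); apply: (mulIf cq0); rewrite divfK // mulrAC divfK //.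
    rewrite eu ev mulrDl mulrDr mulrAC dzK; ring.
  apply: (ncst (p1 / q1)); rewrite exi fmorph_div.
  have cq1 : c q1 != 0 by rewrite fmorph_eq0.
  apply: (mulIf nv); apply: (mulIf cq1); rewrite divfK // mulrAC divfK //.
  rewrite eu ev mulrDl mulrDr -dzK; ring.
have [l el] := sqrtk det^-1.
pose a' := det^-1 * (a * p1 ^+ 2 + p1 * q1 + d * q1 ^+ 2).
pose d' := det^-1 * (a * p0 ^+ 2 + p0 * q0' + d * q0' ^+ 2).
pose al' := l * (al * p1 + ga * q1); pose ga' := l * (al * p0 + ga * q0').
exists a', d', al', ga'; split.
  have cd0 : c det != 0 by rewrite fmorph_eq0.
  have eA : quad c a' d' x * c det = quad c a d xi * v ^+ 2.
    rewrite exi; transitivity (c a * u ^+ 2 + u * v + c d * v ^+ 2); last by rewrite /quad; field.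
    rewrite /quad /a' /d' eu ev.
    have -> : c (det^-1 * (a * p1 ^+ 2 + p1 * q1 + d * q1 ^+ 2))
      = (c det)^-1 * c (a * p1 ^+ 2 + p1 * q1 + d * q1 ^+ 2) by rewrite rmorphM fmorphV.
    have -> : c (det^-1 * (a * p0 ^+ 2 + p0 * q0' + d * q0' ^+ 2))
      = (c det)^-1 * c (a * p0 ^+ 2 + p0 * q0' + d * q0' ^+ 2) by rewrite rmorphM fmorphV.
    transitivity (c (a * p1 ^+ 2 + p1 * q1 + d * q1 ^+ 2) * x ^+ 2 + x * c det
       + c (a * p0 ^+ 2 + p0 * q0' + d * q0' ^+ 2)); first by field.
    by rewrite /det; ring.
  have eS : lin c al' ga' x ^+ 2 * c det = (lin c al ga xi * v) ^+ 2.
    have -> : lin c al ga xi * v = c al * u + c ga * v by rewrite exi /lin; field.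
    rewrite /lin eu ev; transitivity (c l ^+ 2 * c det
      * (c al * (c p1 * x + c p0) + c ga * (c q1 * x + c q0')) ^+ 2).
      by rewrite /al' /ga'; ring.
    by rewrite -rmorphXn el fmorphV mulVf // mul1r.
  rewrite /normal_form nf; congr (_ + _).
  have -> : lin c al' ga' x ^+ 2 = (lin c al ga xi * v) ^+ 2 / c det by rewrite -eS mulfK.
  have -> : quad c a' d' x = quad c a d xi * v ^+ 2 / c det by rewrite -eA mulfK.
  have [->|A0] := eqVneq (quad c a d xi) 0; first by rewrite !mul0r invr0 !mulr0.
  by field; rewrite A0 cd0 nv.
transitivity (l ^+ 2 * det^-1 * det ^+ 2 * res a d al ga).
  by rewrite /res /al' /ga' /a' /d' /det; field; exact: det0.
by rewrite el; field.
Qed.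

Variables (a2 a6 : k) (x y : K).
Hypotheses (a60 : a6 != 0) (exy : ell_eq c a2 a6 x y) (tx : transc c x).
Hypothesis genK : forall Q : K -> Prop, subfield Q -> (forall r, Q (c r)) -> Q x -> Q y ->
  forall z, Q z.

Lemma presents_transc xi a d al ga e w : presents c a6 x y xi a d al ga e w -> transc c xi.
Proof.
move=> [nf _ gen]; apply/transcP => axi; move/transcP: tx; apply.
have sA := algebraic_subfield c; have Ac r : algebraicOver c (c r) by apply: algebraic_id.
have [] // := gen _ sA Ac axi; apply: algebraic_AS; rewrite nf /lin /quad.
by have := Ac al; have := Ac ga; have := Ac a; have := Ac d; have := Ac e => *; sf_tac sA.
Qed.

Lemma presents_AS_gen xi a d al ga e w :
  presents c a6 x y xi a d al ga e w -> AS_gen (P xi) w.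
Proof.
move=> pr; have txi := presents_transc pr; have [nf er gen] := pr; have sP := ratl_subfield c xi.
have Pf : P xi (w ^+ 2 + w).
  rewrite nf; have := ratl_quad c a d xi; have := ratl_lin c al ga xi; have := ratl_cst c xi e.
  by move=> ? ? ?; sf_tac sP.
have nw : ~ P xi w.
  move=> Pw; have [Px Py] := gen _ sP (ratl_cst c xi) (ratl_gen c xi) Pw.
  have [x0 [y0 [ex _ _]]] := ell_rational_const two0 sqrtk txi a60 Px Py exy.
  exact: transc_ncst tx ex.
split=> //; have sS := span2_subfield sP twoK Pf nw.
have b z : P xi z -> span2 (P xi) w z by apply: (span2_base sP).
have [Sx Sy] := gen _ sS (fun r => b _ (ratl_cst c xi r)) (b _ (ratl_gen c xi)) (span2_gen sP w).
exact: genK sS (fun r => b _ (ratl_cst c xi r)) Sx Sy.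
Qed.

(** If [x] is in [k(t)], the cover is the coordinate [x] itself. Otherwise the line through [(x, y)]
    and its conjugate over [k(t)] has slope [lam] in [k(t)] and meets the curve in a third point
    with coordinates in [k(t)]. That point is constant, so the cover is given by the slopes of the
    lines through a fixed point. *)
Lemma double_cover_form t u : transc c t -> AS_gen (P t) u ->
  exists a d al ga e w, [/\ normal_form c a d al ga e t w, res a d al ga ^+ 4 = a6
     & AS_gen (P t) w].
Proof.
move=> tt gu; have [Pu nu span] := gu; have sP := ratl_subfield c t.
have Pc := ratl_cst c t.
have notall : ~ (P t x /\ P t y).
  by move=> [Px Py]; apply: nu; apply: (genK sP Pc Px Py).
suff [xi [a [d [al [ga [e [w [Pxi pr]]]]]]]] : exists xi a d al ga e w,
    P t xi /\ presents c a6 x y xi a d al ga e w.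
  have [Pf nw sp] := presents_AS_gen pr; have [nf er gen] := pr.
  have sub z : P xi z -> P t z by apply: (ratl_min sP Pc Pxi).
  have nwt : ~ P t w by move=> Pw; apply: notall; apply: gen.
  (* [k(xi)] is contained in [k(t)] and both have index two in the whole field, so they agree. *)
  have Pxt : P xi t.
    have [a0 [b0 [Pa Pb et]]] := sp t.
    have [z|b0n] := eqVneq b0 0; first by rewrite et z mul0r addr0.
    case: nwt; have -> : w = (t - a0) / b0 by rewrite et; field.
    by have := ratl_gen c t; have := sub _ Pa; have := sub _ Pb => *; sf_tac sP.
  have [a' [d' [al' [ga' [nf' er']]]]] := normal_form_moebius tt Pxi Pxt nf.
  exists a', d', al', ga', e, w; split=> //; first by rewrite er'.
  split=> //; first exact: sub.
  move=> z; have [a0 [b0 [Pa Pb ez]]] := sp z.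
  by exists a0, b0; split=> //; apply: sub.
have [p1 [q1 [Pp1 Pq1 ex]]] := span x; have [p2 [q2 [Pp2 Pq2 ey]]] := span y.
have x0 : x != 0 by apply/eqP; rewrite -(rmorph0 c); apply: transc_ncst.
have [z|nq1] := eqVneq q1 0.
  have Px : P t x by rewrite ex z mul0r addr0.
  have [al [ga [w pr]]] := presents_x two0 sqrtk exy x0.
  by exists x, 0, 0, al, ga, a2, w.
pose F := u ^+ 2 + u; pose lam := q2 / q1.
pose N := p1 ^+ 2 + p1 * q1 + q1 ^+ 2 * F.
pose x3 := lam ^+ 2 + lam + c a2 + q1; pose nu' := lam * p1 + p2.
pose y3 := lam * x3 + nu'.
have Plam : P t lam by rewrite /lam; sf_tac sP.
have Ca2 := Pc a2; have Ca6 := Pc a6.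
have Px3 : P t x3 by rewrite /x3; sf_tac sP.
have Pnu : P t nu' by rewrite /nu'; sf_tac sP.
have Py3 : P t y3 by rewrite /y3; sf_tac sP.
have PN : P t N by rewrite /N /F; sf_tac sP.
have eyl : y = lam * x + nu'.
  by rewrite ey ex /nu' /lam; field.
have exx : x ^+ 2 = q1 * x + N by rewrite /N /F ex; ring.
(* The curve equation reduced modulo the line and the quadratic equation of [x] is linear in [x]. As
   [x] is not in [k(t)], both coefficients vanish, which says that [(x3, y3)] is on the curve. *)
have cub : (nu' ^+ 2 + c a6 + x3 * N) + (N + x3 * q1 + nu') * x = 0.
  have := exy; rewrite /ell_eq eyl => e1; apply/eqP; rewrite -[0](addrr2 twoK (x ^+ 3 + c a2 * x ^+ 2 + c a6)) -{1}e1.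
  apply/eqP; have -> : x ^+ 3 = (q1 ^+ 2 + N) * x + q1 * N.
    by transitivity (x * x ^+ 2); [ring|rewrite exx; transitivity (q1 * x ^+ 2 + N * x);[ring|rewrite exx; ring]].
  have -> : (lam * x + nu') ^+ 2 = lam ^+ 2 * x ^+ 2 + nu' ^+ 2 by ring.
  have -> : x * (lam * x + nu') = lam * x ^+ 2 + nu' * x by ring.
  by rewrite exx /x3; ring.
have [c0 c1] : nu' ^+ 2 + c a6 + x3 * N = 0 /\ N + x3 * q1 + nu' = 0.
  have nx : ~ P t x.
    move=> Px; apply: nu; have -> : u = (x - p1) / q1 by rewrite ex; field.
    by sf_tac sP.
  have c1 : N + x3 * q1 + nu' = 0.
    apply: contrapT => /eqP nz; apply: nx.
    have -> : x = - (nu' ^+ 2 + c a6 + x3 * N) / (N + x3 * q1 + nu').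
      by apply: (mulIf nz); rewrite divfK //; apply/eqP; rewrite -subr_eq0 opprK mulrC addrC cub.
    by sf_tac sP.
  by split=> //; move: cub; rewrite c1 mul0r addr0.
have e3 : ell_eq c a2 a6 x3 y3.
  have eN : N = x3 * q1 + nu'.
    by apply: (addr2_eq0 twoK); rewrite -[RHS]c1; ring.
  rewrite /ell_eq; apply: (addr2_eq0 twoK).
  transitivity (nu' ^+ 2 + c a6 + x3 * (x3 * q1 + nu')); last by rewrite -eN.
  rewrite /y3; have -> : c a2 = x3 + lam ^+ 2 + lam + q1 by rewrite /x3; ring.
  by ring.
have [x0' [y0' [ex3 ey3 e0]]] := ell_rational_const two0 sqrtk tt a60 Px3 Py3 e3.
have nxx : x != c x0' by apply/eqP/transc_ncst.
have xx0 : x + c x0' != 0 by apply: contra nxx => /eqP/(addr2_eq0 twoK) ->.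
have elam : (y + c y0') / (x + c x0') = lam.
  apply: (mulIf xx0); rewrite divfK // eyl -ey3 -ex3 /y3; ring.
have eh : quad c 1 (a2 + x0') lam = q1.
  by transitivity (lam ^+ 2 + lam + c a2 + c x0'); [rewrite /quad; ring|rewrite -ex3 /x3; ring].
have := @presents_slope k two0 sqrtk K c a2 a6 x y exy x0' y0' e0 nxx.
rewrite /= elam eh => /(_ nq1)[q [al [ga [w [_ _ pr]]]]].
by exists lam, 1, (a2 + x0'), al, ga, q, w.
Qed.
End Classification.

(** * Function fields of elliptic curves *)

Lemma big_ord2 (V : nmodType) (f : 'I_2 -> V) : \sum_i f i = f 0 + f 1.
Proof. by rewrite big_ord_recl big_ord1; congr (_ + f _); apply: val_inj. Qed.

Section DegreeTwo.
Variables (K L : fieldType) (phi : {rmorphism K -> L}).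
Hypothesis two0 : 2 = 0 :> L.
Definition img (z : L) : Prop := exists u, z = phi u.
Let sI : subfield img := subfield_image phi.
Let I u : img (phi u). Proof. by exists u. Qed.
Let twoK : 2 = 0 :> K.
Proof. by apply: (fmorph_inj phi); rewrite rmorph0 rmorph_nat. Qed.

Lemma degree2_span : has_degree phi 2 -> exists2 z, ~ img z &
  forall t, exists u v, t = phi u + phi v * z.
Proof.
move=> [b hb].
have coord t : exists u v, t = phi u * b 0 + phi v * b 1.
  by have [cc [-> _]] := hb t; exists (cc 0 0), (cc 0 1); rewrite big_ord2.
have coord0 u v : phi u * b 0 + phi v * b 1 = 0 -> u = 0 /\ v = 0.
  move=> e; have [cc [_ uq]] := hb 0.
  pose r1 : 'rV[K]_2 := \row_i (if i == 0 then u else v).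
  have h1 : cc = r1 by apply: uq; rewrite big_ord2 !mxE /=.
  have h2 : cc = 0 by apply: uq; rewrite big_ord2 !mxE rmorph0 !mul0r addr0.
  have := congr1 (fun m : 'rV_2 => m 0 0) (etrans (esym h1) h2).
  have := congr1 (fun m : 'rV_2 => m 0 1) (etrans (esym h1) h2).
  by rewrite !mxE /= => -> ->.
have [z nz] : exists z, ~ img z.
  apply: contrapT => no; have all z : img z by apply: contrapT => h; apply: no; exists z.
  have [u0 e0] := all (b 0); have [u1 e1] := all (b 1).
  have [] := coord0 u1 (- u0); first by rewrite e0 e1 rmorphN; ring.
  move=> z1 /eqP; rewrite oppr_eq0 => /eqP z0.
  have [u [v e]] := coord 1; move/eqP: e.
  by rewrite e0 e1 z0 z1 rmorph0 !mulr0 addr0 oner_eq0.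
exists z => // t.
have [p [q e1]] := coord 1; have [r [s ez]] := coord z; have [m [n et]] := coord t.
pose d := p * s - q * r.
have d0 : d != 0.
  apply/eqP => dz.
  have h1 : phi q * z = phi s.
    rewrite -[RHS]mulr1 e1 ez; apply/eqP; rewrite -subr_eq0; apply/eqP.
    by transitivity (- phi d * b 0); [rewrite /d; ring|rewrite dz rmorph0 oppr0 mul0r].
  have h2 : phi p * z = phi r.
    rewrite -[RHS]mulr1 e1 ez; apply/eqP; rewrite -subr_eq0; apply/eqP.
    by transitivity (phi d * b 1); [rewrite /d; ring|rewrite dz rmorph0 mul0r].
  have [q0|q0] := eqVneq q 0; last first.
    apply: nz; exists (s / q); rewrite fmorph_div -h1 mulrC mulKf //.
    by rewrite fmorph_eq0.
  have [p0|p0] := eqVneq p 0.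
    by move/eqP: e1; rewrite p0 q0 !rmorph0 !mul0r addr0 oner_eq0.
  apply: nz; exists (r / p); rewrite fmorph_div -h2 mulrC mulKf //.
  by rewrite fmorph_eq0.
exists ((m * s - n * r) / d), ((p * n - q * m) / d).
have pd : phi d != 0 by rewrite fmorph_eq0.
apply: (mulIf pd); rewrite mulrDl !fmorph_div divfK // mulrAC divfK //.
rewrite -[phi (m * s - _)]mulr1 e1 et ez /d; ring.
Qed.

(** In [z ^ 2 = u + v z] separability excludes [v = 0]: otherwise ['X^2 - u], of zero derivative,
    would divide both a separable polynomial and its derivative. Then [z / v] is an Artin-Schreier
    generator. *)
Lemma degree2_AS : has_degree phi 2 -> separable_extension phi -> exists y, AS_gen img y.
Proof.
move=> /degree2_span[z nz span] sep.
have [u [v e]] := span (z ^+ 2).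
have v0 : v != 0.
  apply/eqP => v0; move: e; rewrite v0 rmorph0 mul0r addr0 => e.
  have [p sp /rootP pz] := sep z.
  pose q : {poly K} := 'X^2 - u%:P.
  have mq : q \is monic by rewrite monicE /q lead_coefDl ?lead_coefXn // size_polyN size_polyXn (leq_ltn_trans (size_polyC_leq1 _)).
  have sq : size q = 3%N by rewrite /q size_polyDl ?size_polyXn // size_polyN (leq_ltn_trans (size_polyC_leq1 _)).
  have q0 : q != 0 by rewrite -size_poly_gt0 sq.
  have qz : (map_poly phi q).[z] = 0.
    by rewrite rmorphB /= map_polyXn map_polyC hornerD hornerN hornerXn hornerC e subrr.
  have sr : (size (p %% q)%R <= 2)%N by rewrite -ltnS -[3%N]sq ltn_modp.
  have rz : (map_poly phi (p %% q)).[z] = 0.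
    have := pz; rewrite {1}(divp_eq p q) rmorphD rmorphM /= hornerD hornerM qz mulr0 add0r.
    by [].
  have er : p %% q = (p %% q)`_1 *: 'X + ((p %% q)`_0)%:P.
    apply/polyP => i; rewrite coefD coefZ coefX coefC.
    case: i => [|[|i]]; rewrite /= ?mulr0 ?mulr1 ?add0r ?addr0 //.
    by rewrite nth_default // (leq_trans sr).
  have c1 : (p %% q)`_1 = 0.
    apply: contrapT => /eqP n1; apply: nz; exists (- (p %% q)`_0 / (p %% q)`_1).
    have n1' : phi (p %% q)`_1 != 0 by rewrite fmorph_eq0.
    move: rz; rewrite {1}er rmorphD /= map_polyZ map_polyX map_polyC hornerD hornerZ hornerX hornerC => rz.
    rewrite fmorph_div rmorphN; apply: (mulIf n1'); rewrite divfK //.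
    by apply/eqP; rewrite -subr_eq0 opprK mulrC rz.
  have c0 : (p %% q)`_0 = 0.
    apply: (fmorph_inj phi); move: rz; rewrite {1}er c1 scale0r add0r map_polyC hornerC rmorph0.
    by [].
  have qp : q %| p by rewrite /dvdp er c1 c0 scale0r add0r polyC0.
  have [g eg] := dvdpP _ _ qp.
  have dq : q^`() = 0.
    by rewrite /q derivB derivXn derivC subr0 -mulr_natl (poly2_0 twoK) mul0r.
  have qp' : q %| p^`() by rewrite eg derivM dq mulr0 addr0 dvdp_mulIr.
  move: sp; rewrite unlock => /coprimepP/(_ q qp qp').
  by rewrite -size_poly_eq1 sq.
have pv : phi v != 0 by rewrite fmorph_eq0.
exists (z / phi v); split.
- exists (u / v ^+ 2); rewrite fmorph_div rmorphXn.
  transitivity ((z ^+ 2 + phi v * z) / phi v ^+ 2); first by field.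
  by rewrite e; field.
- move=> [t et]; apply: nz; exists (t * v); by rewrite rmorphM -et divfK.
- move=> t; have [a [b ->]] := span t; exists (phi a), (phi (b * v)).
  by split=> //; rewrite rmorphM; field.
Qed.

Lemma AS_degree2 y : AS_gen img y -> has_degree phi 2 /\ separable_extension phi.
Proof.
move=> [[f ef] ny span]; split.
  exists (fun i => if i == 0 then 1 else y) => z.
  have [_ [_ [[a ->] [b ->] ez]]] := span z.
  exists (\row_i (if i == 0 then a else b)); split.
    by rewrite big_ord2 !mxE /= mulr1.
  move=> cc; rewrite big_ord2 /= mulr1 ez => e.
  have [e1 e2] := AS_uniq sI two0 ny (I _) (I _) (I _) (I _) e.
  apply/rowP => i; rewrite !mxE; case: i => [[|[|//]] /= p].
    by rewrite (fmorph_inj phi e1); congr (cc _ _); apply: val_inj.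
  by rewrite (fmorph_inj phi e2); congr (cc _ _); apply: val_inj.
move=> z; have [_ [_ [[a ->] [b ->] ez]]] := span z.
have [b0|b0] := eqVneq b 0.
  exists ('X - a%:P); last by rewrite rmorphB /= map_polyX map_polyC root_XsubC ez b0 rmorph0 mul0r addr0.
  by rewrite unlock derivXsubC coprimep1.
have [N eN] : exists N, N = a ^+ 2 + a * b + b ^+ 2 * f by eexists.
exists ('X^2 + b *: 'X + N%:P).
  rewrite unlock !derivD derivXn derivZ derivX derivC addr0.
  rewrite -mulr_natl (poly2_0 twoK) mul0r add0r.
  by rewrite coprimepZr // coprimep1.
rewrite rootE !rmorphD /= map_polyXn map_polyZ map_polyX map_polyC !hornerE ez /= eN.
apply/eqP; transitivity (phi b ^+ 2 * (y ^+ 2 + y + phi f)); first by ring.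
by rewrite ef addrr2 // mulr0.
Qed.
End DegreeTwo.

Section ProjLine.
Variables (k : fieldType) (X : curve_data k) (f : curve_map X (proj_line k)).

Definition coordinate : X := pullback f (FracField.tofrac 'X).

Lemma pullback_tofrac p : pullback f (FracField.tofrac p) = evp (cst X) coordinate p.
Proof.
elim/poly_ind: p => [|p a IH]; first by rewrite !rmorph0.
rewrite !rmorphD !rmorphM /= IH evpX evpC; congr (_ + _).
exact: (pullback_cst f a).
Qed.

Lemma coordinate_transc : transc (cst X) coordinate.
Proof.
by move=> p; rewrite -pullback_tofrac => /eqP; rewrite fmorph_eq0 tofrac_eq0 => /eqP.
Qed.

Lemma pullback_ratl z : img (pullback f) z <-> ratl (cst X) coordinate z.
Proof.
split=> [[u ->]|].
  have [n [d [d0 ->]]] := fracE u; exists n, d; rewrite -!pullback_tofrac fmorph_div.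
  by rewrite fmorph_eq0 tofrac_eq0.
apply: ratl_min (subfield_image (pullback f)) _ _ _; last by eexists.
by move=> a; exists (cst (proj_line k) a); rewrite pullback_cst.
Qed.

Lemma img_ratl : img (pullback f) = ratl (cst X) coordinate.
Proof. by apply/funext => z; apply/propext/pullback_ratl. Qed.
End ProjLine.

(** * Weierstrass equations in characteristic two *)

Section Weierstrass.
Variables (k : fieldType) (two0 : 2 = 0 :> k).

Lemma disc_char2 (E : weierstrass k) : disc E = a1 E ^+ 4 * (a1 E ^+ 2 * a6 E + a1 E * a3 E * a4 E
   + a2 E * a3 E ^+ 2 + a4 E ^+ 2) + a3 E ^+ 4 + a1 E ^+ 3 * a3 E ^+ 3.
Proof. by rewrite /disc /b8 /b6 /b4 /b2; ring. Qed.

Lemma j_invariantV (E : elliptic_curve k) : (j_invariant E)^-1 = disc E / a1 E ^+ 12.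
Proof.
rewrite /j_invariant invf_div; congr (_ / _).
by rewrite /c4 /b2; ring.
Qed.

(** The translation by [r] and [t] kills [a3] and [a4], and scaling by [a1] makes the coefficient of
    [x y] equal to [1]; the constant term becomes [disc / a1 ^ 12], which is [1 / j]. *)
Lemma normalize_weierstrass (K : fieldType) (c : {rmorphism k -> K}) (W : weierstrass k) x0 y0 :
  a1 W != 0 ->
  y0 ^+ 2 + c (a1 W) * x0 * y0 + c (a3 W) * y0
    = x0 ^+ 3 + c (a2 W) * x0 ^+ 2 + c (a4 W) * x0 + c (a6 W) ->
  exists A2 x y r t, [/\ ell_eq c A2 (disc W / a1 W ^+ 12) x y,
    x0 = c (a1 W) ^+ 2 * x + c r & y0 = c (a1 W) ^+ 3 * y + c t].
Proof.
have twoK : 2 = 0 :> K by apply: rmorph_two0 c two0.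
move=> a10 e; pose u := c (a1 W).
have u0 : u != 0 by rewrite fmorph_eq0.
pose r := a3 W / a1 W; pose t := (a1 W ^+ 2 * a4 W + a3 W ^+ 2) / a1 W ^+ 3.
pose A2 := (r + a2 W) / a1 W ^+ 2.
pose x := (x0 + c r) / u ^+ 2; pose y := (y0 + c t) / u ^+ 3.
have ex : x0 = u ^+ 2 * x + c r by rewrite /x; field.
have ey : y0 = u ^+ 3 * y + c t by rewrite /y; field.
exists A2, x, y, r, t; split=> //.
have ej : c (disc W / a1 W ^+ 12) = c (disc W) / u ^+ 12 by rewrite fmorph_div rmorphXn.
have er : c r = c (a3 W) / u by rewrite fmorph_div.
have et : c t = (u ^+ 2 * c (a4 W) + c (a3 W) ^+ 2) / u ^+ 3.
  by rewrite fmorph_div rmorphXn; congr (_ / _); rewrite /u; ring.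
have eA : c A2 = (c (a3 W) / u + c (a2 W)) / u ^+ 2.
  by rewrite -er /A2 fmorph_div rmorphXn -rmorphD.
move: e; rewrite -/u ex ey er et => e.
rewrite /ell_eq eA ej disc_char2.
have ed : c (a1 W ^+ 4 * (a1 W ^+ 2 * a6 W + a1 W * a3 W * a4 W
   + a2 W * a3 W ^+ 2 + a4 W ^+ 2) + a3 W ^+ 4 + a1 W ^+ 3 * a3 W ^+ 3)
  = u ^+ 4 * (u ^+ 2 * c (a6 W) + u * c (a3 W) * c (a4 W)
   + c (a2 W) * c (a3 W) ^+ 2 + c (a4 W) ^+ 2) + c (a3 W) ^+ 4 + u ^+ 3 * c (a3 W) ^+ 3.
  by rewrite /u; ring.
rewrite ed; move: (c (a2 W)) (c (a3 W)) (c (a4 W)) (c (a6 W)) e => k2 k3 k4 k6 e.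
apply: (addr2_eq0 twoK).
move: e; set l := (X in X = _); set rhs := (X in _ = X) => e.
transitivity ((l + rhs) / u ^+ 6); last by rewrite e addrr2 // mul0r.
by rewrite /l /rhs; field.
Qed.
End Weierstrass.

Lemma modulus_eval (F K : fieldType) (r : {rmorphism {poly F} -> K}) (i : F -> K) (A B : F) :
  (forall a, r a%:P = i a) -> r ('X^2 + A%:P * 'X - B%:P) = 0 ->
  r 'X ^+ 2 + i A * r 'X = i B.
Proof. by move=> rC; rewrite rmorphB rmorphD rmorphXn rmorphM !rC => /subr0_eq. Qed.

Section EllipticFunctionField.
Variables (k : fieldType) (E : elliptic_curve k).
Local Notation X := (ell_curve E).
Local Notation h := (weierstrass_poly E).
Local Notation F := {fraction {poly k}}.

Local Notation QF := {poly %/ h with weierstrass_poly_irreducible E}.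

Definition ell_embed : {rmorphism F -> X} := (qpolyC h : {rmorphism F -> QF}).
Definition ell_red : {rmorphism {poly F} -> X} := (in_qpoly h : {rmorphism {poly F} -> QF}).
Definition ell_y : X := ell_red 'X.
Definition ell_x : X := ell_embed (FracField.tofrac 'X).

Lemma ell_evp p : evp (cst X) ell_x p = ell_embed (FracField.tofrac p).
Proof.
elim/poly_ind: p => [|p a IH]; first by rewrite tofrac0 !rmorph0.
rewrite rmorphD rmorphM /= IH evpX evpC tofracD tofracM rmorphD rmorphM.
by [].
Qed.

Lemma ell_x_transc : transc (cst X) ell_x.
Proof.
move=> p; rewrite ell_evp => /eqP; rewrite fmorph_eq0 tofrac_eq0 => /eqP.
by [].
Qed.
Lemma ell_redC a : ell_red a%:P = ell_embed a.
Proof.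
apply: val_inj; rewrite /= Pdiv.Ring.rmodp_small //.
by rewrite /mk_monic size_weierstrass_poly weierstrass_poly_monic /= size_weierstrass_poly
  (leq_ltn_trans (size_polyC_leq1 _)).
Qed.

Lemma ell_red_modulus : ell_red h = 0.
Proof.
apply: val_inj; rewrite /= /mk_monic size_weierstrass_poly weierstrass_poly_monic /=.
exact: Pdiv.RingMonic.rmodpp (weierstrass_poly_monic E).
Qed.

Lemma ell_weierstrass : ell_y ^+ 2 + cst X (a1 E) * ell_x * ell_y + cst X (a3 E) * ell_y
  = ell_x ^+ 3 + cst X (a2 E) * ell_x ^+ 2 + cst X (a4 E) * ell_x + cst X (a6 E).
Proof.
pose A : {poly k} := (a1 E)%:P * 'X + (a3 E)%:P.
pose B : {poly k} := 'X^3 + (a2 E)%:P * 'X^2 + (a4 E)%:P * 'X + (a6 E)%:P.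
have := modulus_eval ell_redC (ell_red_modulus : ell_red ('X^2 + (FracField.tofrac A)%:P * 'X
  - (FracField.tofrac B)%:P) = 0); rewrite -[ell_red 'X]/ell_y.
rewrite -!ell_evp; have -> : evp (cst X) ell_x A = cst X (a1 E) * ell_x + cst X (a3 E).
  by rewrite rmorphD rmorphM /= !evpC evpX.
have -> : evp (cst X) ell_x B
   = ell_x ^+ 3 + cst X (a2 E) * ell_x ^+ 2 + cst X (a4 E) * ell_x + cst X (a6 E).
  by rewrite !(rmorphD, rmorphXn, rmorphM) /= !evpC evpX.
by move=> <-; rewrite mulrDl addrA.
Qed.

Lemma ell_span (z : X) : exists p q : F, z = ell_embed p + ell_embed q * ell_y.
Proof.
have [r sr ->] : exists2 r : {poly F}, (size r <= 2)%N & z = ell_red r.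
  exists (val (z : {poly %/ h})).
    rewrite -ltnS; apply: leq_trans (size_mk_monic (z : {poly %/ h})) _.
    by rewrite /mk_monic size_weierstrass_poly weierstrass_poly_monic /= size_weierstrass_poly.
  apply: val_inj; exact: esym (in_qpoly_small (size_mk_monic (z : {poly %/ h}))).
exists r`_0, r`_1; rewrite -!ell_redC /ell_y -rmorphM -rmorphD; congr (ell_red _).
apply/polyP => i; rewrite coefD coefCM coefX coefC.
case: i => [|[|i]]; rewrite /= ?mulr0 ?mulr1 ?add0r ?addr0 //.
by rewrite nth_default // (leq_trans sr).
Qed.

Lemma ell_generated (Q : X -> Prop) : subfield Q -> (forall r, Q (cst X r)) ->
  Q ell_x -> Q ell_y -> forall z, Q z.
Proof.
move=> sQ Qc Qx Qy z; have [p [q ->]] := ell_span z.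
have QF u : Q (ell_embed u).
  have [n [d [d0 ->]]] := fracE u.
  rewrite fmorph_div -!ell_evp; apply: (ratl_min sQ Qc Qx); exists n, d; split=> //.
  exact: (transc_neq0 ell_x_transc).
have h1 := QF p; have h2 := QF q; exact: (sfD sQ h1 (sfM sQ h2 Qy)).
Qed.

Hypothesis two0 : 2 = 0 :> k.
Hypothesis a1_neq0 : a1 E != 0.

Lemma ell_normalized : exists (A2 : k) (x y : X),
  [/\ ell_eq (cst X) A2 (j_invariant E)^-1 x y, transc (cst X) x
    & forall Q : X -> Prop, subfield Q -> (forall r, Q (cst X r)) -> Q x -> Q y -> forall z, Q z].
Proof.
have [A2 [x [y [r [t [exy ex ey]]]]]] := normalize_weierstrass two0 a1_neq0 ell_weierstrass.
exists A2, x, y; split.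
- by rewrite j_invariantV // disc_char2.
- apply/transcP => ax; move/transcP: ell_x_transc; apply; rewrite ex.
  have sA := algebraic_subfield (cst X).
  have Ac a : algebraicOver (cst X) (cst X a) by apply: algebraic_id.
  by have := Ac r; have := Ac (a1 E) => *; sf_tac sA.
move=> Q sQ Qc Qx Qy; apply: ell_generated => //; rewrite ?ex ?ey.
  by have := Qc r; have := Qc (a1 E) => *; sf_tac sQ.
by have := Qc t; have := Qc (a1 E) => *; sf_tac sQ.
Qed.
End EllipticFunctionField.

(** With [a1 = 0] an affine point doubles to infinity only if [a3 = 0], and then the discriminant
    vanishes. *)
Lemma ordinary_a1 (k : fieldType) (E : elliptic_curve k) : 2 = 0 :> k -> ordinary E -> a1 E != 0.
Proof.
move=> two0 [p pk [K [f [_ /= [P [onP P0 mulP]]]]]].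
have twoK : 2 = 0 :> K by apply: rmorph_two0 f two0.
have p2 : p = 2%N.
  have : 2%N \in [pchar k] by rewrite inE /= two0.
  by rewrite (pcharf_eq pk) inE => /eqP.
apply/eqP => a10; case: P onP P0 mulP => [[x y]|] // _ _.
rewrite p2 /mul_point /= eqxx /= a10 rmorph0 mul0r addr0 addrr2 // add0r.
case: eqP => // e _; have a30 : a3 E = 0 by apply: (fmorph_inj f); rewrite e rmorph0.
by have /eqP := disc_neq0 E; apply; rewrite disc_char2 // a10 a30; ring.
Qed.

(** * The condition is necessary *)

Lemma ord3_sum (V : zmodType) (F : 'I_3 -> V) i j l : i != j -> j != l -> i != l ->
  \sum_i F i = F i + F j + F l.
Proof.
move=> ij jl il; rewrite (bigD1 i) //= (bigD1 j) 1?eq_sym //= (bigD1 l) /=; last first.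
  by rewrite ![l == _]eq_sym il jl.
rewrite big1 ?addr0 ?addrA // => m.
case: i j l m ij jl il => [[|[|[|//]]] ?] [[|[|[|//]]] ?] [[|[|[|//]]] ?] [[|[|[|//]]] ?] //=.
Qed.

(** * Divisibility between linear and quadratic forms *)

Section PolyForms.
Variables (k : fieldType) (two0 : 2 = 0 :> k).
Implicit Types (a d al ga mu nu : k).
Local Notation quadp a d := (a *: 'X^2 + 'X + d%:P : {poly k}).
Local Notation linp al ga := (al *: 'X + ga%:P : {poly k}).
Let two := poly2_0 two0.

Lemma resp_comb a d al ga : (res a d al ga)%:P
  = al%:P ^+ 2 * quadp a d + a%:P * linp al ga ^+ 2 + al%:P * linp al ga.
Proof. rewrite -!mul_polyC /res; ring. Qed.

Lemma size_quadp a d : (1 < size (quadp a d))%N.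
Proof.
rewrite ltnNge; apply/negP => h; have := nth_default 0 h.
by rewrite !coefD coefZ coefXn coefX coefC /= mulr0 add0r addr0 => /eqP; rewrite oner_eq0.
Qed.

Lemma linp_eq0 al ga : linp al ga = 0 -> al = 0 /\ ga = 0.
Proof.
move=> e; split.
  have := congr1 (fun p : {poly k} => p`_1) e.
  by rewrite coefD coefZ coefX coefC coef0 /= mulr1 addr0.
have := congr1 (fun p : {poly k} => p`_0) e.
by rewrite coefD coefZ coefX coefC coef0 /= mulr0 add0r.
Qed.

Lemma size_linp al ga : (size (linp al ga) <= 2)%N.
Proof.
rewrite (leq_trans (size_polyD _ _)) // geq_max (leq_trans (size_scale_leq _ _)) ?size_polyX //=.
by rewrite (leq_trans (size_polyC_leq1 _)).
Qed.

Lemma size_linp_lead al ga : al != 0 -> size (linp al ga) = 2%N.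
Proof.
move=> al0; apply/eqP; rewrite eqn_leq size_linp ltnNge; apply/negP => h.
have := nth_default 0 h; rewrite coefD coefZ coefX coefC /= mulr1 addr0 => z.
by rewrite z eqxx in al0.
Qed.

(* A binary quadratic form [A] with two distinct roots dividing [m S l^2] must divide [m]
   when it is prime to [S] and [l]; the root at infinity is the case [a = 0]. *)
Lemma form_dvd a d m1 m0 al ga mu nu q2 q1 q0 :
  res a d al ga != 0 -> res a d mu nu != 0 ->
  linp m1 m0 * linp al ga * linp mu nu ^+ 2
    = quadp a d * (q2 *: 'X^2 + q1 *: 'X + q0%:P) ->
  m1 = 0 /\ m0 = 0.
Proof.
move=> rS rl e; set A := quadp a d in e; set m := linp m1 m0 in e.
set S := linp al ga in e; set l := linp mu nu in e; set Q := (X in A * X) in e.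
have cS : coprimep A S.
  apply/Bezout_eq1_coprimepP; exists ((res a d al ga)^-1%:P * al%:P ^+ 2, (res a d al ga)^-1%:P * (a%:P * S + al%:P)).
  rewrite /=; transitivity ((res a d al ga)^-1%:P * (res a d al ga)%:P).
    by rewrite resp_comb -/A -/S; ring.
  by rewrite -polyCM mulVf.
have cl : coprimep A l.
  apply/Bezout_eq1_coprimepP; exists ((res a d mu nu)^-1%:P * mu%:P ^+ 2, (res a d mu nu)^-1%:P * (a%:P * l + mu%:P)).
  rewrite /=; transitivity ((res a d mu nu)^-1%:P * (res a d mu nu)%:P).
    by rewrite resp_comb -/A -/l; ring.
  by rewrite -polyCM mulVf.
have Am : A %| m.
  rewrite -(Gauss_dvdpl _ cS) -(Gauss_dvdpl _ (coprimep_expr 2 cl)) e.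
  by rewrite dvdp_mulr.
have sA : (1 < size A)%N by apply: size_quadp.
have sm : (size m <= 2)%N by apply: size_linp.
suff m0' : m = 0 by apply: linp_eq0.
apply/eqP; apply: contraT => nm; exfalso.
have [a0|a0] := eqVneq a 0; last first.
  have sA3 : size A = 3%N.
    rewrite /A -addrA size_polyDl size_scale // size_polyXn // ltnS.
    rewrite (leq_trans (size_polyD _ _)) // geq_max size_polyX /=.
    by rewrite (leq_trans (size_polyC_leq1 _)).
  by have := dvdp_leq nm Am; rewrite sA3 leqNgt ltnS sm.
have m10 : m1 = 0.
  apply/eqP; apply: contraT => n1.
  have al0 : al != 0.
    by apply: contraNneq rS => z; rewrite /res z a0; apply/eqP; ring.
  have mu0 : mu != 0.
    by apply: contraNneq rl => z; rewrite /res z a0; apply/eqP; ring.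
  have sl : size l = 2%N := size_linp_lead nu mu0.
  have sS : size S = 2%N := size_linp_lead ga al0.
  have sm' : size m = 2%N := size_linp_lead m0 n1.
  have nz (p : {poly k}) : size p = 2%N -> p != 0 by rewrite -size_poly_gt0 => ->.
  have h5 : size (A * Q) = 5%N.
    rewrite -e; move: (m) (S) (l) sm' sS sl => p1 p2 p3 s1 s2 s3.
    have [n1' [n2 n3]] := (nz _ s1, (nz _ s2, nz _ s3)).
    by rewrite expr2 !size_mul ?mulf_neq0 // s1 s2 s3.
  have := size_polyMleq A Q; rewrite h5 /A a0 scale0r add0r -[X in X + _]scale1r.
  rewrite size_linp_lead ?oner_neq0 //.
  have : (size Q <= 3)%N.
    rewrite /Q -addrA (leq_trans (size_polyD _ _)) // geq_max.
    rewrite (leq_trans (size_scale_leq _ _)) ?size_polyXn //=.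
    by rewrite (leq_trans (size_linp _ _)).
  by move: (size Q) => u; lia.
have : (size m <= 1)%N by rewrite /m m10 scale0r add0r size_polyC_leq1.
by have := dvdp_leq nm Am; move: sA; move: (size A) (size m) => u v; lia.
Qed.
End PolyForms.

Section Poles.
Variables (k K : fieldType) (c : {rmorphism k -> K}) (two0 : 2 = 0 :> k) (x : K).
Let twoK : 2 = 0 :> K. Proof. exact: rmorph_two0 c two0. Qed.
Hypothesis tx : transc c x.

(** At most a simple pole at infinity, [deg N <= deg B + 1]. With [simple_pole] at every irreducible
    polynomial this covers all places of the line. *)
Definition simple_pole_oo (f : K) := exists N B : {poly k},
  [/\ B != 0, (size N <= (size B).+1)%N & f * evp c x B = evp c x N].

Lemma simple_pole_ooD f g : simple_pole_oo f -> simple_pole_oo g -> simple_pole_oo (f + g).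
Proof.
move=> [N [B [B0 sN e]]] [N' [B' [B'0 sN' e']]]; exists (N * B' + N' * B), (B * B').
split; first by rewrite mulf_neq0.
  have sB : (0 < size B)%N by rewrite size_poly_gt0.
  have sB' : (0 < size B')%N by rewrite size_poly_gt0.
  rewrite size_mul // (leq_trans (size_polyD _ _)) // geq_max.
  have h1 := size_polyMleq N B'; have h2 := size_polyMleq N' B.
  move: sB sB' sN sN' h1 h2; move: (size B) (size B') (size N) (size N') (size (N * B')) (size (N' * B)).
  by move=> *; lia.
by rewrite rmorphD !rmorphM /= -e -e'; ring.
Qed.

Variables (a d al ga e : k) (w : K).
Hypothesis nf : normal_form c a d al ga e x w.
Local Notation quadp := (a *: 'X^2 + 'X + d%:P : {poly k}).

Lemma quadp_separable : coprimep quadp quadp^`().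
Proof.
rewrite !derivD derivZ derivXn derivX derivC addr0 -mulr_natl (poly2_0 two0) mul0r scaler0 add0r.
exact: coprimep1.
Qed.

Lemma normal_form_poly : exists2 N : {poly k}, (size N <= 3)%N
  & (w ^+ 2 + w) * evp c x quadp = evp c x N.
Proof.
exists ((al *: 'X + ga%:P) ^+ 2 + e *: quadp).
  rewrite (leq_trans (size_polyD _ _)) // geq_max; apply/andP; split.
    rewrite expr2 (leq_trans (size_polyMleq _ _)) //.
    by have := size_linp al ga; move: (size _) => u; lia.
  rewrite (leq_trans (size_scale_leq _ _)) // -addrA (leq_trans (size_polyD _ _)) // geq_max.
  rewrite (leq_trans (size_scale_leq _ _)) ?size_polyXn //=.
  by rewrite -[X in X + _]scale1r (leq_trans (size_linp _ _)).
rewrite -quad_evp rmorphD rmorphXn /= -lin_evp evpZ -quad_evp nf.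
by field; apply: quad_neq0.
Qed.

Lemma normal_form_simple p : irreducible_poly p -> simple_pole c x p (w ^+ 2 + w).
Proof.
move=> ip; have [N _ e1] := normal_form_poly.
exact: (simple_pole_sep two0 ip quadp_separable e1).
Qed.

Lemma normal_form_simple_oo : simple_pole_oo (w ^+ 2 + w).
Proof.
have [N sN e1] := normal_form_poly; exists N, quadp; split=> //; first exact: quad_poly_neq0.
by rewrite (leq_trans sN) // ltnS size_quadp.
Qed.

End Poles.

Lemma der_normal_form (k : fieldType) (X : curve_data k) (two0 : 2 = 0 :> k) (x : X)
    a d al ga e w (D : derivation X) : transc (cst X) x ->
  normal_form (cst X) a d al ga e x w ->
  D w = (lin (cst X) al ga x / quad (cst X) a d x) ^+ 2 * D x.
Proof.
have twoX : 2 = 0 :> X by apply: rmorph_two0 (cst X) two0.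
move=> tx nf; have A0 := quad_neq0 a d tx.
have -> : D w = D (w ^+ 2 + w) by rewrite derD der_sqr // add0r.
by rewrite nf derD der_cst addr0 derM der_sqr // derV // der_quad //; field.
Qed.

(** * Three normal forms under one hyperelliptic field *)

Section Hyperelliptic.
Variables (k : fieldType) (two0 : 2 = 0 :> k).
Hypothesis sqrtk : forall a : k, exists b, b ^+ 2 = a.
Variables (X : curve_data k) (x : X) (tx : transc (cst X) x).
Variables (a d al ga e : 'I_3 -> k) (w : 'I_3 -> X).
Local Notation c := (cst X).
Local Notation P := (ratl c).
Hypothesis nf : forall i, normal_form c (a i) (d i) (al i) (ga i) (e i) x (w i).
Hypothesis r0 : forall i, res (a i) (d i) (al i) (ga i) != 0.
Hypothesis nonrational : forall i s, transc c s -> P s x -> P s (w i) -> False.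
Let Pi i := span2 (P x) (w i).
Hypothesis deg2 : forall i, exists v, AS_gen (Pi i) v.
Hypothesis dist : forall i j, i != j -> ~ Pi j (w i).
Variables (s y : X) (ts : transc c s) (gy : AS_gen (P s) y).
Variables (D : derivation X) (Ds0 : D s != 0).

Let twoX : 2 = 0 :> X. Proof. exact: rmorph_two0 (cst X) two0. Qed.
Let sPx := ratl_subfield c x.
Let sPs := ratl_subfield c s.
Let A i := quad c (a i) (d i) x.
Let S i := lin c (al i) (ga i) x.
Let A0 i : A i != 0. Proof. exact: quad_neq0. Qed.

Lemma Pf i : P x (w i ^+ 2 + w i).
Proof.
rewrite nf; have := ratl_quad c (a i) (d i) x; have := ratl_lin c (al i) (ga i) x.
by have := ratl_cst c x (e i) => *; sf_tac sPx.
Qed.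

Lemma nPw i : ~ P x (w i).
Proof. by move=> Pw; apply: (nonrational tx _ Pw); apply: ratl_gen. Qed.

Lemma sPi i : subfield (Pi i).
Proof. exact: (span2_subfield sPx twoX (Pf i) (nPw (i := i))). Qed.

(** Over [k(E_0)] the elements [w_1], [w_2] both differ from the same generator [v] by elements of
    [k(E_0)], so [w_1 + w_2] is in [k(E_0)]. By [AS_linear] it is in [k(x)] or in [w_0 + k(x)], and
    the first case would identify two of the curves. The total is then in [k(x)], and it is constant
    because the three right-hand sides have simple poles only. *)
Lemma sum_w : exists alpha, w 0 + w 1 + w (1 + 1) = c alpha.
Proof.
have [v gv] := deg2 0; have sP0 := sPi 0.
have P0 z : P x z -> Pi 0 z by apply: (span2_base sPx).
have h i : i != 0 -> Pi 0 (w i + v).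
  by move=> i0; have [/(dist i0)|//] := AS_shift sP0 twoX gv (P0 _ (Pf i)).
have h12 : Pi 0 (w 1 + w (1 + 1)).
  have -> : w 1 + w (1 + 1) = (w 1 + v) + (w (1 + 1) + v) by ring.
  by apply: (sfD sP0); apply: h.
have [a' [b' [Pa Pb e1]]] := h12.
have Pww : P x ((a' + b' * w 0) ^+ 2 + (a' + b' * w 0)).
  rewrite -e1; have -> : (w 1 + w (1 + 1)) ^+ 2 + (w 1 + w (1 + 1))
     = (w 1 ^+ 2 + w 1) + (w (1 + 1) ^+ 2 + w (1 + 1)) by ring.
  by apply: (sfD sPx); apply: Pf.
have Pal : P x (w 0 + w 1 + w (1 + 1)).
  case: (AS_linear sPx twoX (Pf 0) (nPw (i := 0)) Pa Pb Pww) => b'v.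
    have n12 : (1 : 'I_3) != 1 + 1 by [].
    case: (dist n12); exists a', 1; split=> //; first exact: sf1.
    by rewrite mul1r; apply: (addr2_eq0 twoX); move: e1; rewrite b'v mul0r addr0 => <-; ring.
  have -> : w 0 + w 1 + w (1 + 1) = a'.
    by rewrite -addrA e1 b'v; ring.
  by [].
apply: (AS_no_pole two0 tx Pal) => [p ip|].
  have -> : (w 0 + w 1 + w (1 + 1)) ^+ 2 + (w 0 + w 1 + w (1 + 1))
     = (w 0 ^+ 2 + w 0) + (w 1 ^+ 2 + w 1) + (w (1 + 1) ^+ 2 + w (1 + 1)) by ring.
  have hp i := normal_form_simple two0 tx (nf i) ip.
  exact: (simple_poleD two0 ip (simple_poleD two0 ip (hp 0) (hp 1)) (hp (1 + 1))).
have -> : (w 0 + w 1 + w (1 + 1)) ^+ 2 + (w 0 + w 1 + w (1 + 1))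
   = (w 0 ^+ 2 + w 0) + (w 1 ^+ 2 + w 1) + (w (1 + 1) ^+ 2 + w (1 + 1)) by ring.
have hp i := normal_form_simple_oo two0 tx (nf i).
exact: (simple_pole_ooD two0 (simple_pole_ooD two0 (hp 0) (hp 1)) (hp (1 + 1))).
Qed.

Lemma sum_wi i j l : i != j -> j != l -> i != l -> exists alpha, w i + w j + w l = c alpha.
Proof.
move=> ij jl il; have [alpha e1] := sum_w; exists alpha; rewrite -e1.
by rewrite -(ord3_sum w ij jl il) (@ord3_sum _ w 0 1 (1 + 1)).
Qed.

Lemma Dx0 : D x != 0.
Proof.
apply/eqP => z; move/eqP: Ds0; apply.
have [v [Pv nv span]] := deg2 0.
have D0 t : Pi 0 t -> D t = 0.
  move=> [a' [b' [Pa Pb ->]]].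
  by rewrite derD derM (der_normal_form two0 D tx (nf 0)) z (der_ratl twoX Pa z) (der_ratl twoX Pb z); ring.
have Dv : D v = 0.
  have -> : D v = D (v ^+ 2 + v) by rewrite derD der_sqr // add0r.
  exact: D0.
have [a' [b' [Pa Pb ->]]] := span s.
by rewrite derD derM Dv (D0 _ Pa) (D0 _ Pb); ring.
Qed.

(** Differentiating the constant [w_i + w_j + w_l] gives the square of the sum, times [D x]. *)
Lemma sum_slopes i j l : i != j -> j != l -> i != l -> S i / A i + S j / A j + S l / A l = 0.
Proof.
move=> ij jl il; have [alpha e1] := sum_wi ij jl il.
have e2 : (S i / A i + S j / A j + S l / A l) ^+ 2 * D x = 0.
  transitivity (D (w i + w j + w l)); last by rewrite e1 der_cst.
  rewrite !derD !(der_normal_form two0 D tx (nf _)) -/(A i) -/(A j) -/(A l) -/(S i) -/(S j) -/(S l). ring.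
by move/eqP: e2; rewrite mulf_eq0 (negPf Dx0) orbF sqrf_eq0 => /eqP.
Qed.

Lemma sum_forms i j l : i != j -> j != l -> i != l ->
  exists kap, S i ^+ 2 / A i + S j ^+ 2 / A j + S l ^+ 2 / A l = c kap.
Proof.
move=> ij jl il; have [alpha e1] := sum_wi ij jl il.
exists (alpha ^+ 2 + alpha + (e i + e j + e l)).
have -> : c (alpha ^+ 2 + alpha + (e i + e j + e l))
  = c alpha ^+ 2 + c alpha + (c (e i) + c (e j) + c (e l)) by ring.
rewrite -e1; transitivity ((w i ^+ 2 + w i) + (w j ^+ 2 + w j) + (w l ^+ 2 + w l)
  + (c (e i) + c (e j) + c (e l))); last by ring.
rewrite !nf -/(A i) -/(A j) -/(A l) -/(S i) -/(S j) -/(S l); ring.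
Qed.

(** If [x] were in [k(s)], each [w_i] would lie in [k(s)] or in [y + k(s)]. They cannot all be of
    the second kind, since the sum of three such elements is not in [k(s)]. *)
Lemma x_not_rational : ~ P s x.
Proof.
move=> Px; have sub z : P x z -> P s z by apply: (ratl_min sPs (ratl_cst c s) Px).
have h i := AS_shift sPs twoX gy (sub _ (Pf i)).
case: (h 0) => [|h0]; first exact: (nonrational ts Px).
case: (h 1) => [|h1]; first exact: (nonrational ts Px).
have [alpha e1] := sum_w.
apply: (nonrational (i := 1 + 1) ts Px).
have -> : w (1 + 1) = c alpha + ((w 0 + y) + (w 1 + y)) by rewrite -e1; ring.
by have := ratl_cst c s alpha => *; sf_tac sPs.
Qed.

Lemma ratio_rational i j : P s (A j / A i).
Proof.
have h m : P s (D x / A m / D s).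
  exact: (regular_ratl two0 ts gy Ds0 (regular1 two0 tx (r0 m) (nf m))).
have -> : A j / A i = (D x / A i / D s) / (D x / A j / D s).
  by have := A0 i; have := A0 j; have := Dx0 => h1 h2 h3; field; rewrite h1 h2 h3 Ds0.
by apply: (sfdiv sPs).
Qed.

(* Taking square roots in [sum_forms], with [A_j = A_i + L^2] and [A_l = A_i + M^2], shows
   that [A_i] divides [M S_i L^2]; if [A_i] is prime to [L], this forces [M = 0]. *)
Lemma A_common_root i j mu nu : A i + A j = lin c mu nu x ^+ 2 ->
  a i + a j = mu ^+ 2 -> d i + d j = nu ^+ 2 -> i != j -> res (a i) (d i) mu nu = 0.
Proof.
move=> eA ea ed ij; apply/eqP; apply: contraT => rn; exfalso.
have [l [jl il]] : exists l : 'I_3, j != l /\ i != l.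
  by case: i j ij {eA ea ed rn} => [[|[|[|//]]] ?] [[|[|[|//]]] ?] //= _;
   first [by exists 0|by exists 1|by exists (1 + 1)].
have [m1 em1] := sqrtk (a i + a l); have [m0 em0] := sqrtk (d i + d l).
pose L := lin c mu nu x; pose M := lin c m1 m0 x.
have eM : A l = A i + M ^+ 2.
  have h1 : c (a l) = c m1 ^+ 2 + c (a i) by rewrite -rmorphXn em1; ring.
  have h0 : c (d l) = c m0 ^+ 2 + c (d i) by rewrite -rmorphXn em0; ring.
  by rewrite /A /M /quad /lin h1 h0; ring.
have eL : A j = A i + L ^+ 2 by rewrite /L -eA; ring.
have g := sum_slopes ij jl il; have [kap f] := sum_forms ij jl il.
have [rho erho] := sqrtk kap.
have e1 : M * (S i / A i) + (M + L) * (S j / A j) = c rho.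
  apply: (sqr2_inj twoX) => /=; rewrite -rmorphXn erho -f.
  have e3 : S l / A l = S i / A i + S j / A j.
    by apply: (addr2_eq0 twoX); rewrite -[RHS]g; ring.
  have -> : S l ^+ 2 / A l = A l * (S l / A l) ^+ 2 by field.
  rewrite e3; transitivity (M ^+ 2 * (S i / A i) ^+ 2 + (M ^+ 2 + L ^+ 2) * (S j / A j) ^+ 2); first by ring.
  have -> : M ^+ 2 = A l + A i by rewrite eM; ring.
  have -> : L ^+ 2 = A j + A i by rewrite eL; ring.
  by field; rewrite !A0.
have e2 : M * S i * L ^+ 2 = A i * (M * S i + (M + L) * S j + c rho * A j).
  have h1 : M * S i * A j + (M + L) * S j * A i = c rho * A i * A j.
    by rewrite -e1; field; rewrite !A0.
  transitivity (M * S i * A j + M * S i * A i); first by rewrite eL; ring.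
  apply: (addr2_eq0 twoX); transitivity (M * S i * A j + (M + L) * S j * A i + c rho * A i * A j); first by ring.
  by rewrite h1 addrr2.
have [m10 m00] : m1 = 0 /\ m0 = 0.
  have [q2 eq2] : exists q2, q2 = m1 * al i + (m1 + mu) * al j + rho * a j by eexists.
  have [q1 eq1] : exists q1, q1 = m1 * ga i + m0 * al i + (m1 + mu) * ga j + (m0 + nu) * al j + rho by eexists.
  have [q0 eq0] : exists q0, q0 = m0 * ga i + (m0 + nu) * ga j + rho * d j by eexists.
  apply: (@form_dvd _ two0 (a i) (d i) m1 m0 (al i) (ga i) mu nu q2 q1 q0) => //.
  apply: (transc_inj tx); rewrite !(rmorphXn, rmorphM) /= -!lin_evp -quad_evp.
  rewrite -/M -/(S i) -/L -/(A i) e2; congr (_ * _).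
  rewrite !rmorphD /= !evpZ rmorphXn /= evpX evpC eq2 eq1 eq0 /M /L /S /A /lin /quad; ring.
have M0 : M = 0 by rewrite /M /lin m10 m00 rmorph0 mul0r addr0.
(* This is what remains for [M = 0]. Comparing coefficients gives [rho] times the resultant of [S j]
   and [A j] equal to zero, while [rho = 0] would make [L] or [S j] vanish. *)
have e4 : L * S j = c rho * A j.
  apply: (mulfI (A0 i)); move: e2; rewrite M0 => e2; apply: (addr2_eq0 twoX).
  transitivity (0 * S i * L ^+ 2 + A i * (0 * S i + (0 + L) * S j + c rho * A j)); first by ring.
  by rewrite e2 addrr2.
have [c1 c2 c3] : [/\ mu * al j = rho * a j, mu * ga j + nu * al j = rho & nu * ga j = rho * d j].
  have : (mu * al j + rho * a j) *: 'X^2 + (mu * ga j + nu * al j + rho) *: 'X + (nu * ga j + rho * d j)%:P = 0.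
    apply: (transc_inj tx); rewrite rmorph0 !rmorphD /= !evpZ rmorphXn /= evpX !evpC.
    transitivity (L * S j + c rho * A j); last by rewrite e4 addrr2.
    by rewrite /L /S /A /lin /quad; ring.
  move=> e5; have h i' : ((mu * al j + rho * a j) *: 'X^2 + (mu * ga j + nu * al j + rho) *: 'X
      + (nu * ga j + rho * d j)%:P)`_i' = 0 by rewrite e5 coef0.
  have := (h 2%N, (h 1%N, h 0%N)); rewrite !coefD !coefZ !coefXn !coefX !coefC /=.
  rewrite !mulr0 !mulr1 !add0r !addr0 => -[/(addr2_eq0 two0) h2 [/(addr2_eq0 two0) h1 /(addr2_eq0 two0) h0]].
  by [].
have [rho0|rho0] := eqVneq rho 0.
  move/eqP: e4; rewrite rho0 rmorph0 mul0r mulf_eq0 => /orP[] /eqP z.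
    move/eqP: rn; apply; move: z; rewrite /L lin_evp => /tx/linp_eq0[-> ->].
    by rewrite /res; ring.
  have := r0 j; move: z; rewrite /S lin_evp => /tx/linp_eq0[-> ->].
  by rewrite /res; have -> : 0 ^+ 2 * d j + 0 * 0 + 0 ^+ 2 * a j = 0 :> k by [ring]; rewrite eqxx.
have /eqP := r0 j; apply; apply: (mulfI rho0); rewrite mulr0.
transitivity (al j ^+ 2 * (rho * d j) + rho * al j * ga j + ga j ^+ 2 * (rho * a j)).
  by rewrite /res; ring.
by rewrite -c3 -c1 -{1}c2; ring.
Qed.

(* Otherwise [A_i] and [L] have a common root, where [L^2 = A_i + A_j], so that the rational
   function [L^2 / A_i] of [x] has degree one. *)
Lemma same_A i j : a i = a j /\ d i = d j.
Proof.
have [->//|ij] := eqVneq i j.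
have [mu emu] := sqrtk (a i + a j); have [nu enu] := sqrtk (d i + d j).
pose L := lin c mu nu x.
have eL : A i + A j = L ^+ 2.
  have h1 : c (a j) = c mu ^+ 2 + c (a i) by rewrite -rmorphXn emu; ring.
  have h0 : c (d j) = c nu ^+ 2 + c (d i) by rewrite -rmorphXn enu; ring.
  by rewrite /A /L /quad /lin h1 h0; ring.
have rz := A_common_root eL (esym emu) (esym enu) ij.
have Pq : P s (L ^+ 2 / A i).
  have -> : L ^+ 2 / A i = 1 + A j / A i by rewrite -eL mulrDl divff.
  by have := ratio_rational i j => *; sf_tac sPs.
have comb := res_comb c (a i) (d i) mu nu x two0; rewrite rz rmorph0 -/(A i) -/L in comb.
have [mu0|mu0] := eqVneq mu 0.
  have [nu0|nu0] := eqVneq nu 0.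
    split; apply: (addr2_eq0 two0); [rewrite -emu mu0|rewrite -enu nu0]; exact: expr0n.
  exfalso; apply: x_not_rational.
  have ai : a i = 0.
    have /eqP : nu ^+ 2 * a i = 0 by rewrite -rz /res mu0; ring.
    by rewrite mulf_eq0 sqrf_eq0 (negPf nu0) => /eqP.
  have Lv : L = c nu by rewrite /L /lin mu0 rmorph0 mul0r add0r.
  have -> : x = c nu ^+ 2 / (L ^+ 2 / A i) - c (d i).
    have cn : c nu != 0 by rewrite fmorph_eq0.
    by rewrite Lv; transitivity (A i - c (d i)); [rewrite /A /quad ai rmorph0; ring|field; rewrite cn A0].
  by have := ratl_cst c s nu; have := ratl_cst c s (d i) => *; sf_tac sPs.
exfalso; apply: x_not_rational.
have cm : c mu != 0 by rewrite fmorph_eq0.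
have L0 : L != 0 by apply: lin_neq0; rewrite // mu0.
(* With zero resultant [res_comb] reads [mu ^ 2 A_i + a_i L ^ 2 + mu L = 0], and division by [L ^ 2]
   recovers [L] from [L ^ 2 / A_i]. *)
have eLr : L = c mu / (c mu ^+ 2 / (L ^+ 2 / A i) + c (a i)).
  have h : c mu ^+ 2 / (L ^+ 2 / A i) + c (a i) = c mu / L.
    apply: (mulIf (expf_neq0 2 L0)); apply: (addr2_eq0 twoX).
    transitivity (c mu ^+ 2 * A i + c (a i) * L ^+ 2 + c mu * L); last by rewrite -comb.
    by field; rewrite A0 L0.
  by rewrite h; field; rewrite cm L0.
have PL : P s L.
  rewrite eLr; have := ratl_cst c s mu; have := ratl_cst c s (a i) => *; sf_tac sPs.
have -> : x = (L - c nu) / c mu by rewrite /L /lin; field.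
by have := ratl_cst c s mu; have := ratl_cst c s nu => *; sf_tac sPs.
Qed.

(** With a common [A] and [S_2 = S_0 + S_1] the sum is the determinant [al_0 ga_1 + al_1 ga_0]. The
    differentials [w_i dx / A] put [w_0] and [w_1] in [k(s)], hence also [(S_0 / S_1) ^ 2] and, by
    [AS_sqr], [S_0 / S_1]. With a nonzero determinant this is a coordinate of the [x]-line, and [x]
    would be in [k(s)]. *)
Lemma sum_res : \sum_i res (a i) (d i) (al i) (ga i) = 0.
Proof.
rewrite (@ord3_sum _ _ 0 1 (1 + 1)) //.
have [a1 d1] := same_A 1 0; have [a2 d2] := same_A (1 + 1) 0.
have := @sum_slopes 0 1 (1 + 1) isT isT isT.
rewrite /A a1 d1 a2 d2 -/(A 0) -!mulrDl => /eqP; rewrite mulf_eq0 invr_eq0 (negPf (A0 0)) orbF => /eqP.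
rewrite /S => eS.
have [eal ega] : al (1 + 1) = al 0 + al 1 /\ ga (1 + 1) = ga 0 + ga 1.
  have : (al 0 + al 1 + al (1 + 1)) *: 'X + (ga 0 + ga 1 + ga (1 + 1))%:P = 0.
    by apply: tx; rewrite -lin_evp -eS /lin; ring.
  by move=> /linp_eq0[h1 h2]; split; apply: (addr2_eq0 two0); rewrite addrC.
rewrite eal ega.
transitivity (al 0 * ga 1 + al 1 * ga 0); first by rewrite /res; ring.
apply/eqP; apply: contraT => dn; exfalso.
have nf0 := nf 0; have nf1 := nf 1; rewrite a1 d1 in nf1.
have h0 := r0 0; have h1 := r0 1; have h2 := r0 (1 + 1); rewrite a1 d1 in h1.
rewrite a2 d2 eal ega in h2.
have PA : P s (D x / A 0 / D s).
  exact: (regular_ratl two0 ts gy Ds0 (regular1 two0 tx h0 nf0)).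
have Pw0 : P s (w 0).
  have := regular_ratl two0 ts gy Ds0 (regular2 two0 tx h0 h1 h2 nf0 nf1); rewrite -/(A 0) => Pw.
  have -> : w 0 = (w 0 * (D x / A 0) / D s) / (D x / A 0 / D s).
    by have := A0 0; have := Dx0 => n1 n2; field; rewrite n1 n2 Ds0.
  exact: sfdiv sPs _ _ _ _.
have Pw1 : P s (w 1).
  have h2' : res (a 0) (d 0) (al 1 + al 0) (ga 1 + ga 0) != 0 by rewrite [al 1 + _]addrC [ga 1 + _]addrC.
  have := regular_ratl two0 ts gy Ds0 (regular2 two0 tx h1 h0 h2' nf1 nf0); rewrite -/(A 0) => Pw.
  have -> : w 1 = (w 1 * (D x / A 0) / D s) / (D x / A 0 / D s).
    by have := A0 0; have := Dx0 => n1 n2; field; rewrite n1 n2 Ds0.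
  exact: sfdiv sPs _ _ _ _.
have nz i : lin c (al i) (ga i) x != 0.
  apply: lin_neq0 => //; apply: contraT; rewrite negb_or !negbK => /andP[/eqP z1 /eqP z2].
  by have /eqP := r0 i; case; rewrite /res z1 z2; ring.
have PS i : P s (w i) -> a i = a 0 -> d i = d 0 -> P s (S i ^+ 2 / A 0).
  move=> Pwi ea ed; have -> : S i ^+ 2 / A 0 = w i ^+ 2 + w i + c (e i).
    by rewrite nf /S /A ea ed; ring.
  by have := ratl_cst c s (e i) => *; sf_tac sPs.
have Pq : P s (S 0 / S 1).
  apply: (AS_sqr sPs twoX gy).
  have -> : (S 0 / S 1) ^+ 2 = (S 0 ^+ 2 / A 0) / (S 1 ^+ 2 / A 0).
    by have := A0 0; have := nz 1 => n1 n2; rewrite /S; field; rewrite n1 n2.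
  by apply: (sfdiv sPs); apply: PS.
apply: x_not_rational.
pose q := S 0 / S 1.
have eq : c (al 0) * x + c (ga 0) = q * (c (al 1) * x + c (ga 1)).
  by rewrite /q /S /lin divfK //; apply: nz.
have n0 : c (al 0) + q * c (al 1) != 0.
  apply: contraNneq dn => z.
  have z' : c (al 0) = q * c (al 1) by apply: (addr2_eq0 twoX).
  have zg : c (ga 0) = q * c (ga 1).
    apply: (addr2_eq0 twoX); transitivity ((c (al 0) * x + c (ga 0)) + q * (c (al 1) * x + c (ga 1))
       + (c (al 0) + q * c (al 1)) * x); first by ring.
    by rewrite eq z addrr2 // mul0r addr0.
  rewrite -(fmorph_eq0 c) rmorphD !rmorphM z' zg; apply/eqP; ring.
have -> : x = (q * c (ga 1) + c (ga 0)) / (c (al 0) + q * c (al 1)).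
  apply: (mulIf n0); rewrite divfK //; apply: (addr2_eq0 twoX).
  transitivity ((c (al 0) * x + c (ga 0)) + q * (c (al 1) * x + c (ga 1))); first by ring.
  by rewrite eq addrr2.
by have := ratl_cst c s (al 0); have := ratl_cst c s (al 1); have := ratl_cst c s (ga 0);
  have := ratl_cst c s (ga 1) => *; sf_tac sPs.
Qed.
End Hyperelliptic.

Section FiniteField.
Variable k : finFieldType.

Lemma two0_card n : #|k| = (2 ^ n)%N -> 2 = 0 :> k.
Proof. by move=> hk; have := pcharf0 (card_finPcharP hk isT). Qed.

Lemma sqrt_finite : 2 = 0 :> k -> forall a : k, exists b, b ^+ 2 = a.
Proof.
move=> two0 a; exists (invF (sqr2_inj two0) a).
exact: (f_invF (sqr2_inj two0) a).
Qed.
End FiniteField.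

Section Transport.
Variables (k : fieldType) (X Y : curve_data k) (f : curve_map X Y).
Local Notation phi := (pullback f).

Lemma pullback_evp y p : phi (evp (cst Y) y p) = evp (cst X) (phi y) p.
Proof.
elim/poly_ind: p => [|p a IH]; first by rewrite !rmorph0.
by rewrite !rmorphD !rmorphM /= IH !evpX !evpC pullback_cst.
Qed.

Lemma pullback_transc y : transc (cst Y) y -> transc (cst X) (phi y).
Proof.
by move=> ty p; rewrite -pullback_evp => /eqP; rewrite fmorph_eq0 => /eqP/ty.
Qed.

Lemma pullback_ratl_img y z : ratl (cst Y) y z -> ratl (cst X) (phi y) (phi z).
Proof.
move=> [p [q [q0 ->]]]; exists p, q; rewrite fmorph_div !pullback_evp; split=> //.
by rewrite -pullback_evp fmorph_eq0.
Qed.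

Lemma pullback_normal_form a d al ga e y w : normal_form (cst Y) a d al ga e y w ->
  normal_form (cst X) a d al ga e (phi y) (phi w).
Proof.
rewrite /normal_form -rmorphXn -rmorphD => ->.
by rewrite rmorphD fmorph_div rmorphXn /= !lin_evp !quad_evp !pullback_evp pullback_cst.
Qed.
End Transport.

Lemma exists_valuation (k : fieldType) (X : curve_data k) (s : X) : transc (cst X) s ->
  exists O : X -> Prop, is_valuation_ring O.
Proof.
move=> ts; pose J u := exists p, u = evp (cst X) s (p * 'X).
have iJ : ideal_of (kpoly s) J.
  split.
  - by move=> _ [r ->]; exists (r * 'X).
  - by move=> _ _ [r ->] [r' ->]; exists (r + r'); rewrite mulrDl rmorphD.
  - by move=> _ _ [r ->] [r' ->]; exists (r * r'); rewrite -mulrA [RHS]rmorphM.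
  - move=> [r]; rewrite -(rmorph1 (evp (cst X) s)) => /(transc_inj ts).
    by move=> /(congr1 (fun p : {poly k} => p`_0))/eqP; rewrite coef1 coefMX /= oner_eq0.
have Js : J s by exists 1; rewrite mul1r evpX.
have [O [vO _ _]] := valuation_dominating (kpoly_subalg s) iJ Js (transc_gen_neq0 ts).
by exists O.
Qed.

(** * From a hyperelliptic cover to the sum of the [1 / j_i] *)

Section OnlyIf.
Variables (k : finFieldType) (two0 : 2 = 0 :> k) (E : 'I_3 -> elliptic_curve k).
Hypothesis a1E : forall i, a1 (E i) != 0.
Let sqrtk := sqrt_finite two0.
Variables (X : curve_data k) (cov : artin_schreier_cover E X).
Let twoX : 2 = 0 :> X. Proof. exact: rmorph_two0 (cst X) two0. Qed.
Local Notation phi i := (pullback (cover_map cov i)).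
Local Notation c := (cst X).
Let x : X := phi 0 (coordinate (base_map cov 0)).

Lemma common_coordinate i : phi i (coordinate (base_map cov i)) = x.
Proof. exact: (cover_comm cov i 0 (FracField.tofrac 'X)). Qed.

Lemma cover_data i : exists (u : k * k * k * k * k) (w : X),
  let: (a, d, al, ga, e) := u in
  [/\ normal_form c a d al ga e x w, res a d al ga ^+ 4 = (j_invariant (E i))^-1,
      forall s, transc c s -> ratl c s x -> ratl c s w -> False
    & forall z, img (phi i) z <-> span2 (ratl c x) w z].
Proof.
pose t := coordinate (base_map cov i).
have tt : transc (cst (ell_curve (E i))) t by apply: coordinate_transc.
have twoE : 2 = 0 :> ell_curve (E i) by apply: rmorph_two0 (cst _) two0.
have [A2 [xE [yE [eqE txE genE]]]] := ell_normalized two0 (a1E i).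
have [dg sp] := base_map_deg2 cov i.
have [v gv] := degree2_AS twoE dg sp.
rewrite img_ratl -/t in gv.
have j0 : (j_invariant (E i))^-1 != 0.
  by rewrite j_invariantV // mulf_neq0 ?disc_neq0 // invr_eq0 expf_neq0.
have [a [d [al [ga [e [w [nf er gw]]]]]]] := double_cover_form two0 sqrtk j0 eqE txE genE tt gv.
exists (a, d, al, ga, e), (phi i w); have [Pf nw sw] := gw.
have spanX z : span2 (ratl c x) (phi i w) (phi i z).
  have [p [q [Pp Pq ->]]] := sw z; exists (phi i p), (phi i q).
  rewrite rmorphD rmorphM -(common_coordinate i); split=> //; exact: pullback_ratl_img.
split=> //.
- by rewrite -(common_coordinate i); apply: pullback_normal_form.
- move=> s ts Px Pw; have sP := ratl_subfield c s.
  have all z : ratl c s (phi i z).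
    have [p [q [Pp Pq ->]]] := spanX z.
    have sub z' : ratl c x z' -> ratl c s z' by apply: (ratl_min sP (ratl_cst c s) Px).
    by have := sub _ Pp; have := sub _ Pq => *; sf_tac sP.
  have eqX : ell_eq c A2 (j_invariant (E i))^-1 (phi i xE) (phi i yE).
    have := congr1 (phi i) eqE; rewrite !(rmorphD, rmorphXn, rmorphM) /= !pullback_cst.
    by [].
  have [x0 [y0 [ex _ _]]] := ell_rational_const two0 sqrtk ts j0 (all _) (all _) eqX.
  exact: transc_ncst (pullback_transc txE) ex.
- move=> z; split=> [[u ->]|]; first exact: spanX.
  move=> [p [q [Pp Pq ->]]].
  have sI := subfield_image (phi i).
  have sub z' : ratl c x z' -> img (phi i) z'.
    apply: (ratl_min sI); first by move=> r; exists (cst _ r); rewrite pullback_cst.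
    by exists t; rewrite common_coordinate.
  have Iw : img (phi i) (phi i w) by eexists.
  by have := sub _ Pp; have := sub _ Pq => *; apply: (sfD sI) => //; apply: (sfM sI).
Qed.

Lemma cover_sum_j : has_genus X 3 -> (exists f : curve_map X (proj_line k), separable_degree2 f) ->
  \sum_(i < 3) (j_invariant (E i))^-1 = 0.
Proof.
move=> [om [rom hom]] [f [dgf spf]].
pose s := coordinate f; have ts : transc c s := @coordinate_transc _ _ f.
(* If all derivations were zero, all regular differentials would be zero too, and coordinates in the
   given basis of length three would not be unique. *)
have [D [u nDu]] : exists (D : derivation X) (u : X), D u <> 0.
  apply: contrapT => no; have D0 (D : derivation X) u : D u = 0.
    by apply: contrapT => h; apply: no; exists D, u.
  pose v : differential X := fun _ => 0.
  have rv : regular v.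
    move=> O vO; exists 0%N, (fun=> 0), (fun=> 0); split=> // D; try by case: D.
    by rewrite big_ord0.
  have [O vO] := exists_valuation ts.
  have omz i D : om i D = 0.
    by have [n [g [t [_ _ ->]]]] := rom i O vO; rewrite big1 // => m _; rewrite D0 mulr0.
  have [cc [_ uq]] := hom v rv.
  have h1 : cc = 0 by apply: uq => D; rewrite big1 // => i _; rewrite omz mulr0.
  have h2 : cc = const_mx 1 by apply: uq => D; rewrite big1 // => i _; rewrite omz mulr0.
  have := congr1 (fun m : 'rV[k]_3 => m 0 0) (etrans (esym h1) h2).
  by rewrite !mxE => /eqP; rewrite eq_sym oner_eq0.
have [y gy] := degree2_AS twoX dgf spf; rewrite img_ratl -/s in gy.
have Ds0 : D s != 0.
  apply/eqP => z; apply: nDu.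
  have [Pf ny span] := gy.
  have Dy : D y = 0.
    by have -> : D y = D (y ^+ 2 + y) by [rewrite derD der_sqr // add0r]; apply: (der_ratl twoX Pf z).
  have [p [q [Pp Pq ->]]] := span u.
  by rewrite derD derM Dy (der_ratl twoX Pp z) (der_ratl twoX Pq z) mul0r mulr0 !addr0.
have [uu hu] := fin_all_exists cover_data.
have [w hw] := fin_all_exists hu.
pose a i := (uu i).1.1.1.1; pose d i := (uu i).1.1.1.2; pose al i := (uu i).1.1.2.
pose ga i := (uu i).1.2; pose e i := (uu i).2.
have h i : [/\ normal_form c (a i) (d i) (al i) (ga i) (e i) x (w i),
      res (a i) (d i) (al i) (ga i) ^+ 4 = (j_invariant (E i))^-1,
      forall s, transc c s -> ratl c s x -> ratl c s (w i) -> False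
    & forall z, img (phi i) z <-> span2 (ratl c x) (w i) z].
  by have := hw i; rewrite /a /d /al /ga /e; case: (uu i) => [[[[? ?] ?] ?] ?].
have j0 i : (j_invariant (E i))^-1 != 0.
  by rewrite j_invariantV // mulf_neq0 ?disc_neq0 // invr_eq0 expf_neq0.
have tx : transc c x by apply/pullback_transc/coordinate_transc.
have eI i : img (phi i) = span2 (ratl c x) (w i).
  by apply/funext => z; apply/propext; case: (h i).
have key : \sum_i res (a i) (d i) (al i) (ga i) = 0.
  apply: (@sum_res k two0 sqrtk X x tx a d al ga e w _ _ _ _ _ s y ts gy D Ds0).
  - by move=> i; case: (h i).
  - move=> i; case: (h i) => _ e4 _ _; apply: contraNneq (j0 i) => z.
    by rewrite -e4 z expr0n.
  - by move=> i; case: (h i).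
  - move=> i; rewrite -eI; have [dg sp] := cover_map_deg2 cov i.
    exact: degree2_AS twoX dg sp.
  - move=> i j ij; rewrite -eI => -[v ev]; apply: (cover_distinct ij) => u0.
    have sI := subfield_image (phi j).
    have sub z' : ratl c x z' -> img (phi j) z'.
      apply: (ratl_min sI); first by move=> r; exists (cst _ r); rewrite pullback_cst.
      by exists (coordinate (base_map cov j)); rewrite common_coordinate.
    have Iw : img (phi j) (w i) by exists v.
    have all z : span2 (ratl c x) (w i) z -> img (phi j) z.
      move=> [p [q [Pp Pq ->]]].
      by have := sub _ Pp; have := sub _ Pq => *; apply: (sfD sI) => //; apply: (sfM sI).
    by apply: all; case: (h i) => _ _ _ h4; apply/h4; exists u0.
transitivity ((\sum_i res (a i) (d i) (al i) (ga i)) ^+ 4); last by rewrite key expr0n.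
rewrite !(@ord3_sum _ _ 0 1 (1 + 1)) //.
have e4 i : (j_invariant (E i))^-1 = res (a i) (d i) (al i) (ga i) ^+ 4 by case: (h i).
rewrite !e4; ring.
Qed.
End OnlyIf.

(** * The condition is sufficient *)

Lemma rmorphism_of (R S : pzRingType) (f : R -> S) :
  zmod_morphism f -> monoid_morphism f -> exists g : {rmorphism R -> S}, g =1 f.
Proof.
move=> fz fm.
pose aM := GRing.isZmodMorphism.Build R S f fz.
pose mM := GRing.isMonoidMorphism.Build R S f fm.
pose g : {rmorphism R -> S} := HB.pack f aM mM.
by exists g.
Qed.

Lemma proj_line_map (k : fieldType) (X : curve_data k) (t : X) : transc (cst X) t ->
  exists f : curve_map X (proj_line k), coordinate f = t.
Proof.
move=> tt; pose F := {fraction {poly k}}.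
have h (z : F) : exists pq : {poly k} * {poly k}, pq.2 != 0 /\
    z = FracField.tofrac pq.1 / FracField.tofrac pq.2.
  by have [n [d [d0 ->]]] := fracE z; exists (n, d).
have [g hg] := choice h.
pose ev := evp (cst X) t.
pose f (z : F) : X := ev (g z).1 / ev (g z).2.
have nz z : ev (g z).2 != 0 by apply: transc_neq0 => //; case: (hg z).
have fE p q : q != 0 -> f (FracField.tofrac p / FracField.tofrac q) = ev p / ev q.
  move=> q0; set z := _ / _; have [n0 /eqP e] := hg z.
  apply/eqP; rewrite /f eqr_div ?nz ?transc_neq0 //.
  move: e; rewrite {1}/z eqr_div ?tofrac_eq0 // -!tofracM tofrac_eq => /eqP e.
  by rewrite /ev -!rmorphM -e.
have fpoly p : f (FracField.tofrac p) = ev p.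
  by have := fE p 1 (oner_neq0 _); rewrite tofrac1 divr1 /ev rmorph1 divr1.
have fz : zmod_morphism f.
  move=> u v; have [n [d [d0 ->]]] := fracE u; have [n' [d' [d'0 ->]]] := fracE v.
  have -> : FracField.tofrac n / FracField.tofrac d - FracField.tofrac n' / FracField.tofrac d'
    = FracField.tofrac (n * d' - n' * d) / FracField.tofrac (d * d').
    by rewrite -mulNr addf_div ?tofrac_eq0 // tofracB !tofracM mulNr.
  rewrite !fE ?mulf_neq0 // /ev rmorphB !rmorphM /=; field.
  by rewrite !transc_neq0.
have fm : monoid_morphism f.
  split=> [|u v]; first by have := fpoly 1; rewrite tofrac1 /ev rmorph1.
  have [n [d [d0 ->]]] := fracE u; have [n' [d' [d'0 ->]]] := fracE v.
  by rewrite mulf_div -!tofracM !fE ?mulf_neq0 // /ev !rmorphM /= mulf_div.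
have [phi ephi] := rmorphism_of fz fm.
have phic a : phi (cst (proj_line k) a) = cst X a.
  by rewrite ephi /= fpoly /ev evpC.
by exists (CurveMap phic); rewrite /coordinate /= ephi fpoly /ev evpX.
Qed.

Lemma AS_lift (L K1 K2 : fieldType) (psi : {rmorphism L -> K1}) (chi : {rmorphism L -> K2})
    (F : L) (y1 : K1) (y2 : K2) : 2 = 0 :> L ->
  AS_gen (img psi) y1 -> y1 ^+ 2 + y1 = psi F -> y2 ^+ 2 + y2 = chi F ->
  exists phi : {rmorphism K1 -> K2}, (forall a, phi (psi a) = chi a) /\ phi y1 = y2.
Proof.
move=> two0 [_ ny span] e1 e2.
have two1 : 2 = 0 :> K1 by apply: rmorph_two0 psi two0.
have two2 : 2 = 0 :> K2 by apply: rmorph_two0 chi two0.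
have h z : exists ab : L * L, z = psi ab.1 + psi ab.2 * y1.
  by have [_ [_ [[a ->] [b ->] ->]]] := span z; exists (a, b).
have [g hg] := choice h.
pose f z := chi (g z).1 + chi (g z).2 * y2.
have fE a b : f (psi a + psi b * y1) = chi a + chi b * y2.
  have I u : img psi (psi u) by exists u.
  have [] := AS_uniq (subfield_image psi) two1 ny (I _) (I _) (I _) (I _) (hg (psi a + psi b * y1)).
  by move=> /(fmorph_inj psi) ea /(fmorph_inj psi) eb; rewrite /f -ea -eb.
have fz : zmod_morphism f.
  move=> u v; rewrite {1}[u]hg {1}[v]hg.
  have -> : psi (g u).1 + psi (g u).2 * y1 - (psi (g v).1 + psi (g v).2 * y1)
    = psi ((g u).1 - (g v).1) + psi ((g u).2 - (g v).2) * y1 by rewrite !rmorphB; ring.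
  by rewrite fE /f !rmorphB; ring.
have fm : monoid_morphism f.
  split=> [|u v].
    have := fE 1 0; rewrite !rmorph1 !rmorph0 !mul0r !addr0.
    by [].
  rewrite {1}[u]hg {1}[v]hg.
  have -> : (psi (g u).1 + psi (g u).2 * y1) * (psi (g v).1 + psi (g v).2 * y1)
    = psi ((g u).1 * (g v).1 + (g u).2 * (g v).2 * F)
      + psi ((g u).1 * (g v).2 + (g u).2 * (g v).1 + (g u).2 * (g v).2) * y1.
    transitivity (psi (g u).1 * psi (g v).1 + psi (g u).2 * psi (g v).2 * (y1 ^+ 2 + y1)
      + (psi (g u).1 * psi (g v).2 + psi (g u).2 * psi (g v).1 + psi (g u).2 * psi (g v).2) * y1).
      by ring.
    by rewrite e1; ring.
  rewrite fE /f; transitivity (chi (g u).1 * chi (g v).1 + chi (g u).2 * chi (g v).2 * (y2 ^+ 2 + y2)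
      + (chi (g u).1 * chi (g v).2 + chi (g u).2 * chi (g v).1 + chi (g u).2 * chi (g v).2) * y2).
    by rewrite e2; ring.
  by ring.
have [phi ephi] := rmorphism_of fz fm.
exists phi; split=> [a|]; rewrite ephi.
  by have := fE a 0; rewrite !rmorph0 !mul0r !addr0.
by have := fE 0 1; rewrite !rmorph0 !rmorph1 !mul1r !add0r.
Qed.

Lemma AS_exists (L : fieldType) (F : L) : 2 = 0 :> L -> (forall z, z ^+ 2 + z <> F) ->
  exists (K : fieldType) (phi : {rmorphism L -> K}) (y : K),
    AS_gen (img phi) y /\ y ^+ 2 + y = phi F.
Proof.
move=> two0 nz; pose p : {poly L} := 'X^2 + 1%:P * 'X - F%:P.
have sp : size p = 3%N.
  rewrite /p -addrA size_polyDl ?size_polyXn // mul1r.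
  by rewrite -[X in X - _]scale1r -polyCN (leq_ltn_trans (size_linp _ _)).
have mp : p \is monic.
  by rewrite monicE /lead_coef sp /= /p !coefD coefN coefXn coefCM coefX coefC mulr0 subr0 addr0.
have nr z : ~~ root p z.
  apply/negP => /rootP; rewrite /p !hornerE => /subr0_eq e; exact: (nz z).
have irr : monic_irreducible_poly p.
  by split=> //; apply: cubic_irreducible; rewrite ?sp.
pose K : fieldType := {poly %/ p with irr}.
pose phi : {rmorphism L -> K} := qpolyC p.
pose red : {rmorphism {poly L} -> K} := in_qpoly p.
have redC a : red a%:P = phi a.
  apply: val_inj; rewrite /= Pdiv.Ring.rmodp_small // /mk_monic sp mp /= sp.
  by rewrite (leq_ltn_trans (size_polyC_leq1 _)).
have red0 : red p = 0.
  apply: val_inj; rewrite /= /mk_monic sp mp /=.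
  exact: Pdiv.RingMonic.rmodpp mp.
have ey : red 'X ^+ 2 + red 'X = phi F.
  by rewrite -(modulus_eval redC red0) rmorph1 mul1r.
exists K, phi, (red 'X); split=> //; split.
- by rewrite ey; exists F.
- move=> [z ez]; apply: (nz z); apply: (fmorph_inj phi).
  by rewrite rmorphD rmorphXn -ez.
move=> z; have [r sr ->] : exists2 r : {poly L}, (size r <= 2)%N & z = red r.
  exists (val (z : {poly %/ p})).
    rewrite -ltnS; apply: leq_trans (size_mk_monic (z : {poly %/ p})) _.
    by rewrite /mk_monic sp mp /= sp.
  apply: val_inj; exact: esym (in_qpoly_small (size_mk_monic (z : {poly %/ p}))).
exists (phi r`_0), (phi r`_1); split; [by eexists|by eexists|].
rewrite -!redC -rmorphM -rmorphD; congr (red _).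
apply/polyP => i; rewrite coefD coefCM coefX coefC.
case: i => [|[|i]]; rewrite /= ?mulr0 ?mulr1 ?add0r ?addr0 //.
by rewrite nth_default // (leq_trans sr).
Qed.

(** * The values of [z^2 + z] in a finite field *)

Section ArtinSchreierValues.
Variables (k : finFieldType) (two0 : 2 = 0 :> k).
Implicit Types u v : k.

Definition AS_value u := exists z : k, z ^+ 2 + z = u.

Lemma AS_valueD u v : AS_value u -> AS_value v -> AS_value (u + v).
Proof. by move=> [z <-] [z' <-]; exists (z + z'); ring. Qed.
Lemma AS_value0 : AS_value 0.
Proof. by exists 0; ring. Qed.
Lemma AS_value_sqr u : AS_value u <-> AS_value (u ^+ 2).
Proof.
split=> [[z <-]|h]; first by exists (z ^+ 2); ring.
have -> : u = u ^+ 2 + (u ^+ 2 + u) by ring.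
by apply: AS_valueD => //; exists u.
Qed.

Let V : {set k} := [set z ^+ 2 + z | z : k].
Lemma AS_valueP u : reflect (AS_value u) (u \in V).
Proof.
by apply: (iffP imsetP) => [[z _ ->]|[z <-]]; exists z.
Qed.

(** A fibre of [z |-> z ^ 2 + z] has no elements besides [z] and [z + 1]. *)
Lemma card_AS_value : (#|k| <= #|V|.*2)%N.
Proof.
rewrite -cardsT -sum1_card (partition_big (fun z : k => z ^+ 2 + z) (mem V)) /=; last first.
  by move=> z _; apply/imsetP; exists z.
rewrite -muln2 -sum_nat_const; apply: leq_sum => u /imsetP[z _ ->].
rewrite sum1_card; apply: (@leq_trans #|[set z; z + 1]|); last by rewrite cards2; case: eqP.
apply/subset_leq_card/fintype.subsetP => t; rewrite unfold_in => /andP[_ /eqP e]; rewrite !inE.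
have : (t + z) * (t + z + 1) = 0.
  by transitivity ((t ^+ 2 + t) + (z ^+ 2 + z)); [ring|rewrite e addrr2].
move=> /eqP; rewrite mulf_eq0 => /orP[] /eqP h; apply/orP; [left|right]; apply/eqP.
  exact: addr2_eq0 two0 _ _ h.
by apply: (addr2_eq0 two0); rewrite -[RHS]h; ring.
Qed.

Lemma disjoint_AS_value u : u \notin V -> [disjoint V & [set z + u | z in V]].
Proof.
move=> nu; apply/pred0P => v /=; apply/negP => /andP[/AS_valueP hv /imsetP[z /AS_valueP hz ev]].
move/AS_valueP: nu; apply; have -> : u = v + z by rewrite ev; ring.
exact: AS_valueD.
Qed.

Lemma card_shift u : #|[set z + u | z in V]| = #|V|.
Proof. by apply: card_imset; apply: addIr. Qed.

(** The disjoint sets [V] and [V + u] have at least [#|k|] elements together, so [v] lies in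
    [V + u]. *)
Lemma AS_value_index2 u v : ~ AS_value u -> ~ AS_value v -> AS_value (u + v).
Proof.
move=> /AS_valueP nu /AS_valueP nv.
have : V :|: [set z + u | z in V] = [set: k]%SET.
  apply/eqP; rewrite eqEcard finset.subsetT cardsT finset.cardsU finset.disjoint_setI0 ?disjoint_AS_value //.
  by rewrite cards0 subn0 card_shift addnn card_AS_value.
move=> /setP/(_ v); rewrite finset.in_setU (negPf nv) inE => /imsetP[z /AS_valueP hz ev].
by have -> : u + v = z by rewrite ev; ring.
Qed.

(** Otherwise [u |-> b / u] would map the complement of [V] injectively into [V] without [0],
    although the complement contains a coset of [V]. *)
Lemma AS_value_exists b : b != 0 -> exists u, ~ AS_value u /\ ~ AS_value (b / u).
Proof.
move=> b0; apply: contrapT => no.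
have sub : [set b / u | u in ~: V] \subset V :\ 0.
  apply/fintype.subsetP => _ /imsetP[u + ->]; rewrite !inE => nu.
  have u0 : u != 0 by apply: contraNneq nu => ->; apply/AS_valueP/AS_value0.
  rewrite mulf_neq0 ?invr_neq0 //=; apply/AS_valueP; apply: contrapT => h.
  by apply: no; exists u; split=> //; apply/AS_valueP.
have inj : injective (fun u => b / u) by move=> u v /(mulfI b0)/invr_inj.
have := subset_leq_card sub; rewrite card_imset //.
have V0 : 0 \in V by apply/AS_valueP/AS_value0.
have [u nu] : exists u, u \notin V.
  apply: contrapT => all.
  have inj2 : injective (fun z : k => z ^+ 2 + z).
    have : #|codom (fun z : k => z ^+ 2 + z)| = #|k|.
      rewrite -cardsT; apply: eq_card => v; rewrite inE.
      have : v \in V by apply: contrapT => h; apply: all; exists v; apply/negP.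
      by move=> /imsetP[z _ ->]; apply: codom_f.
    by move=> /eqP/image_injP h z t; apply: h.
  have /eqP : 0 = 1 :> k by apply: inj2 => /=; ring.
  by rewrite eq_sym oner_eq0.
have sub2 : [set z + u | z in V] \subset ~: V.
  apply/fintype.subsetP => v vs; rewrite inE; apply/negP => vV.
  by have /pred0P/(_ v) := disjoint_AS_value nu; rewrite /= vV vs.
have := subset_leq_card sub2; rewrite card_shift => h1 h2.
have := leq_trans h1 h2; rewrite [#|V|](cardsD1 0) V0 ltnn.
by [].
Qed.
End ArtinSchreierValues.

(** * Models [w^2 + w = g^2 / (t^2 + t + eps) + e] of one elliptic curve *)

Section Models.
Variables (k : finFieldType) (two0 : 2 = 0 :> k).
Variables (K : fieldType) (c : {rmorphism k -> K}).
Variables (a2 : k) (x y : K) (g : k).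
Let b := g ^+ 2.
Hypotheses (g0 : g != 0) (exy : ell_eq c a2 (b ^+ 4) x y) (tx : transc c x).
Let sqrtk := sqrt_finite two0.
Let twoK : 2 = 0 :> K. Proof. exact: rmorph_two0 c two0. Qed.
Local Notation presents := (presents c (b ^+ 4) x y).

Let b0 : b != 0. Proof. exact: expf_neq0. Qed.

Lemma res_std e0 : res 1 e0 0 g = b.
Proof. by rewrite /res /b; ring. Qed.

(** The new coordinate [t = b / (al S)] sends the zero of the linear form [S] to infinity, which
    makes the numerator constant; [res_comb] divided by [S ^ 2] expresses the denominator in [t].
    When [al = 0] a scaling is enough. *)
Lemma standardize xi a d al ga e w : presents xi a d al ga e w ->
  exists t, presents t 1 (if al == 0 then a * d else a * b / al ^+ 2) 0 g e w.
Proof.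
move=> pr; have txi := presents_transc tx pr; have [nf er gen] := pr.
have rb : res a d al ga = b.
  have h : (res a d al ga ^+ 2) ^+ 2 = (b ^+ 2) ^+ 2.
    by transitivity (res a d al ga ^+ 4); [ring|rewrite er; ring].
  have inj : injective (fun u : k => u ^+ 2) by apply: sqr2_inj.
  exact: inj (inj _ _ h).
have A0 := quad_neq0 a d txi.
have comb := res_comb c a d al ga xi two0; rewrite rb in comb.
have cg : c b = c g ^+ 2 by rewrite -rmorphXn.
have fin t e0 : quad c 1 e0 t != 0 ->
    c b * quad c a d xi = quad c 1 e0 t * lin c al ga xi ^+ 2 ->
    (forall P : K -> Prop, subfield P -> (forall r, P (c r)) -> P t -> P xi) ->
    presents t 1 e0 0 g e w.
  move=> q0 h gen'; split; last first.
  - by move=> P sP Pc Pt Pw; apply: gen => //; apply: gen'.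
  - by rewrite res_std.
  rewrite /normal_form nf; congr (_ + _).
  apply/eqP; rewrite eqr_div //; apply/eqP.
  by rewrite [LHS]mulrC -h cg /lin rmorph0 mul0r add0r.
have bK : c b != 0 by rewrite fmorph_eq0.
have [al0|al0] := eqVneq al 0.
  have eb : b = ga ^+ 2 * a by rewrite -rb /res al0; ring.
  have a0 : c a != 0 by rewrite fmorph_eq0; apply: contraNneq b0 => z; rewrite eb z mulr0.
  have eq : quad c 1 (a * d) (c a * xi) = c a * quad c a d xi by rewrite /quad; ring.
  exists (c a * xi); apply: fin.
  - by rewrite eq mulf_neq0.
  - by rewrite eq eb /lin al0 rmorph0 mul0r add0r; ring.
  - move=> P sP Pc Pt; have -> : xi = c a * xi / c a by field.
    by have := Pc a => *; sf_tac sP.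
have cal : c al != 0 by rewrite fmorph_eq0.
have S0 : lin c al ga xi != 0 by apply: lin_neq0; rewrite // al0.
pose S := lin c al ga xi; pose t := c b / (c al * S).
have ce : c (a * b / al ^+ 2) = c a * c b / c al ^+ 2 by rewrite fmorph_div rmorphXn rmorphM.
have h : c b * quad c a d xi = quad c 1 (a * b / al ^+ 2) t * S ^+ 2.
  rewrite {2}/quad ce rmorph1 mul1r.
  transitivity (c b / c al ^+ 2 * (c b + c a * S ^+ 2 + c al * S)).
    have -> : c b + c a * S ^+ 2 + c al * S = c al ^+ 2 * quad c a d xi.
      by rewrite comb -/S; ring.
    by field.
  by rewrite /t; field; rewrite S0 cal.
exists t; apply: fin => //.
- apply: contraNneq (mulf_neq0 bK A0) => z; by rewrite h z mul0r.
- move=> P sP Pc Pt; have -> : xi = (c b / (c al * t) - c ga) / c al.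
    have -> : c b / (c al * t) = S by rewrite /t; field; rewrite bK S0 cal.
    by rewrite /S /lin; field.
  by have := Pc b; have := Pc al; have := Pc ga => *; sf_tac sP.
Qed.

Lemma presents_shift t e0 e w tau om : presents t 1 e0 0 g e w ->
  presents (t + c tau) 1 (e0 + (tau ^+ 2 + tau)) 0 g (e + (om ^+ 2 + om)) (w + c om).
Proof.
move=> [nf er gen]; split.
- have eq : quad c 1 (e0 + (tau ^+ 2 + tau)) (t + c tau) = quad c 1 e0 t.
    by rewrite /quad; ring.
  have el : lin c 0 g (t + c tau) = lin c 0 g t by rewrite /lin; ring.
  rewrite /normal_form eq el.
  transitivity ((w ^+ 2 + w) + (c om ^+ 2 + c om)); first by ring.
  by rewrite nf; ring.
- by rewrite res_std.
- move=> P sP Pc Pt Pw; apply: gen => //.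
    have -> : t = (t + c tau) - c tau by ring.
    by have := Pc tau => *; sf_tac sP.
  have -> : w = (w + c om) - c om by ring.
  by have := Pc om => *; sf_tac sP.
Qed.

(** If it were zero, [slope_trace] would give [x ^ 2 = y0 + lam x0]. For [x0 != 0] this puts [lam]
    and [y] in [k(x)]; for [x0 = 0] it makes [x] constant. *)
Lemma slope_quad_neq0 x0 y0 : y0 ^+ 2 + x0 * y0 = x0 ^+ 3 + a2 * x0 ^+ 2 + b ^+ 4 ->
  quad c 1 (a2 + x0) ((y + c y0) / (x + c x0)) != 0.
Proof.
move=> e0; have nx : x != c x0 by apply/eqP/transc_ncst.
have [ey ex] := slope_trace two0 exy e0 nx.
apply/eqP => hz; move: ey ex; rewrite hz; set lam := _ / _ => ey ex.
have ex' : x ^+ 2 = c y0 + lam * c x0.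
  by transitivity (x ^+ 2 + 0 * x); [ring|rewrite ex; ring].
have [z|nz] := eqVneq x0 0.
  have [r er] := sqrtk y0; apply: (@transc_ncst _ _ c x r tx).
  apply: (sqr2_inj twoK) => /=; rewrite ex' z rmorph0 mulr0 addr0 -er.
  by rewrite rmorphXn.
have cz : c x0 != 0 by rewrite fmorph_eq0.
have sP := ratl_subfield c x; have Px := ratl_gen c x.
have Py : ratl c x y.
  have -> : y = (x ^+ 2 - c y0) / c x0 * (x + c x0) + c y0.
    by rewrite {1}ey ex'; field.
  by have := ratl_cst c x x0; have := ratl_cst c x y0 => *; sf_tac sP.
have [x1 [_ [ex1 _ _]]] := ell_rational_const two0 sqrtk tx (expf_neq0 4 b0) Px Py exy.
exact: transc_ncst tx ex1.
Qed.

Lemma model_split : exists t w, presents t 1 0 0 g a2 w.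
Proof.
have x0 : x != 0 by apply/eqP; rewrite -(rmorph0 c); apply: transc_ncst.
have [al [ga [w pr]]] := presents_x two0 sqrtk exy x0.
have [t] := standardize pr; rewrite !mul0r if_same => pr'.
by exists t, w.
Qed.

(** The slopes through a point of abscissa [x0 = q ^ 2 != 0] give the constants [b / q] and [q].
    Such a point exists when [x0 + (b ^ 2 / x0) ^ 2 + a2] is an Artin-Schreier value, which holds if
    [a2] is one and neither [x0] nor [b ^ 2 / x0] is. If [a2] is not a value, the point with
    [x0 = 0] gives the constants [a2] and [0]. *)
Lemma model_twisted : exists t e0 e w,
  [/\ ~ AS_value e0, ~ AS_value (e + a2) & presents t 1 e0 0 g e w].
Proof.
have [h2|h2] := pselect (AS_value a2); last first.
  have e0 : (b ^+ 2) ^+ 2 + 0 * b ^+ 2 = 0 ^+ 3 + a2 * 0 ^+ 2 + b ^+ 4 by ring.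
  have nx : x != c 0 by apply/eqP/transc_ncst.
  have [q [al [ga [w [q2 al2 pr]]]]] :=
    presents_slope two0 sqrtk exy e0 nx (slope_quad_neq0 e0).
  have q0 : q = 0 by apply/eqP; rewrite -sqrf_eq0 q2.
  have al0 : al = 0 by apply/eqP; rewrite -sqrf_eq0 al2 q0.
  have [t] := standardize pr; rewrite al0 eqxx mul1r addr0 q0 => pr'.
  by exists t, a2, 0, w; rewrite add0r.
have [x0 [n1 n2]] := AS_value_exists two0 (expf_neq0 2 b0).
have x00 : x0 != 0.
  by apply: contra_notN n1 => /eqP ->; apply: AS_value0.
have [y0 e0] : exists y0, y0 ^+ 2 + x0 * y0 = x0 ^+ 3 + a2 * x0 ^+ 2 + b ^+ 4.
  have [z ez] : AS_value (x0 + (b ^+ 2 / x0) ^+ 2 + a2).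
    apply: AS_valueD => //; apply: AS_value_index2 => //.
    by move=> h; apply: n2; apply: (proj2 (AS_value_sqr two0 _)).
  exists (x0 * z); transitivity (x0 ^+ 2 * (z ^+ 2 + z)); first by ring.
  by rewrite ez; field.
have nx : x != c x0 by apply/eqP/transc_ncst.
have [q [al [ga [w [q2 al2 pr]]]]] :=
  presents_slope two0 sqrtk exy e0 nx (slope_quad_neq0 e0).
have q0 : q != 0 by apply: contraNneq x00 => z; rewrite -q2 z expr0n.
have al0 : al != 0 by apply: contraNneq q0 => z; rewrite -al2 z expr0n.
have [t] := standardize pr; rewrite (negPf al0) mul1r al2 => pr'.
exists t, (b / q), q, w; split=> //.
  by move=> /(AS_value_sqr two0); rewrite expr_div_n q2.
move=> h; apply: n1; rewrite -q2; apply: (proj1 (AS_value_sqr two0 q)).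
have -> : q = (q + a2) + a2 by ring.
exact: AS_valueD.
Qed.
End Models.

(** * Algebraic elements and constants of a function field *)

Section Constants.
Variables (k : fieldType) (X : curve_data k).
Local Notation c := (cst X).

Lemma evp_kpolyV z n (q : {poly k}) : z != 0 -> (size q <= n.+1)%N ->
  kpoly z^-1 (evp c z q / z ^+ n).
Proof.
move=> z0; elim: n q => [|n IH] q sq.
  by exists q; rewrite (size1_polyC sq) !evpC expr0 divr1.
have [r er] : kpoly z^-1 (evp c z (drop_poly 1 q) / z ^+ n).
  by apply: IH; rewrite size_drop_poly; lia.
exists (r + q`_0 *: 'X^(n.+1)).
rewrite rmorphD /= -er evpZ rmorphXn /= evpX.
rewrite -{1}(poly_take_drop 1 q) rmorphD rmorphM /= expr1 evpX.
have -> : take_poly 1 q = (q`_0)%:P.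
  by apply/polyP => i; rewrite coef_take_poly coefC; case: i.
rewrite evpC exprVn !exprS; have := expf_neq0 n z0.
by move: (z ^+ n) (evp c z _) (c _) => u A C u0; field; rewrite z0 u0.
Qed.

(** Dividing an equation of degree [n + 1] by [z ^ n] expresses [z] as a polynomial in [z^-1]. *)
Lemma vring_algebraic O z : is_valuation_ring O -> algebraicOver c z -> O z.
Proof.
move=> vO [p p0 /eqP]; rewrite -[_.[z]]/(evp c z p) => ez.
have [//|OV] := vring_inv vO z.
have sO := vring_subalg vO.
have [->|z0] := eqVneq z 0; first exact: sa0 sO.
have sp : (1 < size p)%N.
  rewrite ltnNge; apply/negP => s1; move: ez p0; rewrite (size1_polyC s1) evpC.
  by move=> /eqP; rewrite fmorph_eq0 polyC_eq0 => ->.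
have [n en] : exists n, size p = n.+2 by exists (size p).-2; lia.
pose l := lead_coef p.
have l0 : c l != 0 by rewrite fmorph_eq0 lead_coef_eq0.
pose q := p - l *: 'X^(n.+1).
have sq : (size q <= n.+1)%N.
  apply/leq_sizeP => j hj; rewrite coefB coefZ coefXn.
  have [ej|nj] := eqVneq j n.+1.
    rewrite ej mulr1 /l /lead_coef.
    by rewrite en subrr.
  by rewrite mulr0 subr0 nth_default // en; move: hj nj; lia.
have eq : evp c z q = - (c l * z ^+ n.+1).
  by rewrite /q rmorphB /= ez evpZ rmorphXn /= evpX sub0r.
have -> : z = - ((c l)^-1 * (evp c z q / z ^+ n)).
  by rewrite eq exprS; field; rewrite l0 expf_neq0.
apply: (saN sO); apply: (vring_mul vO); last exact: kpoly_int (evp_kpolyV z0 sq) _ vO OV.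
by rewrite -fmorphV; apply: vring_cst vO _.
Qed.

Variables (s : X) (ts : transc c s).

Lemma kpoly_cst u : kpoly s u -> kpoly s^-1 u -> exists r, u = c r.
Proof.
move=> [p ->] [q e]; have s0 := transc_gen_neq0 ts.
have sp := evp_inv_size (m := 0) ts s0.
have /size1_polyC -> : (size p <= 1)%N by apply: (sp _ q); rewrite expr0 mul1r.
by exists p`_0; rewrite evpC.
Qed.
End Constants.

(** A nonzero constant derivative makes [U] squarefree, so [1 / U] has simple poles only. A solution
    of the Artin-Schreier equation would then be constant, although [U] is not. *)
Section InverseNotASValue.
Variables (k K : fieldType) (c : {rmorphism k -> K}) (two0 : 2 = 0 :> k).
Variables (s : K) (ts : transc c s) (U : {poly k}) (u : k).
Hypotheses (dU : U^`() = u%:P) (u0 : u != 0) (sU : (1 < size U)%N).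
Let twoK : 2 = 0 :> K. Proof. exact: rmorph_two0 c two0. Qed.
Let U0 : U != 0. Proof. by rewrite -size_poly_gt0; lia. Qed.
Let evU : evp c s U != 0. Proof. exact: transc_neq0. Qed.

Lemma inverse_not_AS_value r alpha : ratl c s alpha ->
  alpha ^+ 2 + alpha <> (evp c s U)^-1 + c r.
Proof.
move=> Pa e.
have eU : (alpha ^+ 2 + alpha) * evp c s U = evp c s (1 + r%:P * U).
  by rewrite e rmorphD rmorphM rmorph1 /= evpC; field.
have [||b eb] := AS_no_pole two0 ts Pa.
- move=> p ip; apply: (simple_pole_sep two0 ip _ eU).
  by rewrite dU -alg_polyC coprimepZr ?coprimep1.
- exists (1 + r%:P * U), U; split=> //.
  rewrite (leq_trans (size_polyD _ _)) // geq_max size_poly1 leqW ?(ltnW sU) //=.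
  by rewrite mul_polyC (leq_trans (size_scale_leq _ _)).
have : evp c s ((b ^+ 2 + b)%:P * U - (1 + r%:P * U)) = 0.
  rewrite rmorphB /=; apply/eqP; rewrite subr_eq0; apply/eqP.
  by rewrite -[RHS]eU rmorphM /= evpC eb rmorphD rmorphXn.
move=> /ts /eqP; rewrite subr_eq0 => /eqP h.
have : ((b ^+ 2 + b - r) *: U) = 1 by rewrite scalerBl -!mul_polyC h addrK.
move=> /(congr1 (fun p : {poly k} => size p)); rewrite size_poly1.
have [->|n0] := eqVneq (b ^+ 2 + b - r) 0; first by rewrite scale0r size_poly0.
by rewrite size_scale // => e1; move: sU; rewrite e1.
Qed.
End InverseNotASValue.

(** * The field [k(s, t)] with [t^2 + t = 1 / U(s) + e0] *)

Section Construction.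
Variables (k : fieldType) (two0 : 2 = 0 :> k).
Variables (X : curve_data k) (s t : X) (U : {poly k}) (u e0 : k).
Local Notation c := (cst X).
Local Notation ev := (evp c).
Local Notation P := (ratl c s).
Hypotheses (ts : transc c s) (gt : AS_gen P t).
Hypotheses (dU : U^`() = u%:P) (u0 : u != 0) (sU : (1 < size U)%N).
Hypothesis et : t ^+ 2 + t = (ev s U)^-1 + c e0.
Let twoX : 2 = 0 :> X. Proof. exact: rmorph_two0 c two0. Qed.
Let sP := ratl_subfield c s.
Let gtV : AS_gen (ratl c s^-1) t. Proof. by rewrite ratlV. Qed.
Let tsV := transcV ts.
Let evU : ev s U != 0. Proof. by apply: (transc_neq0 ts); rewrite -size_poly_gt0; lia. Qed.

(** An algebraic [z] is integral in both charts, so its trace is a constant [r]. If [r = 0], then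
    [z] is in [k(s)] and constant for the same reason; otherwise [a / r] would solve the
    Artin-Schreier equation for [1 / U] plus a constant. *)
Lemma algebraic_const z : algebraicOver c z -> exists r, z = c r.
Proof.
move=> az.
have int z' x : algebraicOver c z' -> int_closure x z' by move=> az' O vO _; apply: vring_algebraic.
have ratc z' : algebraicOver c z' -> P z' -> exists r, z' = c r.
  move=> az' Pz; apply: (kpoly_cst ts); apply: int_ratl => //; try exact: int.
  by rewrite ratlV.
have [_ _ /(_ z)[a [b [Pa Pb ez]]]] := gt.
have [r er] : exists r, b = c r.
  apply: (kpoly_cst ts).
    by apply: (int_trace two0 ts gt Pa Pb); rewrite -ez; apply: int.
  by apply: (int_trace two0 tsV gtV (a := a)); rewrite ?ratlV -?ez //; apply: int.
have [r0|r0] := eqVneq r 0.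
  by apply: ratc => //; rewrite ez er r0 rmorph0 mul0r addr0.
have cr : c r != 0 by rewrite fmorph_eq0.
have sA := algebraic_subfield c.
have Ac x : algebraicOver c (c x) by apply: algebraic_id.
have em : z ^+ 2 + c r * z = a ^+ 2 + c r * a + c r ^+ 2 * (t ^+ 2 + t).
  by rewrite ez er; ring.
have [m em'] : exists m, z ^+ 2 + c r * z = c m.
  apply: ratc; first by have := Ac r => ?; sf_tac sA.
  rewrite em; have := ratl_cst c s r; have [Pt _ _] := gt => *; by sf_tac sP.
case: (@inverse_not_AS_value _ _ c two0 s ts U u dU u0 sU (m / r ^+ 2 + e0) (a / c r)).
  by have := ratl_cst c s r => ?; sf_tac sP.
rewrite rmorphD fmorph_div rmorphXn -em' em et.
by field; rewrite cr evU.
Qed.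

Lemma construction_map : exists f : curve_map X (proj_line k), separable_degree2 f.
Proof.
have [f fs] := proj_line_map ts; exists f.
by apply: (@AS_degree2 _ _ _ twoX t); rewrite img_ratl fs.
Qed.

Lemma construction_curve : is_curve X.
Proof.
split; last exact: algebraic_const.
by have [f [df _]] := construction_map; exists 2%N, f.
Qed.

Lemma construction_transc : transc c t.
Proof.
apply/transcP => /algebraic_const[r er]; have [_ nt _] := gt; apply: nt.
by rewrite er; apply: ratl_cst.
Qed.
End Construction.

(** * The derivation [d/ds] from the decomposition [K = K^2 + K^2 s] *)

Section SeparatingDerivation.
Variables (k : fieldType) (two0 : 2 = 0 :> k).
Hypothesis sqrtk : forall a : k, exists b, b ^+ 2 = a.
Variables (X : curve_data k) (s t : X).
Local Notation c := (cst X).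
Local Notation P := (ratl c s).
Hypotheses (ts : transc c s) (gt : AS_gen P t).
Let twoX : 2 = 0 :> X. Proof. exact: rmorph_two0 c two0. Qed.
Let sP := ratl_subfield c s.

Definition sqr_span z := exists a b, z = a ^+ 2 + b ^+ 2 * s.

Lemma sqr_span_subfield : subfield sqr_span.
Proof.
split.
- by exists 1, 0; ring.
- by move=> _ _ [a [b ->]] [a' [b' ->]]; exists (a + a'), (b + b'); ring.
- move=> _ _ [a [b ->]] [a' [b' ->]]; set d := a' ^+ 2 + _.
  have [->|d0] := eqVneq d 0; first by exists 0, 0; rewrite invr0; ring.
  exists ((a * a' + b * b' * s) / d), ((a * b' + b * a') / d).
  apply: (mulIf (expf_neq0 2 d0)).
  transitivity ((a ^+ 2 + b ^+ 2 * s) * d); first by field.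
  transitivity ((a * a' + b * b' * s) ^+ 2 + (a * b' + b * a') ^+ 2 * s); last by field.
  by rewrite /d; ring.
Qed.

Lemma sqr_spanT z : sqr_span z.
Proof.
have sQ := sqr_span_subfield.
have PQ v : P v -> sqr_span v.
  move=> Pv; apply: (ratl_min sQ) Pv.
    by move=> a; have [r <-] := sqrtk a; exists (c r), 0; rewrite rmorphXn; ring.
  by exists 0, 1; ring.
have [Pt _ /(_ z)[a [b [Pa Pb ->]]]] := gt.
have Qt : sqr_span t.
  have -> : t = t ^+ 2 + (t ^+ 2 + t) by ring.
  by apply: (sfD sQ); [exists t, 0; ring|apply: PQ].
by have := PQ _ Pa; have := PQ _ Pb => *; sf_tac sQ.
Qed.

Lemma gen_not_sqr z : z ^+ 2 <> s.
Proof.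
move=> e; have Pz : P z by apply: (AS_sqr sP twoX gt); rewrite e; apply: ratl_gen.
have [p [q [q0 ez]]] := Pz.
have : evp c s ('X * q ^+ 2 - p ^+ 2) = 0.
  rewrite rmorphB rmorphM !rmorphXn /= evpX -{1}e ez.
  by field.
move=> /ts/eqP; rewrite subr_eq0 => /eqP /(congr1 (fun p : {poly k} => size p)).
have qn : q != 0 by apply: contraNneq q0 => ->; rewrite rmorph0.
have [->|pn] := eqVneq p 0.
  by move/eqP; rewrite expr0n size_poly0 size_poly_eq0 mulf_eq0 polyX_eq0 expf_eq0 (negPf qn).
rewrite !expr2 !size_mul ?mulf_neq0 ?polyX_eq0 // size_polyX.
have : (0 < size p)%N by rewrite size_poly_gt0.
have : (0 < size q)%N by rewrite size_poly_gt0.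
by move: (size p) (size q) => a b; lia.
Qed.

Lemma sqr_span_uniq a b a' b' : a ^+ 2 + b ^+ 2 * s = a' ^+ 2 + b' ^+ 2 * s -> b = b'.
Proof.
move=> e; apply/eqP; rewrite -subr_eq0; apply: contraT => n0.
case: (@gen_not_sqr ((a - a') / (b - b'))).
have h : (b - b') ^+ 2 * s = (a - a') ^+ 2.
  transitivity ((a ^+ 2 + b ^+ 2 * s) + a ^+ 2 + b' ^+ 2 * s); first by ring.
  by rewrite e; ring.
by rewrite expr_div_n -h; field.
Qed.

(* [K = K^2 + K^2 s], and [z = a^2 + b^2 s] has derivative [b^2] with respect to [s]. *)
Lemma separating_derivation : exists D0 : derivation X,
  D0 s = 1 /\ forall (D : derivation X) z, D z = D0 z * D s.
Proof.
have [f fP] := choice sqr_spanT; have [d dP] := choice fP.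
pose D z := d z ^+ 2.
have DE a b : D (a ^+ 2 + b ^+ 2 * s) = b ^+ 2.
  by rewrite /D; congr (_ ^+ 2); apply: (@sqr_span_uniq (f (a ^+ 2 + b ^+ 2 * s)) _ a); rewrite -dP.
have dD u v : D (u + v) = D u + D v.
  have [a [b ->]] := sqr_spanT u; have [a' [b' ->]] := sqr_spanT v.
  have -> : a ^+ 2 + b ^+ 2 * s + (a' ^+ 2 + b' ^+ 2 * s)
    = (a + a') ^+ 2 + (b + b') ^+ 2 * s by ring.
  by rewrite !DE; ring.
have dM u v : D (u * v) = D u * v + u * D v.
  have [a [b ->]] := sqr_spanT u; have [a' [b' ->]] := sqr_spanT v.
  have -> : (a ^+ 2 + b ^+ 2 * s) * (a' ^+ 2 + b' ^+ 2 * s)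
    = (a * a' + b * b' * s) ^+ 2 + (a * b' + b * a') ^+ 2 * s by ring.
  by rewrite !DE; ring.
have dc a : D (c a) = 0.
  have [r <-] := sqrtk a; have -> : c (r ^+ 2) = c r ^+ 2 + 0 ^+ 2 * s by rewrite rmorphXn; ring.
  by rewrite DE; ring.
exists (Defs.Derivation dD dM dc); split=> [|D' z] /=.
  have -> : s = 0 ^+ 2 + 1 ^+ 2 * s by ring.
  by rewrite DE; ring.
have [a [b ->]] := sqr_spanT z.
by rewrite DE derD derM !der_sqr; ring.
Qed.
End SeparatingDerivation.

Lemma ord3_cases (i : 'I_3) : [\/ i = 0, i = 1 | i = 1 + 1].
Proof.
case: i => [[|[|[|//]]] h]; [constructor 1|constructor 2|constructor 3]; exact: val_inj.
Qed.

(** * The quartic [upoly] and the quadratics [wpoly] *)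

Section Parametrization.
Variables (k : fieldType) (two0 : 2 = 0 :> k) (g e : 'I_3 -> k).
Hypotheses (g_neq0 : forall i, g i != 0).
Hypotheses (sum_g : g 0 + g 1 + g (1 + 1) = 0) (sum_e : e 0 + e 1 + e (1 + 1) = 0).

Definition delta : k := g 0 * g 1 * g (1 + 1).
Definition kappa : k := g 1 ^+ 2 * e 0 + g 0 ^+ 2 * e 1.
(** From [w_i ^ 2 + w_i = g_i ^ 2 U + e_i] the square of [s = g_1 w_0 + g_0 w_1] is
    [g_1 ^ 2 w_0 + g_0 ^ 2 w_1 + kappa], because [U] cancels. Both equations are linear in [w_0],
    [w_1] with determinant [delta], and [wpoly] is the solution. *)
Definition wpoly i : {poly k} := (g i / delta) *: ('X^2 + g i *: 'X + kappa%:P).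
(** This is [(w_0 ^ 2 + w_0 + e_0) / g_0 ^ 2] expanded in [s]. *)
Definition upoly : {poly k} :=
  delta^-2 *: 'X^4 + ((g 0 ^+ 2 + g 0 * g 1 + g 1 ^+ 2) / delta ^+ 2) *: 'X^2 + delta^-1 *: 'X
  + (kappa ^+ 2 / delta ^+ 2 + kappa / (g 0 * delta) + e 0 / g 0 ^+ 2)%:P.

Let g2 : g (1 + 1) = g 0 + g 1.
Proof. by symmetry; apply: (addr2_eq0 two0). Qed.
Let e2 : e (1 + 1) = e 0 + e 1.
Proof. by symmetry; apply: (addr2_eq0 two0). Qed.

Lemma delta_neq0 : delta != 0.
Proof. by rewrite /delta !mulf_neq0. Qed.

Lemma deriv_upoly : upoly^`() = (delta^-1)%:P.
Proof.
rewrite /upoly !derivD !derivZ !derivXn derivX derivC addr0 alg_polyC.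
have two := poly2_0 two0; rewrite -!mul_polyC; ring.
Qed.

Lemma size_upoly : size upoly = 5%N.
Proof.
have d0 : delta^-2 != 0 by rewrite invr_neq0 ?expf_neq0 ?delta_neq0.
rewrite /upoly -!addrA size_polyDl size_scale ?size_polyXn //.
rewrite (leq_ltn_trans (size_polyD _ _)) // gtn_max.
rewrite (leq_ltn_trans (size_scale_leq _ _)) ?size_polyXn //=.
rewrite (leq_ltn_trans (size_polyD _ _)) // gtn_max.
rewrite (leq_ltn_trans (size_scale_leq _ _)) ?size_polyX //=.
by rewrite (leq_ltn_trans (size_polyC_leq1 _)).
Qed.

Lemma wpoly_sum : wpoly (1 + 1) = wpoly 0 + wpoly 1.
Proof.
have two := poly2_0 two0.
by rewrite /wpoly g2 -!mul_polyC !(polyCM, polyCD); ring.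
Qed.

Lemma wpoly_X : 'X = g 1 *: wpoly 0 + g 0 *: wpoly 1.
Proof.
have two := poly2_0 two0.
transitivity ((g 0 * g 1 / delta * (g 0 + g 1))%:P * 'X : {poly k}).
  suff -> : g 0 * g 1 / delta * (g 0 + g 1) = 1 by rewrite mul1r.
  by rewrite -g2 /delta; field; rewrite !g_neq0.
by rewrite /wpoly -!mul_polyC !(polyCM, polyCD); ring.
Qed.

Lemma wpoly_X2 : 'X^2 = g 1 ^+ 2 *: wpoly 0 + g 0 ^+ 2 *: wpoly 1 + kappa%:P.
Proof.
have two := poly2_0 two0.
have h : g 0 * g 1 / delta * (g 0 + g 1) = 1.
  by rewrite -g2 /delta; field; rewrite !g_neq0.
transitivity ((g 0 * g 1 / delta * (g 0 + g 1))%:P * ('X^2 + kappa%:P) + kappa%:P : {poly k}).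
  by rewrite h mul1r; ring.
by rewrite /wpoly -!mul_polyC !(polyCM, polyCD, expr2); ring.
Qed.

Lemma wpoly_span (q : {poly k}) : (size q <= 3)%N ->
  exists l0 l1 l2, q = l0%:P + l1 *: wpoly 0 + l2 *: wpoly 1.
Proof.
move=> sq; have two := poly2_0 two0.
have -> : q = q`_2 *: 'X^2 + q`_1 *: 'X + (q`_0)%:P.
  apply/polyP => i; rewrite !coefE; case: i => [|[|[|i]]] /=; rewrite ?mulr0 ?mulr1 ?add0r ?addr0 //.
  by rewrite nth_default // (leq_trans sq).
exists (q`_0 + q`_2 * kappa), (q`_1 * g 1 + q`_2 * g 1 ^+ 2), (q`_1 * g 0 + q`_2 * g 0 ^+ 2).
rewrite wpoly_X2 wpoly_X -!mul_polyC !(polyCM, polyCD, expr2).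
by move: (wpoly 0) (wpoly 1) => A B; ring.
Qed.

Lemma wpoly_free l0 l1 l2 : l0%:P + l1 *: wpoly 0 + l2 *: wpoly 1 = 0 ->
  [/\ l0 = 0, l1 = 0 & l2 = 0].
Proof.
move=> h; have d0 := delta_neq0.
have h2 := congr1 (fun p : {poly k} => p`_2) h; have h1 := congr1 (fun p : {poly k} => p`_1) h.
rewrite /= /wpoly !coefE /= in h1 h2.
have {}h2 : l1 * g 0 = l2 * g 1.
  apply: (addr2_eq0 two0); apply: (mulfI (invr_neq0 d0)); rewrite mulr0 -[RHS]h2; ring.
have {}h1 : l1 * g 0 ^+ 2 = l2 * g 1 ^+ 2.
  apply: (addr2_eq0 two0); apply: (mulfI (invr_neq0 d0)); rewrite mulr0 -[RHS]h1; ring.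
have n2 : g 0 + g 1 != 0 by rewrite -g2.
have l20 : l2 = 0.
  have : l2 * g 1 * (g 0 + g 1) = 0.
    transitivity (l1 * g 0 * g 0 + l2 * g 1 ^+ 2); first by rewrite h2; ring.
    by rewrite -mulrA -expr2 h1 addrr2.
  by move/eqP; rewrite !mulf_eq0 (negPf n2) (negPf (g_neq0 1)) !orbF => /eqP.
have l10 : l1 = 0.
  by move/eqP: h2; rewrite l20 mul0r mulf_eq0 (negPf (g_neq0 0)) orbF => /eqP.
by move/eqP: h; rewrite l10 l20 !scale0r !addr0 polyC_eq0 => /eqP.
Qed.

Variables (K : fieldType) (c : {rmorphism k -> K}) (s : K).
Local Notation ev := (evp c).
Let twoK : 2 = 0 :> K. Proof. exact: rmorph_two0 c two0. Qed.

Lemma wpoly_normal i : ev s (wpoly i) ^+ 2 + ev s (wpoly i) = c (g i) ^+ 2 * ev s upoly + c (e i).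
Proof.
have cg j : c (g j) != 0 by rewrite fmorph_eq0.
pose ev' : {rmorphism {poly k} -> K} := evp c s.
have eU : ev s upoly = c (delta^-2) * s ^+ 4
   + c ((g 0 ^+ 2 + g 0 * g 1 + g 1 ^+ 2) / delta ^+ 2) * s ^+ 2 + c delta^-1 * s
   + c (kappa ^+ 2 / delta ^+ 2 + kappa / (g 0 * delta) + e 0 / g 0 ^+ 2).
  by rewrite /upoly !(rmorphD ev') /= evpC !evpZ !(rmorphXn ev') /= !evpX.
have eW j : ev s (wpoly j) = c (g j / delta) * (s ^+ 2 + c (g j) * s + c kappa).
  by rewrite /wpoly evpZ !(rmorphD ev') /= evpC evpZ (rmorphXn ev') /= evpX.
have n2 : c (g 0) + c (g 1) != 0 by rewrite -rmorphD -g2.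
have h0 : ev s (wpoly 0) ^+ 2 + ev s (wpoly 0) = c (g 0) ^+ 2 * ev s upoly + c (e 0).
  rewrite eU eW /kappa /delta g2.
  rewrite !(fmorph_div, fmorphV, rmorphXn, rmorphM, rmorphD) /=.
  have := cg 0; have := cg 1; move: n2.
  move: (c (g 0)) (c (g 1)) (c (e 0)) (c (e 1)) => G0 G1 E0 E1 n n1 n0.
  by field; rewrite n n1 n0.
have h1 : ev s (wpoly 1) ^+ 2 + ev s (wpoly 1) = c (g 1) ^+ 2 * ev s upoly + c (e 1).
  rewrite eU eW /kappa /delta g2.
  rewrite !(fmorph_div, fmorphV, rmorphXn, rmorphM, rmorphD) /=.
  have := cg 0; have := cg 1; move: n2.
  move: (c (g 0)) (c (g 1)) (c (e 0)) (c (e 1)) => G0 G1 E0 E1 n n1 n0.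
  by field; rewrite n n1 n0.
move: h0 h1; move: upoly => V h0 h1.
case: (ord3_cases i) => ->; [exact: h0|exact: h1|].
rewrite wpoly_sum g2 e2 !rmorphD /=.
transitivity ((ev s (wpoly 0) ^+ 2 + ev s (wpoly 0)) + (ev s (wpoly 1) ^+ 2 + ev s (wpoly 1))).
  by ring.
by rewrite h0 h1; ring.
Qed.

End Parametrization.

(** * The regular differentials of the constructed curve *)

Section Genus.
Variables (k : fieldType) (two0 : 2 = 0 :> k) (g e : 'I_3 -> k) (eps : k).
Hypothesis sqrtk : forall a : k, exists b, b ^+ 2 = a.
Hypotheses (g_neq0 : forall i, g i != 0).
Hypotheses (sum_g : g 0 + g 1 + g (1 + 1) = 0) (sum_e : e 0 + e 1 + e (1 + 1) = 0).
Variables (X : curve_data k) (s t : X).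
Local Notation c := (cst X).
Local Notation ev := (evp c).
Local Notation P := (ratl c s).
Local Notation U := (upoly g e).
Local Notation w i := (ev s (wpoly g e i)).
Local Notation A := (quad c 1 eps t).
Hypotheses (ts : transc c s) (gt : AS_gen P t).
Hypothesis et : t ^+ 2 + t = (ev s U)^-1 + c eps.
Let twoX : 2 = 0 :> X. Proof. exact: rmorph_two0 c two0. Qed.
Let sP := ratl_subfield c s.
Let dU : U^`() = ((delta g)^-1)%:P. Proof. exact: deriv_upoly. Qed.
Let d0 : delta g != 0. Proof. exact: delta_neq0. Qed.
Let d1 : (delta g)^-1 != 0. Proof. by rewrite invr_neq0. Qed.
Let cd0 : c (delta g) != 0. Proof. by rewrite fmorph_eq0. Qed.
Let sU : (1 < size U)%N. Proof. by rewrite size_upoly. Qed.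
Let evU : ev s U != 0. Proof. by apply: (transc_neq0 ts); rewrite -size_poly_gt0; lia. Qed.
Let tt : transc c t. Proof. exact: (construction_transc two0 ts gt dU d1 sU et). Qed.

Lemma quad_upoly : A = (ev s U)^-1.
Proof.
rewrite /quad rmorph1 mul1r.
by rewrite et; ring.
Qed.

Lemma wpoly_normal_form i : normal_form c 1 eps 0 (g i) (e i) t (w i).
Proof.
rewrite /normal_form (wpoly_normal two0 g_neq0 sum_g sum_e) quad_upoly invrK.
by rewrite /lin rmorph0 mul0r add0r.
Qed.

Let r0 i : res 1 eps 0 (g i) != 0.
Proof. by rewrite /res expr0n /= !mul0r !add0r mulr1 expf_neq0. Qed.
Let g01 : g 0 + g 1 != 0.
Proof. by rewrite (addr2_eq0 two0 sum_g). Qed.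
Let r01 : res 1 eps (0 + 0) (g 0 + g 1) != 0.
Proof. by rewrite /res addr0 expr0n /= !mul0r !add0r mulr1 expf_neq0. Qed.

Let om0 : differential X := fun D => D t / A.
Let om1 : differential X := fun D => w 0 * (D t / A).
Let om2 : differential X := fun D => w 1 * (D t / A).

Lemma regular_om0 : regular om0.
Proof. exact (regular1 two0 tt (r0 0) (wpoly_normal_form 0)). Qed.
Lemma regular_om1 : regular om1.
Proof. exact (regular2 two0 tt (r0 0) (r0 1) r01 (wpoly_normal_form 0) (wpoly_normal_form 1)). Qed.
Lemma regular_om2 : regular om2.
Proof.
have r10 : res 1 eps (0 + 0) (g 1 + g 0) != 0 by rewrite [g 1 + _]addrC.
exact (regular2 two0 tt (r0 1) (r0 0) r10 (wpoly_normal_form 1) (wpoly_normal_form 0)).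
Qed.

(** As [1 / A = U] and [U' = 1 / delta], the three differentials are [ds / (delta U)] times [1],
    [w_0], [w_1]. *)
Lemma der_t (D : derivation X) : D t / A = D s / (c (delta g) * ev s U).
Proof.
have : D (t ^+ 2 + t) = D ((ev s U)^-1 + c eps) by rewrite et.
rewrite !derD der_sqr // der_cst add0r addr0 derV // der_evp dU evpC fmorphV => ->.
by rewrite quad_upoly; field; rewrite [_ U != 0]evU cd0 oner_neq0.
Qed.

(** Every regular differential is [q ds / U] with [deg q <= 2], by [regular_bound] with [m = 4]. The
    polynomials [1], [w_0], [w_1] are a basis of this space of [q]. *)
Lemma construction_genus : has_genus X 3.
Proof.
have [D0 [D0s D0P]] := separating_derivation two0 sqrtk ts gt.
have D0s0 : D0 s != 0 by rewrite D0s oner_eq0.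
pose om (i : 'I_3) : differential X := if i == 0 then om0 else if i == 1 then om1 else om2.
exists om; split=> [i|v rv].
  by case: (ord3_cases i) => ->; rewrite /om /=; [exact: regular_om0|exact: regular_om1|exact: regular_om2].
have [q sq eq] : exists2 q : {poly k}, (size q < 4)%N & v D0 / D0 s * ev s U = ev s q.
  have sR := @int_subalg _ X.
  have kp x n (p : {poly k}) : x != 0 -> (size p <= n.+1)%N -> int_closure x^-1 (evp c x p / x ^+ n).
    by move=> x0 sp; apply: kpoly_int; apply: evp_kpolyV.
  have s0 := transc_gen_neq0 ts.
  have eb (V : {poly k}) : ev s (V + eps *: V ^+ 2) = ev s V + c eps * ev s V ^+ 2.
    by rewrite rmorphD /= evpZ rmorphXn.
  (* [U t] is a root of [Y ^ 2 + U Y + U + eps U ^ 2]. The coefficients have degree at most [4] and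
     [8], so that [U t / s ^ 4] is integral in the chart [s^-1]. *)
  have h1 : int_closure s (0 + ev s U * t).
    apply: (int_integral2 (a := ev s U) (b := ev s (U + eps *: U ^+ 2))).
    - by apply: kpoly_int; exists U.
    - by apply: kpoly_int; exists (U + eps *: U ^+ 2).
    - rewrite eb add0r.
      transitivity (ev s U ^+ 2 * (t ^+ 2 + t) + (ev s U + c eps * ev s U ^+ 2)); first by ring.
      by rewrite et; field.
  have h2 : int_closure s^-1 ((0 + ev s U * t) / s ^+ 4).
    apply: (int_integral2 (a := ev s U / s ^+ 4) (b := ev s (U + eps *: U ^+ 2) / s ^+ 8)).
    - by apply: kp => //; rewrite size_upoly.
    - apply: kp => //; rewrite (leq_trans (size_polyD _ _)) // geq_max size_upoly //=.
      rewrite (leq_trans (size_scale_leq _ _)) // expr2.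
      by rewrite (leq_trans (size_polyMleq _ _)) // size_upoly.
    - rewrite eb add0r.
      transitivity ((ev s U ^+ 2 * (t ^+ 2 + t) + (ev s U + c eps * ev s U ^+ 2)) / s ^+ 8).
        by field.
      by rewrite et; field; rewrite s0 evU.
  exact: (regular_bound two0 ts gt D0s0 rv _ (sf0 sP) h1 h2).
have [l0 [l1 [l2 eql]]] := wpoly_span two0 e g_neq0 sum_g sq.
(* A regular [v] is a combination of terms [f * D u], and every [D] is [D s] times [D0]. *)
have vD D : v D = D s * v D0.
  have [O vO] := exists_valuation ts.
  have [n [f [u [_ _ h]]]] := rv O vO.
  rewrite !h mulr_sumr; apply: eq_bigr => i _.
  by rewrite (D0P D); ring.
have omE D (l : 'rV[k]_3) : \sum_(i < 3) c (l 0 i) * om i D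
   = (c (l 0 0) + c (l 0 1) * w 0 + c (l 0 (1 + 1)) * w 1) * (D s / (c (delta g) * ev s U)).
  rewrite (@ord3_sum _ _ 0 1 (1 + 1)) // /om /= /om0 /om1 /om2 der_t; ring.
pose L : 'rV[k]_3 := \row_i (delta g * (if i == 0 then l0 else if i == 1 then l1 else l2)).
have cM l : c (delta g * l) = c (delta g) * c l by rewrite rmorphM.
have [E0 E1 E2] : [/\ c (L 0 0) = c (delta g) * c l0, c (L 0 1) = c (delta g) * c l1
    & c (L 0 (1 + 1)) = c (delta g) * c l2].
  by rewrite !mxE -!cM.
have evl m0 m1 m2 (A B : {poly k}) : ev s (m0%:P + m1 *: A + m2 *: B)
   = c m0 + c m1 * ev s A + c m2 * ev s B.
  by rewrite !rmorphD /= evpC !evpZ.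
have evq : ev s q = c l0 + c l1 * w 0 + c l2 * w 1.
  by rewrite eql evl.
have vL D : v D = \sum_(i < 3) c (L 0 i) * om i D.
  rewrite omE E0 E1 E2 vD.
  have -> : v D0 = (c l0 + c l1 * w 0 + c l2 * w 1) / ev s U.
    by rewrite -evq -eq D0s divr1 mulfK.
  by field; rewrite cd0 [_ U != 0]evU.
exists L; split=> // L' vL'.
have : ev s ((L 0 0 - L' 0 0)%:P + (L 0 1 - L' 0 1) *: wpoly g e 0
    + (L 0 (1 + 1) - L' 0 (1 + 1)) *: wpoly g e 1) = 0.
  have := vL D0; rewrite (vL' D0) !omE D0s mul1r => /(mulIf (invr_neq0 (mulf_neq0 cd0 evU))) h.
  rewrite evl !rmorphB /=.
  transitivity ((c (L 0 0) + c (L 0 1) * w 0 + c (L 0 (1 + 1)) * w 1)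
    + (c (L' 0 0) + c (L' 0 1) * w 0 + c (L' 0 (1 + 1)) * w 1)); first by ring.
  by rewrite h addrr2.
move=> /ts /(wpoly_free two0 g_neq0 sum_g)[/subr0_eq h0 /subr0_eq h1 /subr0_eq h2].
apply/rowP => i; case: (ord3_cases i) => ->; [exact: h0|exact: h1|exact: h2].
Qed.
End Genus.

Lemma standard_form_nonrational (k K : fieldType) (c : {rmorphism k -> K}) (two0 : 2 = 0 :> k)
    (t w : K) eps g e : transc c t -> g != 0 -> normal_form c 1 eps 0 g e t w -> ~ ratl c t w.
Proof.
move=> tt g0 nf Pw; have twoK := rmorph_two0 c two0.
have [||r er] := AS_no_pole two0 tt Pw.
- by move=> p ip; have := normal_form_simple two0 tt nf ip.
- by have := normal_form_simple_oo two0 tt nf.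
have A0 : quad c 1 eps t != 0 by apply: quad_neq0.
pose m := r ^+ 2 + r + e.
have h : c m * quad c 1 eps t = c (g ^+ 2).
  have em : c m = c g ^+ 2 / quad c 1 eps t.
    have -> : c m = (w ^+ 2 + w) + c e by rewrite /m er !rmorphD rmorphXn.
    by rewrite nf /lin rmorph0 mul0r add0r; ring.
  by rewrite em divfK // rmorphXn.
have : evp c t (m%:P * (1 *: 'X^2 + 'X + eps%:P) - (g ^+ 2)%:P) = 0.
  by rewrite rmorphB rmorphM /= -quad_evp !evpC h subrr.
move=> /tt /(congr1 (fun p : {poly k} => (p`_1, p`_0))).
rewrite !coefB !coefCM !coefD coefZ coefXn coefX !coefC /= coefZ coefXn coefX /= !mulr0 !add0r.
rewrite addr0 mulr1 subr0 => -[-> /eqP].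
by rewrite mul0r sub0r oppr_eq0 expf_eq0 (negPf g0) andbF.
Qed.

Section Lifting.
Variables (k : fieldType) (two0 : 2 = 0 :> k).

Lemma pullback_normal_value (X Y : curve_data k) (f : curve_map X Y) a d al ga e y :
  pullback f (lin (cst Y) al ga y ^+ 2 / quad (cst Y) a d y + cst Y e)
  = lin (cst X) al ga (pullback f y) ^+ 2 / quad (cst X) a d (pullback f y) + cst X e.
Proof.
by rewrite rmorphD fmorph_div rmorphXn /= !lin_evp !quad_evp !pullback_evp pullback_cst.
Qed.

Variables (X Y : curve_data k) (h : curve_map X (proj_line k)).
Variables (a d al ga e : k) (w : X) (T W : Y).
Hypotheses (nX : normal_form (cst X) a d al ga e (coordinate h) w).
Hypotheses (nY : normal_form (cst Y) a d al ga e T W).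
Hypotheses (tT : transc (cst Y) T) (gW : AS_gen (ratl (cst Y) T) W).

Lemma lift_cover : exists (b : curve_map Y (proj_line k)) (f : curve_map X Y),
  [/\ AS_gen (img (pullback b)) W,
      forall u, pullback f (pullback b u) = pullback h u
    & img (pullback f) = span2 (ratl (cst X) (coordinate h)) w].
Proof.
have [b bT] := proj_line_map tT.
have gb : AS_gen (img (pullback b)) W by rewrite img_ratl bT.
pose Z : proj_line k := FracField.tofrac 'X.
pose F := lin (cst (proj_line k)) al ga Z ^+ 2 / quad (cst (proj_line k)) a d Z + cst (proj_line k) e.
have twoL : 2 = 0 :> proj_line k := rmorph_two0 (cst (proj_line k)) two0.
have [||phi [phib phiW]] := AS_lift (F := F) (chi := pullback h) (y2 := w) twoL gb.
- by rewrite pullback_normal_value -/(coordinate b) bT.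
- by rewrite pullback_normal_value -/(coordinate h).
have phic r : phi (cst Y r) = cst X r by rewrite -(pullback_cst b) phib pullback_cst.
exists b, (CurveMap phic); split=> //=.
apply/funext => z; apply/propext; rewrite -img_ratl; split.
  move=> [u ->]; have [_ _ /(_ u)[_ [_ [[p ->] [q ->] ->]]]] := gb.
  exists (pullback h p), (pullback h q); split; [by exists p|by exists q|].
  by rewrite rmorphD rmorphM phiW !phib.
move=> [_ [_ [[p ->] [q ->] ->]]].
by exists (pullback b p + pullback b q * W); rewrite rmorphD rmorphM phiW !phib.
Qed.
End Lifting.

(** * The three maps of degree two from the constructed curve *)

Section Cover.
Variables (k : fieldType) (two0 : 2 = 0 :> k) (g e : 'I_3 -> k) (eps : k).
Hypotheses (g_neq0 : forall i, g i != 0).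
Hypotheses (sum_g : g 0 + g 1 + g (1 + 1) = 0) (sum_e : e 0 + e 1 + e (1 + 1) = 0).
Variables (X : curve_data k) (s t : X).
Local Notation c := (cst X).
Local Notation ev := (evp c).
Local Notation w i := (ev s (wpoly g e i)).
Hypotheses (ts : transc c s) (gt : AS_gen (ratl c s) t).
Hypothesis et : t ^+ 2 + t = (ev s (upoly g e))^-1 + c eps.
Let twoX : 2 = 0 :> X. Proof. exact: rmorph_two0 c two0. Qed.
Let tt : transc c t.
Proof.
have d1 : (delta g)^-1 != 0 by rewrite invr_neq0 // delta_neq0.
have sU : (1 < size (upoly g e))%N by rewrite size_upoly.
exact: (construction_transc two0 ts gt (deriv_upoly two0 g e) d1 sU et).
Qed.
Let sPt := ratl_subfield c t.
Let nf i := wpoly_normal_form two0 g_neq0 sum_g sum_e et i.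
Let nP i : ~ ratl c t (w i).
Proof. exact (standard_form_nonrational two0 tt (g_neq0 i) (nf i)). Qed.
Let Pf i : ratl c t (w i ^+ 2 + w i).
Proof.
rewrite (nf i); have := ratl_quad c 1 eps t; have := ratl_lin c 0 (g i) t.
by have := ratl_cst c t (e i) => *; sf_tac sPt.
Qed.

Lemma wpoly_third i j : i != j -> exists l, w i + w j = w l.
Proof.
have sumw : w (1 + 1) = w 0 + w 1 by rewrite (wpoly_sum two0 e sum_g) rmorphD.
case: (ord3_cases i) => ->; case: (ord3_cases j) => -> // _.
- by exists (1 + 1); rewrite sumw.
- by exists 1; rewrite sumw; ring.
- by exists (1 + 1); rewrite sumw; ring.
- by exists 0; rewrite sumw; ring.
- by exists 1; rewrite sumw; ring.
- by exists 0; rewrite sumw; ring.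
Qed.

Lemma wpoly_not_span i j : i != j -> ~ span2 (ratl c t) (w i) (w j).
Proof.
move=> nij [a [b [Pa Pb ej]]].
have h : ratl c t ((a + b * w i) ^+ 2 + (a + b * w i)) by rewrite -ej.
have [b0|b1] := AS_linear sPt twoX (Pf i) (@nP i) Pa Pb h.
  by apply: (@nP j); rewrite ej b0 mul0r addr0.
have [l el] := wpoly_third nij; apply: (@nP l).
have -> : w l = a by rewrite -el ej b1; ring.
by [].
Qed.

(** A field containing [w_i] and [w_j] contains their sum, which is the third [w], hence also
    [s = g_1 w_0 + g_0 w_1]; together with [t] this generates everything. *)
Lemma wpoly_span_gen i j : i != j -> AS_gen (span2 (ratl c t) (w i)) (w j).
Proof.
move=> nij.
have sPi : subfield (span2 (ratl c t) (w i)) by apply: span2_subfield.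
have Pfj : span2 (ratl c t) (w i) (w j ^+ 2 + w j) by apply: (span2_base sPt).
split=> //; first exact: wpoly_not_span.
have sQ : subfield (span2 (span2 (ratl c t) (w i)) (w j)).
  by apply: span2_subfield => //; apply: wpoly_not_span.
set Q := span2 _ _ in sQ; move=> z; suff : Q z by [].
have Qt v : ratl c t v -> Q v by move=> h; apply: (span2_base sPi); apply: (span2_base sPt).
have Qc r : Q (c r) by apply/Qt/ratl_cst.
have Qwi : Q (w i) by apply: (span2_base sPi); apply: span2_gen.
have Qwj : Q (w j) by apply: span2_gen.
have Qw l : Q (w l).
  have [->|li] := eqVneq l i; first by [].
  have [->|lj] := eqVneq l j; first by [].
  have [m em] := wpoly_third nij.
  have -> : l = m.
    apply/eqP; apply: contraT => lm.
    have mi : m != i.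
      apply: contraTneq isT => mi; case: (@nP j).
      have -> : w j = w i + w i by rewrite -{1}mi -em; ring.
      by rewrite addrr2 //; apply: sf0.
    have mj : m != j.
      apply: contraTneq isT => mj; case: (@nP i).
      have -> : w i = w j + w j by rewrite -{1}mj -em; ring.
      by rewrite addrr2 //; apply: sf0.
    by move: nij li lj lm mi mj; case: (ord3_cases i) => ->; case: (ord3_cases j) => ->;
       case: (ord3_cases l) => ->; case: (ord3_cases m) => ->.
  by rewrite -em; apply: (sfD sQ).
have Qs : Q s.
  have -> : s = c (g 1) * w 0 + c (g 0) * w 1.
    by rewrite -{1}(evpX c s) {1}(wpoly_X two0 e g_neq0 sum_g) rmorphD /= !evpZ.
  by have := Qw 0; have := Qw 1; have := Qc (g 0); have := Qc (g 1) => *; sf_tac sQ.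
have Qr v : ratl c s v -> Q v by apply: ratl_min.
have [_ _ /(_ z)[a [b [/Qr Pa /Qr Pb ->]]]] := gt.
by have := Qt _ (ratl_gen c t) => ?; sf_tac sQ.
Qed.

Lemma construction_maps (Y : 'I_3 -> curve_data k) :
  (forall i, exists T W : Y i, [/\ transc (cst (Y i)) T, AS_gen (ratl (cst (Y i)) T) W
    & normal_form (cst (Y i)) 1 eps 0 (g i) (e i) T W]) ->
  exists (f : forall i, curve_map X (Y i)) (b : forall i, curve_map (Y i) (proj_line k)),
    [/\ forall i, separable_degree2 (f i), forall i, separable_degree2 (b i),
      forall i j, pullback (f i) \o pullback (b i) =1 pullback (f j) \o pullback (b j)
    & forall i j, i != j ->
        ~ (forall u : Y i, exists v : Y j, pullback (f i) u = pullback (f j) v)].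
Proof.
move=> models; have [h ht] := proj_line_map tt.
have lift i : exists bf : curve_map (Y i) (proj_line k) * curve_map X (Y i),
    [/\ exists W, AS_gen (img (pullback bf.1)) W,
      forall u, pullback bf.2 (pullback bf.1 u) = pullback h u
    & img (pullback bf.2) = span2 (ratl c t) (w i)].
  have [T [W [tT gW nW]]] := models i.
  have nX : normal_form c 1 eps 0 (g i) (e i) (coordinate h) (w i) by rewrite ht.
  have [b [f [h1 h2 h3]]] := lift_cover two0 nX nW tT gW.
  by exists (b, f); split=> //=; [exists W|rewrite h3 ht].
pose bf i := projT1 (cid (lift i)); have bfP i := projT2 (cid (lift i)).
exists (fun i => (bf i).2), (fun i => (bf i).1); split.
- move=> i; have [j nij] : exists j : 'I_3, i != j.
    by case: (ord3_cases i) => ->; [exists 1|exists 0|exists 0].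
  have [_ _ im] := bfP i.
  by apply: (AS_degree2 twoX (y := w j)); rewrite im; apply: wpoly_span_gen.
- move=> i; have [[W gW] _ _] := bfP i.
  exact: (AS_degree2 (rmorph_two0 (cst (Y i)) two0) gW).
- move=> i j u; have [_ hi _] := bfP i; have [_ hj _] := bfP j.
  exact (etrans (hi u) (esym (hj u))).
- move=> i j nij hij; have nji : j != i by rewrite eq_sym.
  have [_ _ imi] := bfP i; have [_ _ imj] := bfP j.
  apply: (wpoly_not_span nji); rewrite -imj.
  have : img (pullback (bf i).2) (w i) by rewrite imi; apply: span2_gen.
  by move=> [u ->]; apply: hij.
Qed.

Lemma construction_cover (E : 'I_3 -> elliptic_curve k) :
  (forall i, exists T W : ell_curve (E i),
    [/\ transc (cst (ell_curve (E i))) T, AS_gen (ratl (cst (ell_curve (E i))) T) W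
      & normal_form (cst (ell_curve (E i))) 1 eps 0 (g i) (e i) T W]) ->
  inhabited (artin_schreier_cover E X).
Proof.
move=> /construction_maps[f [b [hf hb hc hd]]].
exact: inhabits (ArtinSchreierCover hf hb hc hd).
Qed.
End Cover.

Lemma construction_exists (k : fieldType) (two0 : 2 = 0 :> k) (U : {poly k}) (u eps : k) :
  U^`() = u%:P -> u != 0 -> (1 < size U)%N ->
  exists (X : curve_data k) (s t : X), [/\ transc (cst X) s, AS_gen (ratl (cst X) s) t
    & t ^+ 2 + t = (evp (cst X) s U)^-1 + cst X eps].
Proof.
move=> dU u0 sU.
pose f0 : curve_map (proj_line k) (proj_line k) := @CurveMap k (proj_line k) (proj_line k) idfun (fun=> erefl).
have tZ := @coordinate_transc _ _ f0; have imZ := img_ratl f0.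
set Z := coordinate f0 in tZ imZ.
have twoL : 2 = 0 :> proj_line k := rmorph_two0 (cst (proj_line k)) two0.
have [K [phi [t [gt et]]]] := AS_exists (F := (evp (cst (proj_line k)) Z U)^-1 + cst (proj_line k) eps) twoL
  (fun z => inverse_not_AS_value two0 tZ dU u0 sU (r := eps) (alpha := z)
     ltac:(rewrite -imZ; by exists z)).
pose X := CurveData (phi \o cst (proj_line k)).
pose f : curve_map X (proj_line k) := @CurveMap k X (proj_line k) phi (fun=> erefl).
exists X, (coordinate f), t; split; [exact: coordinate_transc| by rewrite -img_ratl|].
have -> : coordinate f = pullback f Z by [].
by rewrite et rmorphD fmorphV -(pullback_evp f).
Qed.

(** * Common constants for three curves, and the equivalence *)

Section Models.
Variables (k : finFieldType) (two0 : 2 = 0 :> k).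

Definition has_model (Y : curve_data k) (g eps e : k) := exists T W : Y,
  [/\ transc (cst Y) T, AS_gen (ratl (cst Y) T) W & normal_form (cst Y) 1 eps 0 g e T W].

(** [M eps e] collects the pairs of constants realized by models of [E]. The eighth root [g] is
    forced by [res 1 eps 0 g = g ^ 2], a fourth root of [1 / j]. *)
Lemma ell_models (E : elliptic_curve k) : a1 E != 0 ->
  exists d : k * k * (k -> k -> Prop), let: (g, A2, M) := d in
  [/\ g != 0 /\ g ^+ 8 = (j_invariant E)^-1,
      forall eps e, M eps e -> has_model (ell_curve E) g eps e,
      M 0 A2,
      exists eps e, [/\ ~ AS_value eps, ~ AS_value (e + A2) & M eps e]
    & forall eps e u v, M eps e -> AS_value u -> AS_value v -> M (eps + u) (e + v)].
Proof.
move=> a1E; have sqrtk := sqrt_finite two0.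
have [A2 [x [y [exy tx genK]]]] := ell_normalized two0 a1E.
have j0 : (j_invariant E)^-1 != 0.
  by rewrite j_invariantV // mulf_neq0 ?disc_neq0 // invr_neq0 // expf_neq0.
have [r1 e1] := sqrtk (j_invariant E)^-1; have [r2 e2] := sqrtk r1; have [g eg] := sqrtk r2.
have g8 : (g ^+ 2) ^+ 4 = (j_invariant E)^-1 by rewrite -e1 -e2 -eg -!exprM.
have g0 : g != 0 by apply: contraNneq j0 => z; rewrite -g8 z expr0n /= expr0n.
rewrite -g8 in exy *.
pose M eps e := exists T W, presents (cst (ell_curve E)) ((g ^+ 2) ^+ 4) x y T 1 eps 0 g e W.
have [T [W pr]] := model_split two0 g0 exy tx.
exists (g, A2, M); split; first by rewrite -exprM.
- move=> eps e [T' [W' pr']]; exists T', W'; split.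
  + exact (presents_transc tx pr').
  + exact (presents_AS_gen two0 sqrtk (expf_neq0 4 (expf_neq0 2 g0)) exy tx genK pr').
  + by case: pr'.
- by exists T, W.
- have [T' [eps [e [W' [h1 h2 h3]]]]] := model_twisted two0 g0 exy tx.
  by exists eps, e; split=> //; exists T', W'.
- move=> eps e u v [T' [W' pr']] [tau <-] [om <-].
  exists (T' + cst _ tau), (W' + cst _ om).
  exact (presents_shift two0 tau om pr').
Qed.

(** Modulo Artin-Schreier values, each curve realizes the class of [(0, A_i)] and the class in which
    both entries are changed. Changing all three curves at once keeps the first entries equal and,
    three being odd, changes the class of the sum of the [e_i]; so one of the two choices has a sum
    that a shift of [e_0] makes zero. *)
Lemma common_models (M : 'I_3 -> k -> k -> Prop) (A : 'I_3 -> k) :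
  (forall i, M i 0 (A i)) ->
  (forall i, exists eps e, [/\ ~ AS_value eps, ~ AS_value (e + A i) & M i eps e]) ->
  (forall i eps e u v, M i eps e -> AS_value u -> AS_value v -> M i (eps + u) (e + v)) ->
  exists eps (e : 'I_3 -> k), e 0 + e 1 + e (1 + 1) = 0 /\ forall i, M i eps (e i).
Proof.
move=> split tw shift; pose S := A 0 + A 1 + A (1 + 1).
have fix_sum eps (e : 'I_3 -> k) : (forall i, M i eps (e i)) -> AS_value (e 0 + e 1 + e (1 + 1)) ->
    exists eps (e : 'I_3 -> k), e 0 + e 1 + e (1 + 1) = 0 /\ forall i, M i eps (e i).
  set S' := e 0 + _ + _ => hM hS; exists eps, (fun i => e i + if i == 0 then S' else 0).
  split=> [|i]; first by rewrite /= /S'; ring.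
  rewrite -[eps]addr0; apply: shift => //; first exact: AS_value0.
  by case: ifP => _ //; apply: AS_value0.
have [hS|hS] := pselect (AS_value S); first exact: fix_sum split hS.
have [f fP] := choice tw; have [e eP] := choice fP.
apply: (fix_sum (f 0) e) => [i|].
  have [n1 _ Mi] := eP i; have [n0 _ _] := eP 0.
  have -> : f 0 = f i + (f i + f 0) by ring.
  rewrite -[e i]addr0; apply: shift => //; last exact: AS_value0.
  exact: AS_value_index2.
have n i : ~ AS_value (e i + A i) by case: (eP i).
have -> : e 0 + e 1 + e (1 + 1)
   = ((e 0 + A 0) + (e 1 + A 1)) + ((e (1 + 1) + A (1 + 1)) + S) by rewrite /S; ring.
by apply: AS_valueD => //; apply: AS_value_index2.
Qed.
End Models.

Theorem theorem3p1 (k : finFieldType) (n : nat) (hk : #|k| = (2 ^ n)%N)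
    (E : 'I_3 -> elliptic_curve k) (hE : forall i, ordinary (E i)) :
  (exists C : curve_data k,
     [/\ is_curve C, has_genus C 3, hyperelliptic C
       & inhabited (artin_schreier_cover E C)])
  <-> \sum_(i < 3) (j_invariant (E i))^-1 = 0.
Proof.
have two0 := two0_card hk; have sqrtk := sqrt_finite two0.
have a1E i : a1 (E i) != 0 by apply: ordinary_a1.
split=> [[C [_ gC [_ hC] [cov]]]|sum_j]; first exact (cover_sum_j two0 a1E cov gC hC).
have [d dP] := choice (fun i => ell_models two0 (a1E i)).
pose g i := (d i).1.1; pose A i := (d i).1.2; pose M i := (d i).2.
have {}dP i : [/\ g i != 0 /\ g i ^+ 8 = (j_invariant (E i))^-1,
      forall eps e, M i eps e -> has_model (ell_curve (E i)) (g i) eps e,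
      M i 0 (A i),
      exists eps e, [/\ ~ AS_value eps, ~ AS_value (e + A i) & M i eps e]
    & forall eps e u v, M i eps e -> AS_value u -> AS_value v -> M i (eps + u) (e + v)].
  by have := dP i; rewrite /g /A /M; case: (d i) => [[]].
have g0 i : g i != 0 by case: (dP i) => -[].
have sum_g : g 0 + g 1 + g (1 + 1) = 0.
  suff : (g 0 + g 1 + g (1 + 1)) ^+ 8 = 0 by move/eqP; rewrite expf_eq0 => /eqP.
  transitivity (g 0 ^+ 8 + g 1 ^+ 8 + g (1 + 1) ^+ 8); first by ring.
  rewrite -[RHS]sum_j (@ord3_sum _ _ 0 1 (1 + 1)) //.
  by case: (dP 0) => -[_ ->] _ _ _ _; case: (dP 1) => -[_ ->] _ _ _ _; case: (dP (1 + 1)) => -[_ ->].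
have [||| eps [e [sum_e hM]]] := common_models two0 (M := M) (A := A); try by move=> i; case: (dP i).
have d1 : (delta g)^-1 != 0 by rewrite invr_neq0 // delta_neq0.
have dU := deriv_upoly two0 g e.
have sU : (1 < size (upoly g e))%N by rewrite size_upoly.
have [X [s [t [ts gt et]]]] := construction_exists two0 eps dU d1 sU.
have genus := construction_genus two0 sqrtk g0 sum_g sum_e ts gt et.
exists X; split=> //.
- exact: (construction_curve two0 ts gt dU d1 sU et).
- by split; [exists 3%N|exact: (construction_map two0 ts gt)].
- apply: (construction_cover two0 g0 sum_g sum_e ts gt et) => i.
  by case: (dP i) => _ h _ _ _; apply: h; apply: hM.
Qed.
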